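(* Let $1\le p\le\infty$ and let $\mathcal{M}$ be a closed (weak-$*$ closed if $p=\infty$) real-linear subspace of $L^p_r(\mathbb{T})$ with $z\mathcal{M}\subseteq\mathcal{M}$. Then: (1) $\mathcal{M}$ is simply invariant (i.e. $z\mathcal{M}\neq\mathcal{M}$) if and only if $\mathcal{M}=\phi H^p_r(\mathbb{T})$ for some unimodular function $\phi$ on $\mathbb{T}$ with $\phi=\phi^\ast$. (2) $\mathcal{M}$ is doubly invariant (i.e. $z\mathcal{M}=\mathcal{M}$) if and only if there exists a measurable subset $E\subseteq\mathbb{T}$ such that $E=E^\ast$ and $\mathcal{M}=\chi_E L^p_r(\mathbb{T})$.
   Context: $\mathbb{T}$ is the unit circle with normalized Lebesgue measure and $z$ is the identity function on $\mathbb{T}$. For $f\in L^p(\mathbb{T})$ put $f^\ast(\zeta)=\overline{f(\overline{\zeta})}$; then $\widehat{f^\ast}(n)=\overline{\hat f(n)}$. $L^p_r(\mathbb{T})=\{f\in L^p(\mathbb{T}): f=f^\ast\}$ is the real Banach space of functions in $L^p(\mathbb{T})$ with all Fourier coefficients real. $H^p(\mathbb{T})=\{f\in L^p(\mathbb{T}):\hat f(n)=0 \text{ for } n<0\}$ and $H^p_r(\mathbb{T})=H^p(\mathbb{T})\cap L^p_r(\mathbb{T})$. For $p=\infty$ all closures are in the weak-$*$ topology of $L^\infty=(L^1)^\ast$. ''Unimodular'' means measurable with $|\phi|=1$ a.e. For $E\subseteq\mathbb{T}$, $E^\ast=\{\overline{\lambda}:\lambda\in E\}$; $\chi_E$ is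 the indicator function of $E$. Functions and sets are identified modulo null sets. *)

(* Defs.v *)
From HB Require Import structures.
From mathcomp Require Import all_boot all_order all_algebra.
From mathcomp Require Import all_classical all_reals all_analysis.
From mathcomp Require Import measurable_realfun.
From mathcomp.real_closed Require Import complex.

Set Implicit Arguments.
Unset Strict Implicit.
Unset Printing Implicit Defensive.

Import Order.TTheory GRing.Theory Num.Theory.
Import numFieldNormedType.Exports.

Local Open Scope classical_set_scope.
Local Open Scope ring_scope.
Local Open Scope complex_scope.

Record circle (R : realType) := Circle {
  circle_val :> R[i];
  circle_valP : `|circle_val| == 1 }.

HB.instance Definition _ (R : realType) := [isSub for @circle_val R].
HB.instance Definition _ (R : realType) := [Choice of circle R by <:].

Section circle.
Context {R : realType}.
Implicit Types (x : circle R) (t : R).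

Lemma circle_one_subproof : `|1 : R[i]| == 1.
Proof. by rewrite normr1. Qed.

Definition circle_one : circle R := Circle circle_one_subproof.

HB.instance Definition _ := isPointed.Build (circle R) circle_one.

Lemma circle_conj_subproof x : `|(x : R[i])^*| == 1.
Proof. by rewrite normcJ; exact: circle_valP. Qed.

Definition circle_conj x : circle R := Circle (circle_conj_subproof x).

Lemma expi_subproof t : `|cos t +i* sin t| == 1.
Proof. by rewrite normc_def /= cos2Dsin2 sqrtr1. Qed.

Definition expi t : circle R := Circle (expi_subproof t).

Definition circle_coord x : R * R := (complex.Re x, complex.Im x).

End circle.

(* The trace on the circle of the Borel sigma-algebra of the plane. *)
HB.instance Definition _ (R : realType) :=
  Measurable.copy (circle R) (g_sigma_algebra_preimageType (@circle_coord R)).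

Section circle_measure.
Context {R : realType}.

Lemma measurable_expi : measurable_fun [set: R] (@expi R).
Proof.
move=> _ _ [B mB <-]; rewrite setTI -comp_preimage -[X in measurable X]setTI.
have mc : measurable_fun [set: R] (fun t : R => (cos t, sin t)).
  by apply: measurable_fun_pair; apply: continuous_measurable_fun;
    [exact: continuous_cos|exact: continuous_sin].
by have := mc measurableT _ mB; rewrite setTI.
Qed.

Definition expi_mfun : {mfun measurableTypeR R >-> circle R} :=
  HB.pack (@expi R)
    (@isMeasurableFun.Build _ _ (measurableTypeR R) _ (@expi R) measurable_expi).

Lemma two_pi_gt0 : 0 < pi *+ 2 :> R.
Proof. by rewrite pmulrn_lgt0 // pi_gt0. Qed.

(* Normalized arc length: the law of e^{it} for t uniform on [0, 2 pi]. *)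
Definition circle_measure : probability (circle R) R :=
  distribution (uniform_prob two_pi_gt0) expi_mfun.

End circle_measure.

Section function_spaces.
Context {R : realType}.
Implicit Types (f g phi : circle R -> R[i]) (p : \bar R).
Implicit Types (A M : set (circle R -> R[i])).

Local Notation m := (@circle_measure R).

Definition cmeasurable f :=
  measurable_fun setT (fun x => complex.Re (f x)) /\
  measurable_fun setT (fun x => complex.Im (f x)).

Definition cLnorm p f : \bar R := Lnorm m p (fun x => (Normc.normc (f x))%:E).

Definition cintegral f : R[i] :=
  (\int[m]_x complex.Re (f x)) +i* (\int[m]_x complex.Im (f x)).

(* Elements of L^p are represented by functions; classes modulo null sets are
   rendered by sets of functions that are saturated for a.e. equality. *)
Definition Lp p : set (circle R -> R[i]) :=
  [set f | cmeasurable f /\ (cLnorm p f < +oo)%E].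

Definition star f : circle R -> R[i] := fun x => (f (circle_conj x))^*.

Definition fourier f (n : int) : R[i] :=
  cintegral (fun x => f x * (x : R[i]) ^ (- n)).

Definition Lpr p := Lp p `&` [set f | f = star f %[ae m]].

Definition Hp p := Lp p `&` [set f | forall n : int, n < 0 -> fourier f n = 0].

Definition Hpr p := Hp p `&` Lpr p.

(* phi A, saturated for a.e. equality *)
Definition mulset phi A : set (circle R -> R[i]) :=
  [set h | cmeasurable h /\ exists2 f, A f & h = phi \* f %[ae m]].

Definition unimodular phi :=
  cmeasurable phi /\ {ae m, forall x, Normc.normc (phi x) = 1}.

Definition zfun : circle R -> R[i] := fun x => x.

Record real_subspace p M : Prop := {
  real_subspace_sub : M `<=` Lpr p;
  real_subspace_ae : forall f g,
    M f -> cmeasurable g -> f = g %[ae m] -> M g;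
  real_subspace0 : M (fun=> 0);
  real_subspaceD : forall f g, M f -> M g -> M (f \+ g);
  real_subspaceZ : forall (a : R) f, M f -> M (fun x => a%:C * f x) }.

Definition norm_closed p M := forall f, Lp p f ->
  (forall e : R, 0 < e -> exists2 g, M g & (cLnorm p (f \- g)%R < e%:E)%E) ->
  M f.

(* Basic weak-* neighbourhoods of f in L^oo = (L^1)^* are given by finitely many
   g_i in L^1, via the pairing (f, g) |-> \int f g. *)
Definition weakstar_closed M := forall f, Lp +oo%E f ->
  (forall (n : nat) (g : 'I_n -> circle R -> R[i]) (e : R),
    (forall i, Lp 1%E (g i)) -> 0 < e ->
    exists2 h, M h &
      forall i, Normc.normc (cintegral (fun x => (f x - h x) * g i x)) < e) ->
  M f.

Definition Lp_closed p M :=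
  if p == +oo%E then weakstar_closed M else norm_closed p M.

Definition simply_invariant M := mulset zfun M <> M.

Definition doubly_invariant M := mulset zfun M = M.

Definition set_star (E : set (circle R)) : set (circle R) := circle_conj @` E.

End function_spaces.

(* Main.v *)
(** Norm closed and weak-* closed subspaces of L^p share one property: they are
    closed under a.e. limits dominated by a function of L^p. Let M be such a
    space with z M in M. For f in M, multiplying by (the squares of) outer
    functions of modulus c / (1 + d sqrt |f|), d -> 0, gives bounded elements of
    M converging to f and dominated by 4 |f|; hence M is determined by the space V
    of its bounded elements, to which the Hilbert space arguments apply. If the
    conjugate of z times some f in V is not in M, the component of f orthogonal
    to z V is orthogonal to z^n times itself for all n > 0, so it has constant
    modulus, and its normalization is phi. Otherwise V is invariant under z and
    its conjugate, and the projection q of 1 on V satisfies (1 - q) conj f = 0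
    for all f in V, so that q is the indicator of E. The outer functions come
    from the same wandering vector argument, applied to the polynomials times
    s = 1 + d sqrt |f|; Fejer means make their polynomial approximants uniformly
    bounded. *)

Require Import Defs.
From HB Require Import structures.
From mathcomp Require Import all_boot all_order all_algebra.
From mathcomp Require Import all_classical all_reals all_analysis.
From mathcomp Require Import measurable_realfun.
From mathcomp.real_closed Require Import complex.
From mathcomp Require Import ring lra.

Set Implicit Arguments.
Unset Strict Implicit.
Unset Printing Implicit Defensive.

Import Order.TTheory GRing.Theory Num.Theory.
Import numFieldNormedType.Exports.

Local Open Scope classical_set_scope.
Local Open Scope ring_scope.

Local Notation Re := complex.Re.
Local Notation Im := complex.Im.
Local Notation normc := Normc.normc.
(* Inside products, [^*] would otherwise be parsed as [Num.conj]. *)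
Local Notation "z ^*" := (conjc z) : ring_scope.

(** A first obstacle is that [M] may be multiplied only by polynomials in [z], so an element cannot
    be truncated by an indicator: the multipliers that replace truncation must be bounded limits of
    polynomials with real coefficients and nonnegative frequencies. Since [f] may be merely
    integrable, the square root makes the multiplier the solution of an L^2 problem, and its square
    is what bounds [f]; each factor is at most 2, whence the constant 4. A second obstacle is that V
    need not be closed in L^2. A projection q is therefore kept together with a sequence of V that
    tends to it almost everywhere under a square-integrable majorant. It proves bounded only
    afterwards, because f - q has constant modulus or q takes the values 0 and 1, and cutoff
    multipliers then bring it back into [M]. The scalar product is the real part of the integral. On
    functions equal to their [star] nothing is lost: conjugation of the circle preserves the measure
    and makes the imaginary part integrate to zero. *)

Section complex_numbers.
Context {R : realType}.
Implicit Types (z w : R[i]) (u v : nat -> R[i]).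
Local Open Scope complex_scope.

Lemma ReD z w : Re (z + w) = Re z + Re w.
Proof. by case: z; case: w. Qed.

Lemma ImD z w : Im (z + w) = Im z + Im w.
Proof. by case: z; case: w. Qed.

Lemma ReN z : Re (- z) = - Re z. Proof. by case: z. Qed.

Lemma ImN z : Im (- z) = - Im z. Proof. by case: z. Qed.

Lemma ReM z w : Re (z * w) = Re z * Re w - Im z * Im w.
Proof. by case: z; case: w. Qed.

Lemma ImM z w : Im (z * w) = Re z * Im w + Im z * Re w.
Proof. by case: z; case: w. Qed.

Lemma ReJ z : Re z^* = Re z. Proof. by case: z. Qed.

Lemma ImJ z : Im z^* = - Im z. Proof. by case: z. Qed.

Definition ReImE := (ReD, ImD, ReN, ImN, ReM, ImM, ReJ, ImJ).

Lemma normc_ge0 z : 0 <= normc z.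
Proof. by case: z => a b; exact: sqrtr_ge0. Qed.

Lemma sqr_normcE z : normc z ^+ 2 = Re z ^+ 2 + Im z ^+ 2.
Proof. by case: z => a b; rewrite /= sqr_sqrtr// addr_ge0// sqr_ge0. Qed.

Lemma Re_mulJ z : Re (z * z^*) = normc z ^+ 2.
Proof. by rewrite sqr_normcE !ReImE; ring. Qed.

Lemma Im_mulJ z : Im (z * z^*) = 0.
Proof. by rewrite !ReImE; ring. Qed.

Lemma mulJE z : z * z^* = (normc z ^+ 2)%:C.
Proof. by apply/eqP; rewrite eq_complex Re_mulJ Im_mulJ /= !eqxx. Qed.

Lemma normc_conj z : normc z^* = normc z.
Proof. by case: z => a b /=; rewrite sqrrN. Qed.

Lemma normc_real (r : R) : normc r%:C = `|r|.
Proof. by rewrite /= expr0n addr0 sqrtr_sqr. Qed.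

Lemma normcX z n : normc (z ^+ n) = normc z ^+ n.
Proof.
by elim: n => [|n IH]; rewrite ?expr0 ?Normc.normc1// !exprS Normc.normcM IH.
Qed.

Lemma norm_Re_le z : `|Re z| <= normc z.
Proof.
by rewrite -sqrtr_sqr; case: z => a b /=; rewrite ler_wsqrtr// lerDl sqr_ge0.
Qed.

Lemma norm_Im_le z : `|Im z| <= normc z.
Proof.
by rewrite -sqrtr_sqr; case: z => a b /=; rewrite ler_wsqrtr// lerDr sqr_ge0.
Qed.

Lemma normc_le_sum z : normc z <= `|Re z| + `|Im z|.
Proof.
rewrite -(ler_pXn2r (n := 2))// ?nnegrE ?normc_ge0 ?addr_ge0//.
rewrite sqr_normcE sqrrD !real_normK ?num_real// [leRHS]addrAC lerDl.
by rewrite mulrn_wge0// mulr_ge0.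
Qed.

Lemma sqr_normcD_le z w :
  normc (z + w) ^+ 2 <= 2 * normc z ^+ 2 + 2 * normc w ^+ 2.
Proof.
rewrite !sqr_normcE !ReImE.
have := sqr_ge0 (Re z - Re w); have := sqr_ge0 (Im z - Im w); nra.
Qed.

Lemma normcD_le z w : normc (z + w) <= normc z + normc w.
Proof. by have := ler_normD z w; rewrite -lecR rmorphD. Qed.

Lemma normc_eq0 z : (normc z == 0) = (z == 0).
Proof.
apply/eqP/eqP => [/Normc.eq0_normc//|->]; exact: Normc.normc0.
Qed.

(** Stated on the two parts, where the limit theorems for real measurable functions apply
    directly. *)
Definition ccvg u (l : R[i]) :=
  Re (u n) @[n --> \oo] --> Re l /\ Im (u n) @[n --> \oo] --> Im l.

Lemma ccvg_cst l : ccvg (fun=> l) l.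
Proof. by split; exact: cvg_cst. Qed.

Lemma ccvgD u v k l : ccvg u k -> ccvg v l -> ccvg (fun n => u n + v n) (k + l).
Proof.
move=> [u1 u2] [v1 v2]; split.
- by under eq_fun do rewrite ReD; rewrite ReD; exact: cvgD.
- by under eq_fun do rewrite ImD; rewrite ImD; exact: cvgD.
Qed.

Lemma ccvgN u k : ccvg u k -> ccvg (fun n => - u n) (- k).
Proof.
move=> [u1 u2]; split.
- by under eq_fun do rewrite ReN; rewrite ReN; exact: cvgN.
- by under eq_fun do rewrite ImN; rewrite ImN; exact: cvgN.
Qed.

Lemma ccvgB u v k l : ccvg u k -> ccvg v l -> ccvg (fun n => u n - v n) (k - l).
Proof. by move=> uk vl; apply: ccvgD => //; exact: ccvgN. Qed.

Lemma ccvgM u v k l : ccvg u k -> ccvg v l -> ccvg (fun n => u n * v n) (k * l).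
Proof.
move=> [u1 u2] [v1 v2]; split.
- under eq_fun do rewrite ReM; rewrite ReM.
  by apply: cvgB; exact: cvgM.
- under eq_fun do rewrite ImM; rewrite ImM.
  by apply: cvgD; exact: cvgM.
Qed.

Lemma ccvgMl a u k : ccvg u k -> ccvg (fun n => a * u n) (a * k).
Proof. by apply: ccvgM; exact: ccvg_cst. Qed.

Lemma ccvgJ u k : ccvg u k -> ccvg (fun n => (u n)^*) (k^*).
Proof.
move=> [u1 u2]; split.
- by under eq_fun do rewrite ReJ; rewrite ReJ.
- by under eq_fun do rewrite ImJ; rewrite ImJ; exact: cvgN.
Qed.

Lemma ccvg_unique u k l : ccvg u k -> ccvg u l -> k = l.
Proof.
move=> [u1 u2] [v1 v2]; apply/eqP; rewrite eq_complex.
by apply/andP; split; apply/eqP; [exact: (cvg_unique _ u1)|exact: (cvg_unique _ u2)].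
Qed.

Lemma ccvg_sqr_normc u l : ccvg u l -> normc (u n) ^+ 2 @[n --> \oo] --> normc l ^+ 2.
Proof.
move=> ul; have [+ _] := ccvgM ul (ccvgJ ul).
by under eq_fun do rewrite Re_mulJ; rewrite Re_mulJ.
Qed.

Lemma ccvg_normc u l : ccvg u l -> normc (u n) @[n --> \oo] --> normc l.
Proof.
move=> /ccvg_sqr_normc /(continuous_cvg _ (@sqrt_continuous R (normc l ^+ 2))).
rewrite sqrtr_sqr ger0_norm ?normc_ge0//.
suff -> : Num.sqrt \o (fun n => normc (u n) ^+ 2) = (fun n => normc (u n)) by [].
by apply/funext => n; rewrite /= sqrtr_sqr ger0_norm ?normc_ge0.
Qed.

Lemma normc_ccvg u l : normc (u n - l) @[n --> \oo] --> 0 -> ccvg u l.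
Proof.
move=> /cvgrPdist_lt h; split; apply/cvgrPdist_lt => e e0; have := h e e0;
  apply: filterS => n; rewrite sub0r normrN ger0_norm ?normc_ge0// distrC;
  apply: le_lt_trans.
- by have := norm_Re_le (u n - l); rewrite !ReImE.
- by have := norm_Im_le (u n - l); rewrite !ReImE.
Qed.

Lemma ccvg_le u l (c : R) : ccvg u l -> (forall n, normc (u n) <= c) -> normc l <= c.
Proof.
move=> /ccvg_normc h uc; rewrite -(cvg_lim _ h)//.
by apply: limr_le; [apply/cvgP: h|exact: nearW].
Qed.

End complex_numbers.

(** * Points of the circle and their integer powers *)

Section circle_points.
Context {R : realType}.
Implicit Types x : circle R.
Local Open Scope complex_scope.

Lemma normc_circle x : normc (x : R[i]) = 1.
Proof.
have := circle_valP x; rewrite normc_def => /eqP[].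
by case: (x : R[i]).
Qed.

Lemma circle_neq0 x : (x : R[i]) != 0.
Proof. by rewrite -normc_eq0 normc_circle oner_eq0. Qed.

Lemma circle_mulJ x : (x : R[i]) * (x : R[i])^* = 1.
Proof. by rewrite mulJE normc_circle expr1n. Qed.

Lemma circle_invE x : (x : R[i])^-1 = (x : R[i])^*.
Proof.
by apply: (mulfI (circle_neq0 x)); rewrite circle_mulJ divff ?circle_neq0.
Qed.

Lemma circle_conjK : involutive (@circle_conj R).
Proof. by move=> x; apply: val_inj; rewrite /= conjcK. Qed.

Lemma normc_expz x (n : int) : normc ((x : R[i]) ^ n) = 1.
Proof.
case: n => n; rewrite ?NegzE -?exprnP -?exprnN.
  by rewrite normcX normc_circle expr1n.
by rewrite Normc.normcV normcX normc_circle expr1n invr1.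
Qed.

Lemma conjc_expz x (n : int) : ((x : R[i]) ^ n)^* = (x : R[i]) ^ (- n).
Proof.
rewrite -exprz_inv circle_invE; case: n => n; rewrite ?NegzE -?exprnP -?exprnN.
  by rewrite rmorphXn.
by rewrite conjc_inv rmorphXn.
Qed.

Lemma circle_conj_expz x (n : int) :
  (circle_conj x : R[i]) ^ n = (x : R[i]) ^ (- n).
Proof. by rewrite /= -circle_invE exprz_inv. Qed.

Lemma expzD x (n k : int) : (x : R[i]) ^ (n + k) = (x : R[i]) ^ n * (x : R[i]) ^ k.
Proof. by rewrite expfzDr// circle_neq0. Qed.

End circle_points.

(** * Measurability and integration on the circle *)

Section measurability.
Context {R : realType}.
Implicit Types (f g : circle R -> R[i]) (w : circle R -> R) (u : nat -> circle R -> R[i]).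
Local Open Scope complex_scope.

Lemma cmeasurable_cst (c : R[i]) : cmeasurable (fun=> c : R[i]).
Proof. by split; exact: measurable_cst. Qed.

Lemma cmeasurableD f g : cmeasurable f -> cmeasurable g ->
  cmeasurable (fun x => f x + g x).
Proof.
move=> [f1 f2] [g1 g2]; split.
- by under eq_fun do rewrite ReD; exact: measurable_funD.
- by under eq_fun do rewrite ImD; exact: measurable_funD.
Qed.

Lemma cmeasurableN f : cmeasurable f -> cmeasurable (fun x => - f x).
Proof.
move=> [f1 f2]; split.
- by under eq_fun do rewrite ReN; exact: measurable_funN.
- by under eq_fun do rewrite ImN; exact: measurable_funN.
Qed.

Lemma cmeasurableB f g : cmeasurable f -> cmeasurable g ->
  cmeasurable (fun x => f x - g x).
Proof. by move=> mf mg; apply: cmeasurableD => //; exact: cmeasurableN. Qed.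

Lemma cmeasurableM f g : cmeasurable f -> cmeasurable g ->
  cmeasurable (fun x => f x * g x).
Proof.
move=> [f1 f2] [g1 g2]; split.
- by under eq_fun do rewrite ReM; apply: measurable_funB; exact: measurable_funM.
- by under eq_fun do rewrite ImM; apply: measurable_funD; exact: measurable_funM.
Qed.

Lemma cmeasurableJ f : cmeasurable f -> cmeasurable (fun x => (f x)^*).
Proof.
move=> [f1 f2]; split.
- by under eq_fun do rewrite ReJ.
- by under eq_fun do rewrite ImJ; exact: measurable_funN.
Qed.

Lemma cmeasurableC w : measurable_fun setT w -> cmeasurable (fun x => (w x)%:C).
Proof. by move=> mw; split => //=; exact: measurable_cst. Qed.

Lemma measurable_sqrt : measurable_fun [set: R] (@Num.sqrt R).
Proof. by apply: continuous_measurable_fun; exact: sqrt_continuous. Qed.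

Lemma measurable_normc f : cmeasurable f -> measurable_fun setT (fun x => normc (f x)).
Proof.
move=> [f1 f2]; have -> : (fun x => normc (f x)) =
    Num.sqrt \o (fun x => Re (f x) ^+ 2 + Im (f x) ^+ 2).
  by apply/funext => x /=; case: (f x).
apply: measurableT_comp; first exact: measurable_sqrt.
by apply: measurable_funD; exact: measurable_funX.
Qed.

Lemma measurable_circle_coord : measurable_fun setT (@circle_coord R).
Proof. by move=> _ B mB; exists B. Qed.

Lemma cmeasurable_circle_val : cmeasurable (@circle_val R).
Proof.
split.
- have -> : (fun x : circle R => Re x) = fst \o @circle_coord R by [].
  exact: (measurableT_comp measurable_fst measurable_circle_coord).
- have -> : (fun x : circle R => Im x) = snd \o @circle_coord R by [].
  exact: (measurableT_comp measurable_snd measurable_circle_coord).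
Qed.

Lemma measurable_circle_conj : measurable_fun setT (@circle_conj R).
Proof.
move=> _ _ [B mB <-]; rewrite setTI -comp_preimage -[X in measurable X]setTI.
have [mr mi] := cmeasurableJ cmeasurable_circle_val.
by have := measurable_fun_pair mr mi measurableT mB; rewrite !setTI.
Qed.

Lemma cmeasurable_comp_conj f : cmeasurable f -> cmeasurable (fun x => f (circle_conj x)).
Proof.
move=> [f1 f2]; split.
- exact: (measurableT_comp f1 measurable_circle_conj).
- exact: (measurableT_comp f2 measurable_circle_conj).
Qed.

Lemma cmeasurable_expz (n : int) : cmeasurable (fun x : circle R => (x : R[i]) ^ n).
Proof.
have h (k : nat) : cmeasurable (fun x : circle R => (x : R[i]) ^+ k).
  elim: k => [|k IH]; first by under eq_fun do rewrite expr0; exact: cmeasurable_cst.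
  by under eq_fun do rewrite exprS; exact: (cmeasurableM cmeasurable_circle_val IH).
case: n => k; first exact: h.
have -> : (fun x : circle R => (x : R[i]) ^ (Negz k)) =
          (fun x : circle R => ((x : R[i]) ^+ k.+1)^*).
  by apply/funext => x; rewrite -[_ ^+ _]/((x : R[i]) ^ k.+1) conjc_expz NegzE.
exact: (cmeasurableJ (h _)).
Qed.

Lemma cmeasurable_cvg u f : (forall n, cmeasurable (u n)) ->
  (forall x, ccvg (u^~ x) (f x)) -> cmeasurable f.
Proof.
move=> mu uf; split.
- apply: (@measurable_fun_cvg _ _ _ _ (fun n x => Re (u n x))) => [n|x _].
    by have [] := mu n.
  by have [] := uf x.
- apply: (@measurable_fun_cvg _ _ _ _ (fun n x => Im (u n x))) => [n|x _].
    by have [] := mu n.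
  by have [] := uf x.
Qed.

Lemma cmeasurable_indic (E : set (circle R)) : measurable E ->
  cmeasurable (\1_E : circle R -> R[i]).
Proof.
move=> mE; have -> : (\1_E : circle R -> R[i]) = (fun x => (\1_E x : R)%:C).
  by apply/funext => x; rewrite !indicE; case: (_ \in _).
by apply: cmeasurableC; exact: measurable_indic.
Qed.

End measurability.

(** * Integrals of complex functions and dominated convergence *)

Section integrals.
Context {R : realType}.
Implicit Types (f g : circle R -> R[i]) (w : circle R -> R) (u : nat -> circle R -> R[i]).
Local Open Scope complex_scope.
Local Notation m := (@circle_measure R).

Definition cintegrable f :=
  cmeasurable f /\ m.-integrable setT (fun x => (normc (f x))%:E).

Lemma le_cintegrable f g : cmeasurable f -> cintegrable g ->
  (\forall x \ae m, normc (f x) <= normc (g x)) -> cintegrable f.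
Proof.
move=> mf [mg /integrableP[mig ig]] fg; split => //; apply/integrableP.
have mnf : measurable_fun setT (fun x => (normc (f x))%:E).
  exact/measurable_EFinP/measurable_normc.
split => //; apply: le_lt_trans ig.
apply: ae_ge0_le_integral => //.
- exact: measurableT_comp.
- exact: measurableT_comp.
- apply: filterS fg => x fg _.
  by rewrite lee_fin !ger0_norm ?normc_ge0.
Qed.

Lemma cintegrable_Re f : cintegrable f -> m.-integrable setT (EFin \o (fun x => Re (f x))).
Proof.
move=> [[mf _] ig]; apply: le_integrable ig => //; first exact/measurable_EFinP.
by move=> x _ /=; rewrite lee_fin (ger0_norm (normc_ge0 _)) norm_Re_le.
Qed.

Lemma cintegrable_Im f : cintegrable f -> m.-integrable setT (EFin \o (fun x => Im (f x))).
Proof.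
move=> [[_ mf] ig]; apply: le_integrable ig => //; first exact/measurable_EFinP.
by move=> x _ /=; rewrite lee_fin (ger0_norm (normc_ge0 _)) norm_Im_le.
Qed.

Lemma cintegrableC w : m.-integrable setT (EFin \o w) -> cintegrable (fun x => (w x)%:C).
Proof.
move=> iw; have mw : measurable_fun setT w.
  by apply/measurable_EFinP; case/integrableP: iw.
split; first exact: cmeasurableC.
apply: le_integrable iw => //.
  exact/measurable_EFinP/measurable_normc/cmeasurableC.
by move=> x _; rewrite lee_fin ger0_norm ?normc_ge0// normc_real.
Qed.

Lemma cintegrable_normc f : cintegrable f -> cintegrable (fun x => (normc (f x))%:C).
Proof. by move=> [_ h]; exact: cintegrableC. Qed.

Lemma cintegrable_bounded f (c : R) : cmeasurable f ->
  (\forall x \ae m, normc (f x) <= c) -> cintegrable f.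
Proof.
move=> mf fc; apply: (@le_cintegrable _ (fun=> (`|c|)%:C)) => //.
  by apply: cintegrableC; exact: finite_measure_integrable_cst.
apply: filterS fc => x /le_trans; apply.
by rewrite normc_real ger0_norm ?ler_norm.
Qed.

Lemma cintegrable_cst (c : R[i]) : cintegrable (fun=> c).
Proof. by apply: (@cintegrable_bounded _ (normc c)); [exact: cmeasurable_cst|exact: aeW]. Qed.

Lemma cintegrableD f g : cintegrable f -> cintegrable g -> cintegrable (fun x => f x + g x).
Proof.
move=> [mf nf] [mg ng]; apply: (@le_cintegrable _ (fun x => (normc (f x) + normc (g x))%:C)).
- exact: cmeasurableD.
- by apply: cintegrableC; exact: (integrableD measurableT nf ng).
- by apply: aeW => x; rewrite normc_real ger0_norm ?addr_ge0 ?normc_ge0// le_normcD.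
Qed.

Lemma cintegrableN f : cintegrable f -> cintegrable (fun x => - f x).
Proof.
move=> [mf nf]; split; first exact: cmeasurableN.
by under eq_fun do rewrite normcN.
Qed.

Lemma cintegrableB f g : cintegrable f -> cintegrable g -> cintegrable (fun x => f x - g x).
Proof. by move=> cf cg; apply: cintegrableD => //; exact: cintegrableN. Qed.

Lemma cintegrableMb f g (c : R) : cmeasurable f -> (\forall x \ae m, normc (f x) <= c) ->
  cintegrable g -> cintegrable (fun x => f x * g x).
Proof.
move=> mf fc [mg ng]; apply: (@le_cintegrable _ (fun x => (`|c| * normc (g x))%:C)).
- exact: cmeasurableM.
- by apply: cintegrableC; exact: (integrableZl measurableT _ ng).
- apply: filterS fc => x fc; rewrite Normc.normcM normc_real normrM normr_id.
  by rewrite [`|normc _|]ger0_norm ?normc_ge0// ler_wpM2r ?normc_ge0// (le_trans fc) ?ler_norm.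
Qed.

Lemma cintegrableZ (c : R[i]) f : cintegrable f -> cintegrable (fun x => c * f x).
Proof.
by apply: (@cintegrableMb _ _ (normc c)); [exact: cmeasurable_cst|exact: aeW].
Qed.

Lemma cintegrable_expzM (n : int) f : cintegrable f ->
  cintegrable (fun x => f x * (x : R[i]) ^ n).
Proof.
under eq_fun do rewrite mulrC.
apply: (@cintegrableMb _ _ 1); first exact: cmeasurable_expz.
by apply: aeW => x; rewrite normc_expz.
Qed.

Lemma cintegrable_sum n (F : nat -> circle R -> R[i]) :
  (forall k, cintegrable (F k)) -> cintegrable (fun x => \sum_(k < n) F k x).
Proof.
move=> iF; elim: n => [|n IH].
  by under eq_fun do rewrite big_ord0; exact: cintegrable_cst.
by under eq_fun do rewrite big_ord_recr /=; exact: cintegrableD.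
Qed.

(** Only the real part of an integral is tracked; statements about the whole complex integral are
    recovered by letting a complex constant multiply the integrand. *)
Definition Rint f : R := \int[m]_x Re (f x).

Lemma RintD f g : cintegrable f -> cintegrable g ->
  Rint (fun x => f x + g x) = Rint f + Rint g.
Proof.
move=> cf cg; rewrite /Rint; under eq_Rintegral do rewrite ReD.
by rewrite RintegralD//; exact: cintegrable_Re.
Qed.

Lemma RintN f : cintegrable f -> Rint (fun x => - f x) = - Rint f.
Proof.
move=> cf; rewrite /Rint; under eq_Rintegral do rewrite ReN -mulN1r.
by rewrite RintegralZl ?mulN1r//; exact: cintegrable_Re.
Qed.

Lemma RintB f g : cintegrable f -> cintegrable g ->
  Rint (fun x => f x - g x) = Rint f - Rint g.
Proof. by move=> cf cg; rewrite RintD ?RintN//; exact: cintegrableN. Qed.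

Lemma RintZ (c : R) f : cintegrable f -> Rint (fun x => c%:C * f x) = c * Rint f.
Proof.
move=> cf; rewrite /Rint; under eq_Rintegral do rewrite ReM /= mul0r subr0.
by rewrite RintegralZl//; exact: cintegrable_Re.
Qed.

Lemma Rint_cst (c : R) : Rint (fun=> c%:C) = c.
Proof.
rewrite /Rint Rintegral_cst//; transitivity (Re c%:C * fine 1%E).
  by congr (_ * fine _); exact: probability_setT.
by rewrite mulr1.
Qed.

Lemma eq_Rint f g : (forall x, Re (f x) = Re (g x)) -> Rint f = Rint g.
Proof. by move=> fg; apply: eq_Rintegral => x _; exact: fg. Qed.

Lemma Rint_ae f g : cmeasurable f -> cmeasurable g ->
  (\forall x \ae m, Re (f x) = Re (g x)) -> Rint f = Rint g.
Proof.
move=> [mf _] [mg _] fg; rewrite /Rint /Rintegral; congr fine.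
apply: ae_eq_integral => //; [exact/measurable_EFinP|exact/measurable_EFinP|].
by apply: filterS fg => x + _ => /= ->.
Qed.

Lemma Rint_ge0 f : cmeasurable f -> (\forall x \ae m, 0 <= Re (f x)) -> 0 <= Rint f.
Proof.
move=> [mf mf'] f0; have -> : Rint f = Rint (fun x => `|Re (f x)|%:C).
  apply: Rint_ae; [by split|by apply: cmeasurableC; exact: measurableT_comp|].
  by apply: filterS f0 => x f0 /=; rewrite ger0_norm.
by apply: Rintegral_ge0 => x _ /=.
Qed.

Lemma le_Rint f g : cintegrable f -> cintegrable g ->
  (\forall x \ae m, Re (f x) <= Re (g x)) -> Rint f <= Rint g.
Proof.
move=> cf cg fg; rewrite -subr_ge0 -RintB//; apply: Rint_ge0.
  by have [] := cintegrableB cg cf.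
by apply: filterS fg => x; rewrite !ReImE subr_ge0.
Qed.

Lemma Rint_eq0 f : cintegrable f -> (\forall x \ae m, 0 <= Re (f x)) -> Rint f = 0 ->
  \forall x \ae m, Re (f x) = 0.
Proof.
move=> cf f0 If; have mf : measurable_fun setT (fun x => Re (f x)) by case: cf => -[].
have : (\int[m]_(x in setT) `|(Re (f x))%:E| = 0)%E.
  have -> : (\int[m]_(x in setT) `|(Re (f x))%:E| = \int[m]_x (Re (f x))%:E)%E.
    apply: ae_eq_integral => //.
    - by apply: measurableT_comp => //; exact/measurable_EFinP.
    - exact/measurable_EFinP.
    - by apply: filterS f0 => x f0 _ /=; rewrite ger0_norm.
  rewrite -[LHS]fineK; last exact: integrable_fin_num (cintegrable_Re cf).
  by congr EFin.
move/(ae_eq_integral_abs m measurableT); move/(_ ltac:(exact/measurable_EFinP)).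
by apply: filterS => x /(_ I)[].
Qed.

Lemma dominated_cintegrable u f g : (forall n, cmeasurable (u n)) -> cmeasurable f ->
  cintegrable g -> (forall n, \forall x \ae m, normc (u n x) <= normc (g x)) ->
  (\forall x \ae m, ccvg (u^~ x) (f x)) ->
  cintegrable f /\ Rint (u n) @[n --> \oo] --> Rint f.
Proof.
move=> mu mf [mg ng] ug uf.
have ug' : \forall x \ae m, forall n, normc (u n x) <= normc (g x) by exact: ae_foralln.
have cf : cintegrable f.
  apply: (@le_cintegrable _ g) => //; apply: filterS2 ug' uf => x ug1 uf1.
  exact: ccvg_le uf1 ug1.
split => //.
have [] := @dominated_convergence _ _ _ m setT measurableT
  (fun n x => (Re (u n x))%:E) (fun x => (Re (f x))%:E) (fun x => (normc (g x))%:E).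
- by move=> n; apply/measurable_EFinP; case: (mu n).
- by apply/measurable_EFinP; case: mf.
- by apply: filterS uf => x [h _] _; apply: cvg_EFin => //; exact: nearW.
- by [].
- by apply: filterS ug' => x h n _; rewrite lee_fin (le_trans (norm_Re_le _)).
- have fin := integrable_fin_num measurableT (cintegrable_Re cf).
  by move=> _ _; rewrite -(fineK fin) => /fine_cvg.
Qed.

End integrals.

(** * Arc length: invariance under conjugation and integrals of powers *)

Section circle_measure_facts.
Context {R : realType}.
Implicit Types (f g : circle R -> R[i]).
Local Open Scope complex_scope.
Local Notation m := (@circle_measure R).
Local Notation mu := (@lebesgue_measure R).

Lemma measurable_reflect (a : R) :
  measurable_fun setT (fun t : measurableTypeR R => a - t : measurableTypeR R).
Proof. by apply: measurable_funB => //; exact: measurable_cst. Qed.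

(** The image of [mu] under the reflection agrees with [mu] on half-open intervals, and these
    determine Lebesgue measure. *)
Lemma lebesgue_measure_reflect (a : R) (A : set R) : measurable A ->
  mu ((fun t => a - t) @^-1` A) = mu A.
Proof.
pose phi : {mfun measurableTypeR R >-> measurableTypeR R} :=
  HB.pack (fun t : measurableTypeR R => a - t : measurableTypeR R)
    (@isMeasurableFun.Build _ _ _ _ _ (measurable_reflect a)).
move=> mA; rewrite -[LHS]/(pushforward mu phi A).
apply/esym/lebesgue_measure_unique => //= _ [[x y]] _ <-.
rewrite /pushforward; have -> : phi @^-1` `]x, y]%classic = `[a - y, a - x[%classic.
  by apply/seteqP; split => t /=; rewrite !in_itv /=; lra.
rewrite !lebesgue_measure_itv/= !lte_fin ltrD2l ltrN2; case: ifP => // _.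
by congr EFin; lra.
Qed.

Lemma uniform_probE (a b : R) (ab : a < b) (U : set R) : measurable U ->
  uniform_prob ab U = ((b - a)^-1%:E * mu (U `&` `[a, b]%classic))%E.
Proof.
move=> mU; rewrite /uniform_prob integral_uniform_pdf.
rewrite (eq_integral (cst (b - a)^-1%:E)); last first.
  by move=> x /[!inE] -[_ /=]; rewrite in_itv /= /uniform_pdf => ->.
by rewrite integral_cst//; exact: measurableI.
Qed.

Lemma circle_measureE (A : set (circle R)) : measurable A ->
  m A = ((pi *+ 2)^-1%:E * mu ((@expi R) @^-1` A `&` `[0%R, (pi *+ 2)%R]%classic))%E.
Proof.
move=> mA; rewrite -[LHS]/(uniform_prob two_pi_gt0 (expi @^-1` A)) uniform_probE.
  by rewrite subr0.
by rewrite -[X in measurable X]setTI; exact: measurable_expi.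
Qed.

(** The conjugate of e^{it} is e^{i(2 pi - t)}, and t -> 2 pi - t preserves both the interval
    [0, 2 pi] and Lebesgue measure. *)
Lemma circle_measure_conj (A : set (circle R)) : measurable A ->
  m (@circle_conj R @^-1` A) = m A.
Proof.
move=> mA; have me (B : set (circle R)) : measurable B -> measurable ((@expi R) @^-1` B).
  by move=> mB; rewrite -[X in measurable X]setTI; exact: measurable_expi.
rewrite !circle_measureE//; last first.
  by rewrite -[X in measurable X]setTI; exact: measurable_circle_conj.
congr (_ * _)%E; rewrite -[RHS](@lebesgue_measure_reflect (pi *+ 2)); last first.
  by apply: measurableI => //; exact: me.
congr (mu _); rewrite preimage_setI; congr (_ `&` _).
- apply/seteqP; split => t /=; suff -> : circle_conj (expi t) = expi (pi *+ 2 - t) by [];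
  by apply: val_inj => /=; rewrite cosB sinB cos2pi sin2pi !mul1r !mul0r sub0r addr0.
- by apply/seteqP; split => t /=; rewrite !in_itv /=; lra.
Qed.

Lemma ae_circle_conj (P : circle R -> Prop) :
  (\forall x \ae m, P x) -> \forall x \ae m, P (circle_conj x).
Proof.
move=> [N [mN N0 PN]]; exists (@circle_conj R @^-1` N); split.
- by rewrite -[X in measurable X]setTI; exact: measurable_circle_conj.
- by rewrite circle_measure_conj.
- by move=> x Px; apply: PN.
Qed.

Definition circle_conj_mfun : {mfun circle R >-> circle R} :=
  HB.pack (@circle_conj R) (@isMeasurableFun.Build _ _ _ _ _ (@measurable_circle_conj R)).

Lemma integral_circle_conj (h : circle R -> \bar R) :
  (\int[distribution m circle_conj_mfun]_x h x = \int[m]_x h x)%E.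
Proof. by apply: eq_measure_integral => A mA _; exact: (circle_measure_conj mA). Qed.

Lemma cintegrable_comp_conj f : cintegrable f -> cintegrable (fun x => f (circle_conj x)).
Proof.
move=> [mf /integrableP[mnf nf]]; have mg := cmeasurable_comp_conj mf.
split => //; apply/integrableP; split; first exact/measurable_EFinP/measurable_normc.
apply: le_lt_trans nf; rewrite le_eqVlt; apply/orP; left; apply/eqP.
rewrite -[RHS]integral_circle_conj ge0_integral_distribution//.
exact: measurableT_comp.
Qed.

Lemma Rint_comp_conj f : cintegrable f -> Rint (fun x => f (circle_conj x)) = Rint f.
Proof.
move=> cf; rewrite /Rint /Rintegral -[in RHS]integral_circle_conj integral_distribution//.
- by apply/measurable_EFinP; case: cf => -[].
- exact: (cintegrable_Re (cintegrable_comp_conj cf)).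
Qed.

Lemma expiX t n : (expi t : R[i]) ^+ n = cos (t *+ n) +i* sin (t *+ n).
Proof.
elim: n => [|n IH]; first by rewrite expr0 mulr0n cos0 sin0.
apply/eqP; rewrite exprS IH mulrS cosD sinD eq_complex /=.
by apply/andP; split; apply/eqP; ring.
Qed.

(** In the parameter t the integrand is cos (n t), integrated over a full period by the fundamental
    theorem of calculus. *)
Lemma Rint_expX n : (0 < n)%N -> Rint (fun x : circle R => (x : R[i]) ^+ n) = 0.
Proof.
move=> n0; have cz : cintegrable (fun x : circle R => (x : R[i]) ^+ n).
  apply: (@cintegrable_bounded _ _ 1); first exact: (@cmeasurable_expz _ n).
  by apply: aeW => x; rewrite normcX normc_circle expr1n.
(* Adding 1 makes the integrand nonnegative, as the two changes of variables below require; [F] is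
   then a primitive of 1 + cos (n t). *)
have -> : Rint (fun x : circle R => (x : R[i]) ^+ n) =
          Rint (fun x : circle R => 1%:C + (x : R[i]) ^+ n) - 1.
  by rewrite RintD ?Rint_cst//; [lra|exact: cintegrable_cst].
apply/eqP; rewrite subr_eq0; apply/eqP.
have mRe : measurable_fun setT (fun x : circle R => Re (1%:C + (x : R[i]) ^+ n)).
  by have [[]] := cintegrableD (cintegrable_cst 1%:C) cz.
have Re0 (x : circle R) : 0 <= Re (1%:C + (x : R[i]) ^+ n).
  have := norm_Re_le ((x : R[i]) ^+ n); rewrite normcX normc_circle expr1n.
  by rewrite ler_norml !ReImE /=; lra.
rewrite /Rint /Rintegral; pose h (x : circle R) : \bar R := (Re (1%:C + (x : R[i]) ^+ n))%:E.
have mh : measurable_fun setT h by exact/measurable_EFinP.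
have h0 x : (0 <= h x)%E by rewrite lee_fin.
rewrite -[X in fine X]/(\int[distribution (uniform_prob two_pi_gt0) expi_mfun]_x h x)%E.
rewrite ge0_integral_distribution// integral_uniform//; last 2 first.
- exact: (measurableT_comp mh measurable_expi).
- by move=> x; exact: h0.
rewrite subr0.
pose F (t : R) : R := t + n%:R^-1 * sin (n%:R * t).
have n0' : n%:R != 0 :> R by rewrite pnatr_eq0 -lt0n.
have dF (t : R) : is_derive t 1 F (1 + cos (n%:R * t)).
  rewrite /F.
  have d1 : is_derive t 1 (fun t : R => sin (n%:R * t)) (n%:R * cos (n%:R * t)).
    have d0 : is_derive t 1 (fun t : R => n%:R * t) n%:R.
      have := @is_deriveZ _ _ _ _ n%:R _ _ _ (is_derive_id t (1 : R)).
      by rewrite /GRing.scale /= mulr1.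
    have := @is_derive1_comp _ sin (fun t : R => n%:R * t) t _ _ (is_derive_sin _) d0.
    by rewrite mulrC.
  have d2 := @is_deriveZ _ _ _ _ n%:R^-1 _ _ _ d1.
  have := is_deriveD (is_derive_id t (1 : R)) d2.
  by rewrite /GRing.scale /= mulrA mulVf// mul1r.
have cF : continuous F.
  by move=> t; apply: differentiable_continuous; apply/derivable1_diffP; case: (dF t).
transitivity (fine ((pi *+ 2)^-1%:E * ((F (pi *+ 2))%:E - (F 0)%:E))%E).
  congr (fine (_ * _)%E).
  rewrite -(@continuous_FTC2 _ (fun t => 1 + cos (n%:R * t)) F 0 (pi *+ 2)).
  - apply: eq_integral => t _; congr EFin.
    by rewrite /= expiX /= mulr_natl.
  - exact: two_pi_gt0.
  - apply: continuous_subspaceT => t; apply: cvgD; first exact: cvg_cst.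
    apply: continuous_comp; last exact: continuous_cos.
    by apply: cvgM; [exact: cvg_cst|exact: cvg_id].
  - split.
    + by move=> t _; case: (dF t).
    + by apply: cvg_at_right_filter; exact: cF.
    + by apply: cvg_at_left_filter; exact: cF.
  - by move=> t _; rewrite derive1E; case: (dF t).
have s0 : sin (n%:R * pi *+ 2) = 0 :> R.
  have -> : n%:R * pi *+ 2 = pi *+ (n * 2) :> R by rewrite mulrnA mulr_natl.
  elim: (n * 2)%N => [|k IH]; first by rewrite mulr0n sin0.
  by rewrite mulrS sinD sinpi mul0r IH mulr0 addr0.
rewrite /F mulr0 sin0 mulr0 addr0 mulrnAr s0 mulr0 addr0 /= subr0.
by rewrite mulVf// gt_eqF// two_pi_gt0.
Qed.

Lemma cintegrable_expz (n : int) : cintegrable (fun x : circle R => (x : R[i]) ^ n).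
Proof.
apply: (@cintegrable_bounded _ _ 1); first exact: cmeasurable_expz.
by apply: aeW => x; rewrite normc_expz.
Qed.

Lemma Rint_expz (n : int) : Rint (fun x : circle R => (x : R[i]) ^ n) = (n == 0)%:R.
Proof.
case: n => [[|n]|n].
- by rewrite (@eq_Rint _ _ (fun=> 1%:C)) ?Rint_cst// => x; rewrite expr0z.
- exact: Rint_expX.
- rewrite (@eq_Rint _ _ (fun x : circle R => (x : R[i]) ^+ n.+1)) ?Rint_expX// => x.
  by rewrite -ReJ conjc_expz NegzE opprK.
Qed.

End circle_measure_facts.

(** * Uniqueness of Fourier coefficients *)

Section uniqueness.
Context {R : realType}.
Implicit Types (F f g : circle R -> R[i]) (h : circle R -> R).
Local Open Scope complex_scope.
Local Notation m := (@circle_measure R).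

(** The Newton-Schulz iteration for the sign: an odd cubic with fixed points -1, 0 and 1. Its
    iterates are polynomials in s that tend to the sign of s on [-1, 1], which brings indicators
    within reach of an algebra closed under bounded limits. *)
Definition sgn_step (s : R) : R := s * (3 - s ^+ 2) / 2.

Lemma sgn_step_itv s : 0 < s <= 1 -> s <= sgn_step s <= 1.
Proof.
move=> /andP[s0 s1]; rewrite -subr_ge0 -[sgn_step s <= 1]subr_ge0.
have -> : sgn_step s - s = s * (1 - s) * (1 + s) / 2 by rewrite /sgn_step; field.
have -> : 1 - sgn_step s = (1 - s) ^+ 2 * (2 + s) / 2 by rewrite /sgn_step; field.
by apply/andP; split; rewrite divr_ge0// ?mulr_ge0 ?sqr_ge0//; lra.
Qed.

(** For an iterate r >= s the next distance to 1 is (1 - r) (1 - r/2 - r^2/2), so each step shrinks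
    the distance by the factor 1 - s/2 at least. *)
Lemma iter_sgn_step_pos s n : 0 < s <= 1 ->
  s <= iter n sgn_step s <= 1 /\ 1 - iter n sgn_step s <= (1 - s / 2) ^+ n.
Proof.
move=> /andP[s0 s1]; elim: n => [|n [/andP[IH1 IH2] IH3]].
  by rewrite /= lexx s1 expr0; split => //; lra.
have /andP[T1 T2] := @sgn_step_itv (iter n sgn_step s) ltac:(by rewrite IH2 andbT (lt_le_trans s0)).
rewrite iterS T2 andbT (le_trans IH1 T1); split => //.
apply: (@le_trans _ _ ((1 - iter n sgn_step s) * (1 - s / 2))).
  by rewrite /sgn_step; move: (iter n sgn_step s) IH1 IH2 => r *; nra.
by rewrite exprSr ler_wpM2r//; lra.
Qed.

Lemma iter_sgn_step_cvg s : `|s| <= 1 -> iter n sgn_step s @[n --> \oo] --> Num.sg s.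
Proof.
have pos r : 0 < r <= 1 -> iter n sgn_step r @[n --> \oo] --> (1 : R).
  move=> r01; have /andP[r0 r1] := r01.
  suff : 1 - iter n sgn_step r @[n --> \oo] --> (0 : R).
    move=> h; rewrite (_ : (fun n => iter n sgn_step r) = (fun n => 1 - (1 - iter n sgn_step r))).
      by rewrite -[X in _ --> X]subr0; apply: cvgB => //; exact: cvg_cst.
    by apply/funext => n; rewrite subKr.
  apply: (@squeeze_cvgr _ _ _ _ (cst 0) (fun n => (1 - r / 2) ^+ n)).
  - by apply: nearW => n; have [/andP[h1 h2] h3] := iter_sgn_step_pos n r01; rewrite h3 andbT subr_ge0.
  - exact: cvg_cst.
  - by apply: cvg_expr; rewrite ger0_norm; lra.
have opp n r : iter n sgn_step (- r) = - iter n sgn_step r.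
  by elim: n => // n IH; rewrite !iterS IH /sgn_step sqrrN; ring.
have zero n : iter n sgn_step 0 = 0 by elim: n => // n IH; rewrite iterS IH /sgn_step; ring.
rewrite ler_norml => /andP[s1 s2]; have [s0|s0|->] := ltrgt0P s.
- by rewrite gtr0_sg//; apply: pos; rewrite s0.
- rewrite ltr0_sg//; have /pos h : 0 < - s <= 1 by lra.
  rewrite (_ : (fun n => iter n sgn_step s) = (fun n => - iter n sgn_step (- s))); first exact: cvgN h.
  by apply/funext => n; rewrite opp opprK.
- by rewrite sgr0; under eq_fun do rewrite zero; exact: cvg_cst.
Qed.

(** With [c] ranging over all complex numbers, the vanishing of the real functional [Rint] says that
    every complex Fourier coefficient is zero. *)
Definition null_coeffs F := cintegrable F /\
  forall (c : R[i]) (n : int), Rint (fun x => c * (F x * (x : R[i]) ^ n)) = 0.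

Lemma null_coeffsZ c F : null_coeffs F -> null_coeffs (fun x => c * F x).
Proof.
move=> [cF F0]; split; first exact: cintegrableZ.
by move=> d n; rewrite -(F0 (d * c) n); apply: eq_Rint => x; rewrite !mulrA.
Qed.

Lemma null_coeffsD F f : null_coeffs F -> null_coeffs f -> null_coeffs (fun x => F x + f x).
Proof.
move=> [cF F0] [cf f0]; split; first exact: cintegrableD.
move=> c n; rewrite (@eq_Rint _ _ (fun x =>
   c * (F x * (x : R[i]) ^ n) + c * (f x * (x : R[i]) ^ n))); last by move=> x; congr Re; ring.
by rewrite RintD ?F0 ?f0 ?addr0//; apply: cintegrableZ; exact: cintegrable_expzM.
Qed.

Lemma null_coeffsX F (k : int) : null_coeffs F -> null_coeffs (fun x => F x * (x : R[i]) ^ k).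
Proof.
move=> [cF F0]; split; first exact: cintegrable_expzM.
by move=> c n; rewrite -(F0 c (k + n)); apply: eq_Rint => x; rewrite expzD [F x * (_ * _)]mulrA.
Qed.

(* Multipliers form an algebra which contains the coordinates and is closed
   under bounded pointwise limits, hence contains the indicators of all Borel
   sets. *)
Definition multiplier h := [/\ measurable_fun setT h, exists c, forall x, `|h x| <= c &
  forall F, null_coeffs F -> null_coeffs (fun x => (h x)%:C * F x)].

Lemma multiplier_cst c : multiplier (fun=> c).
Proof.
by split; [exact: measurable_cst|exists `|c| |move=> F; exact: null_coeffsZ].
Qed.

Lemma multiplierD h k : multiplier h -> multiplier k -> multiplier (fun x => h x + k x).
Proof.
move=> [mh [a ha] Mh] [mk [b kb] Mk]; split.
- exact: measurable_funD.
- by exists (a + b) => x; rewrite (le_trans (ler_normD _ _))// lerD.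
- move=> F nF; have := null_coeffsD (Mh _ nF) (Mk _ nF); congr null_coeffs.
  by apply/funext => x; rewrite rmorphD mulrDl.
Qed.

Lemma multiplierM h k : multiplier h -> multiplier k -> multiplier (fun x => h x * k x).
Proof.
move=> [mh [a ha] Mh] [mk [b kb] Mk]; split.
- exact: measurable_funM.
- by exists (a * b) => x; rewrite normrM ler_pM.
- move=> F nF; have := Mh _ (Mk _ nF); congr null_coeffs.
  by apply/funext => x; rewrite rmorphM mulrA.
Qed.

(** The common bound [c] yields the majorant |c d F|, so the coefficients of the products pass to
    the limit by dominated convergence. *)
Lemma multiplier_cvg (hn : nat -> circle R -> R) h (c : R) : (forall n, multiplier (hn n)) ->
  (forall n x, `|hn n x| <= c) -> (forall x, hn n x @[n --> \oo] --> h x) -> multiplier h.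
Proof.
move=> Mhn hnc hnh.
have mh : measurable_fun setT h.
  by apply: measurable_fun_cvg => [n|x _]; [have [] := Mhn n|exact: hnh].
have hc x : `|h x| <= c.
  rewrite -(cvg_lim _ (cvg_norm (hnh x)))//; apply: limr_le.
    by apply/cvgP; exact: (cvg_norm (hnh x)).
  by apply: nearW => n; exact: hnc.
split => // [|F [cF F0]]; first by exists c.
have chF : cintegrable (fun x => (h x)%:C * F x).
  apply: (@cintegrableMb _ (fun x => (h x)%:C) F c) => //.
  by apply: aeW => x; rewrite normc_real.
split => // d k.
have [mF _] := cF.
have [|||||_] := @dominated_cintegrable _
  (fun n x => d * ((hn n x)%:C * F x * (x : R[i]) ^ k))
  (fun x => d * ((h x)%:C * F x * (x : R[i]) ^ k))
  (fun x => (c%:C * d) * F x).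
- move=> n; have [mhn _ _] := Mhn n.
  apply: cmeasurableM; first exact: cmeasurable_cst.
  apply: cmeasurableM; last exact: cmeasurable_expz.
  by apply: cmeasurableM => //; exact: cmeasurableC.
- apply: cmeasurableM; first exact: cmeasurable_cst.
  apply: cmeasurableM; last exact: cmeasurable_expz.
  by apply: cmeasurableM => //; exact: cmeasurableC.
- exact: cintegrableZ.
- move=> n; apply: aeW => x; rewrite !Normc.normcM normc_expz !normc_real mulr1.
  rewrite mulrA [normc d * _]mulrC !ler_wpM2r ?normc_ge0//.
  by rewrite (le_trans (hnc n x))// ler_norm.
- apply: aeW => x; apply: ccvgMl; apply: ccvgM; last exact: ccvg_cst.
  apply: ccvgM; last exact: ccvg_cst.
  by split => //=; exact: cvg_cst.
- have -> : (fun n => Rint (fun x => d * ((hn n x)%:C * F x * (x : R[i]) ^ k))) = (fun=> 0).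
    by apply/funext => n; have [_ _ /(_ F (conj cF F0))[_ ->]] := Mhn n.
  by move=> h0; rewrite -(cvg_lim _ h0)// lim_cst.
Qed.

(** On the circle the conjugate of z is its inverse, so the real part is half the sum of z and z^-1,
    and multiplication by a power of z merely shifts the coefficients. *)
Lemma multiplier_Re : multiplier (fun x => Re x).
Proof.
split.
- by have [] := @cmeasurable_circle_val R.
- by exists 1 => x; rewrite -(normc_circle x) norm_Re_le.
- move=> F nF; have := null_coeffsZ (2^-1) (null_coeffsD (null_coeffsX 1 nF) (null_coeffsX (-1) nF)).
  congr null_coeffs; apply/funext => x; rewrite -conjc_expz expr1z -mulrDr addcJ.
  by field.
Qed.

Lemma multiplier_Im : multiplier (fun x => Im x).
Proof.
split.
- by have [] := @cmeasurable_circle_val R.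
- by exists 1 => x; rewrite -(normc_circle x) norm_Im_le.
- move=> F nF.
  have := null_coeffsZ ('i%C^-1 / 2)
    (null_coeffsD (null_coeffsX 1 nF) (null_coeffsZ (-1) (null_coeffsX (-1) nF))).
  congr null_coeffs; apply/funext => x; rewrite -conjc_expz expr1z mulN1r -mulrBr subcJ.
  have i0 : 'i%C != 0 :> R[i] by rewrite eq_complex /= oner_eq0 andbF.
  by field.
Qed.

Lemma multiplier_sg h : multiplier h -> (forall x, `|h x| <= 1) -> multiplier (fun x => Num.sg (h x)).
Proof.
move=> Mh h1; apply: (@multiplier_cvg (fun n x => iter n sgn_step (h x)) _ 1).
- elim=> [|n IH] //=; rewrite /sgn_step.
  have -> : (fun x => iter n sgn_step (h x) * (3 - iter n sgn_step (h x) ^+ 2) / 2) = (fun x =>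
      iter n sgn_step (h x) * (3 + (-1) * (iter n sgn_step (h x) * iter n sgn_step (h x))) * 2^-1).
    by apply/funext => x; rewrite mulN1r expr2.
  by do ![exact: multiplier_cst|exact: IH|apply: multiplierM|apply: multiplierD].
- move=> n x; have := h1 x; rewrite !ler_norml.
  elim: n => [|n IH] // hx; move: (IH hx); rewrite iterS.
  move: (iter n sgn_step (h x)) => r /andP[r1 r2].
  rewrite -subr_ge0 -[_ <= 1]subr_ge0.
  have -> : sgn_step r - -1 = (1 + r) ^+ 2 * (2 - r) / 2 by rewrite /sgn_step; field.
  have -> : 1 - sgn_step r = (1 - r) ^+ 2 * (2 + r) / 2 by rewrite /sgn_step; field.
  by apply/andP; split; rewrite divr_ge0// mulr_ge0 ?sqr_ge0//; lra.
- by move=> x; exact: iter_sgn_step_cvg.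
Qed.

Definition multiplier_set (A : set (circle R)) := multiplier (\1_A).

Lemma multiplier_gt h (a : R) : multiplier h -> (forall x, `|h x| <= 1) ->
  multiplier_set [set x | a < h x].
Proof.
(* This factor brings h - a into [-1, 1], where the sign iteration converges. *)
move=> Mh h1; pose c := (1 + `|a|)^-1.
have c0 : 0 < c by rewrite invr_gt0 ltr_pwDl.
have Mk : multiplier (fun x => c * (h x + - a)).
  by do ![exact: multiplier_cst|exact: Mh|apply: multiplierM|apply: multiplierD].
have k1 x : `|c * (h x + - a)| <= 1.
  rewrite normrM gtr0_norm// ler_pdivrMl ?mulr1 ?ltr_pwDl//.
  by rewrite (le_trans (ler_normD _ _))// normrN lerD2r.
have Ms := multiplier_sg Mk k1.
(* For s in {-1, 0, 1}, (s + s^2) / 2 is 1 at s = 1 and 0 otherwise. *)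
have : multiplier (fun x => 2^-1 * (Num.sg (c * (h x + - a)) +
    Num.sg (c * (h x + - a)) * Num.sg (c * (h x + - a)))).
  by do ![exact: multiplier_cst|exact: Ms|apply: multiplierM|apply: multiplierD].
congr multiplier; apply/funext => x; rewrite indicE sgrM gtr0_sg// mul1r.
have [ha|ha|ha] := ltrgtP a (h x).
- by rewrite gtr0_sg ?subr_gt0// mem_set//= mulr1 mulVf.
- by rewrite ltr0_sg ?subr_lt0// memNset//= ?mulrNN ?mulr1 ?addNr ?mulr0//; apply/negP; rewrite -leNgt ltW.
- by rewrite -ha subrr sgr0 mulr0 addr0 mulr0 memNset//= -ha ltxx.
Qed.

Lemma sigma_algebra_multiplier_set : sigma_algebra setT multiplier_set.
Proof.
split.
- by rewrite /multiplier_set indic0; exact: multiplier_cst.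
- move=> A MA; have : multiplier (fun x => 1 + (-1) * \1_A x).
    by do ![exact: multiplier_cst|exact: MA|apply: multiplierM|apply: multiplierD].
  congr multiplier; apply/funext => x; rewrite setTD !indicE in_setC.
  by case: (x \in A); rewrite mulN1r ?subrr ?subr0.
- move=> A MA.
  have MU n : multiplier_set (\big[setU/set0]_(k < n) A k).
    elim: n => [|n IH].
      by rewrite big_ord0 /multiplier_set indic0; exact: multiplier_cst.
    rewrite big_ord_recr /=; move: (\big[_/_]_(_ < _) _) IH => B MB.
    have : multiplier (fun x => \1_B x + \1_(A n) x + (-1) * (\1_B x * \1_(A n) x)).
      by do ![exact: multiplier_cst|exact: MA|exact: MB|apply: multiplierM|apply: multiplierD].
    congr multiplier; apply/funext => x; rewrite !indicE in_setU.
    by case: (x \in B); case: (x \in A n) => /=; ring.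
  apply: (@multiplier_cvg (fun n => \1_(\big[setU/set0]_(k < n) A k)) _ 1) => //.
    by move=> n x; rewrite indicE; case: (_ \in _); rewrite ?normr1 ?normr0.
  move=> x; apply: cvg_near_cst; have [[k _ Akx]|nAx] := pselect ((\bigcup_k A k) x).
  - exists k.+1 => // n /= kn; rewrite !indicE !mem_set//; first by exists k.
    by rewrite -bigcup_mkord; exists k.
  - apply: nearW => n; rewrite !indicE !memNset// -bigcup_mkord => -[k _ Akx].
    by apply: nAx; exists k.
Qed.

Lemma multiplier_set_preimage h (B : set R) : multiplier h -> (forall x, `|h x| <= 1) ->
  measurable B -> multiplier_set (h @^-1` B).
Proof.
move=> Mh h1 mB; have : (@RGenOInfty.G R).-sigma.-measurable B by rewrite -RGenOInfty.measurableE.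
move: {mB} B; apply: (@smallest_sub _ _ _ [set B | multiplier_set (h @^-1` B)]).
  have [S0 SC SU] := sigma_algebra_multiplier_set; split => [|A|A MA] /=; first exact: S0.
    by rewrite setTD preimage_setC -setTD; exact: SC.
  by rewrite preimage_bigcup; exact: SU.
move=> _ [a ->] /=; have := multiplier_gt a Mh h1; congr multiplier_set.
by apply/seteqP; split => x /=; rewrite in_itv /= andbT.
Qed.

Lemma multiplier_measurable (A : set (circle R)) : measurable A -> multiplier_set A.
Proof.
case=> B mB <-; rewrite setTI; have : g_sigma_preimageU fst snd B := mB.
move: {mB} B; apply: (@smallest_sub _ _ _ [set B | multiplier_set (@circle_coord R @^-1` B)]).
  have [S0 SC SU] := sigma_algebra_multiplier_set; split => [|B|B MB] /=; first exact: S0.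
    by rewrite setTD preimage_setC -setTD; exact: SC.
  by rewrite preimage_bigcup; exact: SU.
move=> _ [[B mB <-]|[B mB <-]] /=; rewrite setTI.
- apply: (multiplier_set_preimage multiplier_Re) => // x.
  by rewrite -(normc_circle x) norm_Re_le.
- apply: (multiplier_set_preimage multiplier_Im) => // x.
  by rewrite -(normc_circle x) norm_Im_le.
Qed.

(** The indicator of the set where Re F > 0 is a multiplier; the zeroth coefficient of its product
    with F is the integral of the positive part of Re F, which therefore vanishes. *)
Lemma null_coeffs_Re_le0 F : null_coeffs F -> \forall x \ae m, Re (F x) <= 0.
Proof.
move=> nF; have [[mF _] _] := nF.1.
have mA : measurable [set x | 0 < Re (F x)].
  have := mF measurableT _ (measurable_itv `]0, +oo[); rewrite setTI.
  by congr measurable; apply/seteqP; split => x /=; rewrite in_itv /= andbT.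
have [_ _ /(_ _ nF)[cAF /(_ 1 0)]] := multiplier_measurable mA.
rewrite (@eq_Rint _ _ (fun x => (\1_[set x | 0 < Re (F x)] x)%:C * F x)); last first.
  by move=> x; rewrite expr0z mul1r mulr1.
move/(Rint_eq0 cAF) => h.
have : \forall x \ae m, Re ((\1_[set x | 0 < Re (F x)] x)%:C * F x) = 0.
  apply: h; apply: aeW => x; rewrite ReM /= mul0r subr0 indicE.
  by have [/set_mem/= /ltW|_] := boolP (x \in _); rewrite ?mul1r ?mul0r.
apply: filterS => x; rewrite ReM /= mul0r subr0 indicE.
have [/set_mem/= _|/negP] := boolP (x \in _); first by rewrite mul1r => ->.
by rewrite inE /= => /negP; rewrite -leNgt.
Qed.

(** The one-sided estimate applies to F, -F, iF and -iF. *)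
Lemma null_coeffs_eq0 F : null_coeffs F -> \forall x \ae m, F x = 0.
Proof.
move=> nF.
have := null_coeffs_Re_le0 nF.
have := null_coeffs_Re_le0 (null_coeffsZ (-1) nF).
have := null_coeffs_Re_le0 (null_coeffsZ 'i%C nF).
have := null_coeffs_Re_le0 (null_coeffsZ (-'i%C) nF).
move=> h1 h2 h3 h4; near=> x; apply/eqP; rewrite eq_complex /=.
have H1 : Re (- 'i * F x) <= 0 by near: x.
have H2 : Re ('i * F x) <= 0 by near: x.
have H3 : Re (- 1 * F x) <= 0 by near: x.
have H4 : Re (F x) <= 0 by near: x.
move: H1 H2 H3 H4; rewrite !ReImE /=; case: (F x) => a b /=.
by rewrite !eq_le; lra.
Unshelve. all: by end_near. Qed.

End uniqueness.

(** * Square-integrable functions and projections *)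

Section square_integrable.
Context {R : realType}.
Implicit Types (f g h W : circle R -> R[i]) (u v : nat -> circle R -> R[i]).
Local Open Scope complex_scope.
Local Notation m := (@circle_measure R).

Definition square_integrable f :=
  cmeasurable f /\ cintegrable (fun x => (normc (f x) ^+ 2)%:C).

Definition sqnorm f : R := Rint (fun x => (normc (f x) ^+ 2)%:C).

Lemma cmeasurable_sqr_normc f : cmeasurable f -> cmeasurable (fun x => (normc (f x) ^+ 2)%:C).
Proof. by move=> mf; apply: cmeasurableC; apply: measurable_funX; exact: measurable_normc. Qed.

Lemma le_square_integrable f g : cmeasurable f -> square_integrable g ->
  (\forall x \ae m, normc (f x) <= normc (g x)) -> square_integrable f.
Proof.
move=> mf [mg ig] fg; split => //; apply: le_cintegrable ig _.
  exact: cmeasurable_sqr_normc.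
apply: filterS fg => x fg; rewrite !normc_real !ger0_norm ?sqr_ge0//.
by rewrite ler_pXn2r// nnegrE normc_ge0.
Qed.

Lemma square_integrableD f g : square_integrable f -> square_integrable g ->
  square_integrable (fun x => f x + g x).
Proof.
move=> [mf sf] [mg sg]; split; first exact: cmeasurableD.
apply: (@le_cintegrable _ _ (fun x => 2%:C * (normc (f x) ^+ 2)%:C + 2%:C * (normc (g x) ^+ 2)%:C)).
- by apply: cmeasurable_sqr_normc; exact: cmeasurableD.
- by apply: cintegrableD; exact: cintegrableZ.
- apply: aeW => x; rewrite -!rmorphM -rmorphD !normc_real !ger0_norm ?sqr_ge0//.
    exact: sqr_normcD_le.
  by rewrite addr_ge0// mulr_ge0// sqr_ge0.
Qed.

Lemma square_integrableMb f g (c : R) : cmeasurable f -> (\forall x \ae m, normc (f x) <= c) ->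
  square_integrable g -> square_integrable (fun x => f x * g x).
Proof.
move=> mf fc [mg sg]; split; first exact: cmeasurableM.
have -> : (fun x => (normc (f x * g x) ^+ 2)%:C) =
    (fun x => (normc (f x) ^+ 2)%:C * (normc (g x) ^+ 2)%:C).
  by apply/funext => x; rewrite Normc.normcM exprMn rmorphM.
apply: (@cintegrableMb _ _ _ (c ^+ 2)) => //; first exact: cmeasurable_sqr_normc.
apply: filterS fc => x fc; rewrite normc_real ger0_norm ?sqr_ge0//.
by rewrite ler_pXn2r// nnegrE ?normc_ge0// (le_trans _ fc) ?normc_ge0.
Qed.

Lemma square_integrableZ (c : R[i]) f : square_integrable f ->
  square_integrable (fun x => c * f x).
Proof.
by apply: (@square_integrableMb _ _ (normc c)); [exact: cmeasurable_cst|exact: aeW].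
Qed.

Lemma square_integrableN f : square_integrable f -> square_integrable (fun x => - f x).
Proof. by under eq_fun do rewrite -mulN1r; exact: square_integrableZ. Qed.

Lemma square_integrableB f g : square_integrable f -> square_integrable g ->
  square_integrable (fun x => f x - g x).
Proof. by move=> sf sg; apply: square_integrableD => //; exact: square_integrableN. Qed.

Lemma square_integrable_expzM (n : int) f : square_integrable f ->
  square_integrable (fun x => (x : R[i]) ^ n * f x).
Proof.
apply: (@square_integrableMb _ _ 1); first exact: cmeasurable_expz.
by apply: aeW => x; rewrite normc_expz.
Qed.

Lemma square_integrable_bounded f (c : R) : cmeasurable f ->
  (\forall x \ae m, normc (f x) <= c) -> square_integrable f.
Proof.
move=> mf fc; split => //; apply: (@cintegrable_bounded _ _ (c ^+ 2)).
  exact: cmeasurable_sqr_normc.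
apply: filterS fc => x fc; rewrite normc_real ger0_norm ?sqr_ge0//.
by rewrite ler_pXn2r// nnegrE ?normc_ge0// (le_trans _ fc) ?normc_ge0.
Qed.

Lemma square_integrable_cst (c : R[i]) : square_integrable (fun=> c).
Proof.
by apply: (@square_integrable_bounded _ (normc c)); [exact: cmeasurable_cst|exact: aeW].
Qed.

Lemma square_integrable_normc f : square_integrable f ->
  square_integrable (fun x => (normc (f x))%:C).
Proof.
move=> sf; have [mf _] := sf; apply: (le_square_integrable _ sf).
  by apply: cmeasurableC; exact: measurable_normc.
by apply: aeW => x; rewrite normc_real ger0_norm ?normc_ge0.
Qed.

Lemma square_integrable_comp_conj f : square_integrable f ->
  square_integrable (fun x => f (circle_conj x)).
Proof.
by move=> [mf sf]; split; [exact: cmeasurable_comp_conj|exact: (cintegrable_comp_conj sf)].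
Qed.

Lemma square_integrableJ f : square_integrable f -> square_integrable (fun x => (f x)^*).
Proof.
move=> sf; have [mf _] := sf; apply: (le_square_integrable _ sf); first exact: cmeasurableJ.
by apply: aeW => x; rewrite normc_conj.
Qed.

Lemma square_integrable_cintegrable f : square_integrable f -> cintegrable f.
Proof.
move=> [mf sf]; apply: (@le_cintegrable _ _ (fun x => 1%:C + (normc (f x) ^+ 2)%:C)) => //.
  by apply: cintegrableD => //; exact: cintegrable_cst.
apply: aeW => x; rewrite -rmorphD normc_real ger0_norm ?addr_ge0 ?sqr_ge0//.
by have := sqr_ge0 (normc (f x) - 1); nra.
Qed.

Lemma cintegrable_mul f g : square_integrable f -> square_integrable g ->
  cintegrable (fun x => f x * g x).
Proof.
move=> [mf sf] [mg sg].
apply: (@le_cintegrable _ _ (fun x => (normc (f x) ^+ 2)%:C + (normc (g x) ^+ 2)%:C)).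
- exact: cmeasurableM.
- exact: cintegrableD.
- apply: aeW => x; rewrite -rmorphD normc_real ger0_norm ?addr_ge0 ?sqr_ge0//.
  by rewrite Normc.normcM; have := sqr_ge0 (normc (f x) - normc (g x)); nra.
Qed.

Lemma cintegrable_mulJ f g : square_integrable f -> square_integrable g ->
  cintegrable (fun x => f x * (g x)^*).
Proof. by move=> sf sg; apply: cintegrable_mul => //; exact: square_integrableJ. Qed.

Lemma sqnorm_ge0 f : square_integrable f -> 0 <= sqnorm f.
Proof.
by move=> [mf [sf _]]; apply: Rint_ge0 => //; apply: aeW => x /=; exact: sqr_ge0.
Qed.

Lemma sqnormD f g : square_integrable f -> square_integrable g ->
  sqnorm (fun x => f x + g x) = sqnorm f + 2 * Rint (fun x => f x * (g x)^*) + sqnorm g.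
Proof.
move=> sf sg; have cfg := cintegrable_mulJ sf sg.
rewrite /sqnorm -RintZ// -RintD; [|by case: sf|exact: cintegrableZ].
rewrite -RintD; [|apply: cintegrableD; [by case: sf|exact: cintegrableZ]|by case: sg].
by apply: eq_Rint => x; rewrite !ReImE /= !sqr_normcE !ReImE; ring.
Qed.

Lemma sqnormZ (c : R) f : square_integrable f ->
  sqnorm (fun x => c%:C * f x) = c ^+ 2 * sqnorm f.
Proof.
move=> [_ sf]; rewrite /sqnorm -RintZ//; apply: eq_Rint => x.
by rewrite -rmorphM /= Normc.normcM normc_real exprMn real_normK ?num_real.
Qed.

Lemma parallelogram f g : square_integrable f -> square_integrable g ->
  sqnorm (fun x => f x + g x) + sqnorm (fun x => f x - g x) = 2 * sqnorm f + 2 * sqnorm g.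
Proof.
move=> sf sg; have sfg := square_integrableD sf sg; have sfg' := square_integrableB sf sg.
rewrite /sqnorm -!RintZ -?RintD; try (by case: sfg); try (by case: sfg'); try (by case: sf);
  try (by case: sg); try (by apply: cintegrableZ; case: sf); try (by apply: cintegrableZ; case: sg).
by apply: eq_Rint => x; rewrite !ReImE /= !sqr_normcE !ReImE; ring.
Qed.

(* Domination by a square-integrable function gives L2 convergence together
   with the possibility of passing to the limit in every pairing. *)
Definition dominated_cvg2 u f := [/\ forall n, cmeasurable (u n), cmeasurable f,
  exists W, square_integrable W /\ forall n, \forall x \ae m, normc (u n x) <= normc (W x) &
  \forall x \ae m, ccvg (u^~ x) (f x)].

Lemma dominated_cvg2_sqint u f : dominated_cvg2 u f ->
  (forall n, square_integrable (u n)) /\ square_integrable f.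
Proof.
move=> [mu mf [W [sW uW]] uf]; split => [n|]; first exact: le_square_integrable sW (uW n).
apply: (le_square_integrable mf sW); have uW' := ae_foralln uW.
by apply: filterS2 uW' uf => x h /ccvg_le; apply.
Qed.

Lemma dominated_cvg2_Rint u f g : dominated_cvg2 u f -> square_integrable g ->
  Rint (fun x => u n x * g x) @[n --> \oo] --> Rint (fun x => f x * g x).
Proof.
move=> [mu mf [W [sW uW]] uf] sg; have [mg _] := sg.
have [|||||_ //] := @dominated_cintegrable _ (fun n x => u n x * g x) (fun x => f x * g x)
  (fun x => W x * g x).
- by move=> n; exact: cmeasurableM.
- exact: cmeasurableM.
- exact: cintegrable_mul.
- move=> n; apply: filterS (uW n) => x h.
  by rewrite !Normc.normcM ler_wpM2r ?normc_ge0.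
- by apply: filterS uf => x h; apply: ccvgM => //; exact: ccvg_cst.
Qed.

Lemma dominated_cvg2_sqnorm u f : dominated_cvg2 u f -> sqnorm (u n) @[n --> \oo] --> sqnorm f.
Proof.
move=> [mu mf [W [sW uW]] uf]; have [mW iW] := sW.
have [|||||_ //] := @dominated_cintegrable _ (fun n x => (normc (u n x) ^+ 2)%:C)
  (fun x => (normc (f x) ^+ 2)%:C) (fun x => (normc (W x) ^+ 2)%:C).
- by move=> n; exact: cmeasurable_sqr_normc.
- exact: cmeasurable_sqr_normc.
- by [].
- move=> n; apply: filterS (uW n) => x h; rewrite !normc_real !ger0_norm ?sqr_ge0//.
  by rewrite ler_pXn2r// nnegrE normc_ge0.
- by apply: filterS uf => x h; split; [exact: ccvg_sqr_normc|exact: cvg_cst].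
Qed.

Lemma dominated_cvg2Mb u f h (c : R) : dominated_cvg2 u f -> cmeasurable h ->
  (\forall x \ae m, normc (h x) <= c) ->
  dominated_cvg2 (fun n x => h x * u n x) (fun x => h x * f x).
Proof.
move=> [mu mf [W [sW uW]] uf] mh hc; split.
- by move=> n; exact: cmeasurableM.
- exact: cmeasurableM.
- exists (fun x => c%:C * W x); split; first exact: square_integrableZ.
  move=> n; apply: filterS2 hc (uW n) => x hx ux.
  by rewrite !Normc.normcM normc_real ler_pM ?normc_ge0// (le_trans hx) ?ler_norm.
- by apply: filterS uf => x; exact: ccvgMl.
Qed.

Lemma dominated_cvg2Bl u f h : dominated_cvg2 u f -> square_integrable h ->
  dominated_cvg2 (fun n x => h x - u n x) (fun x => h x - f x).
Proof.
move=> [mu mf [W [sW uW]] uf] sh; have [mh _] := sh; split.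
- by move=> n; exact: cmeasurableB.
- exact: cmeasurableB.
- exists (fun x => (normc (h x))%:C + (normc (W x))%:C); split.
    by apply: square_integrableD; exact: square_integrable_normc.
  move=> n; apply: filterS (uW n) => x ux.
  rewrite -rmorphD normc_real ger0_norm ?addr_ge0 ?normc_ge0//.
  by rewrite (le_trans (le_normcD _ _))// normcN lerD2l.
- by apply: filterS uf => x; apply: ccvgB; exact: ccvg_cst.
Qed.

End square_integrable.

(** * Fast L^2 convergence, minimizing sequences and projections *)

Section riesz_fischer.
Context {R : realType}.
Implicit Types (f g h W : circle R -> R[i]) (u v : nat -> circle R -> R[i]).
Local Open Scope complex_scope.
Local Notation m := (@circle_measure R).

Lemma nneseries_le (a : nat -> \bar R) (c : \bar R) : (forall n, (0 <= a n)%E) ->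
  (forall n, (\sum_(0 <= i < n) a i <= c)%E) -> (\sum_(i <oo) a i <= c)%E.
Proof.
move=> a0 ac; apply: lime_le; last exact: nearW.
by apply: is_cvg_nneseries.
Qed.

(** The integral of 2^n d_n is at most C 2^-n, so the weighted series has integral at most 2 C and
    is finite almost everywhere. Half of the rate 4^-n is thus spent on summability, while the
    weights 2^n survive as pointwise decay. *)
Lemma ae_summable (d : nat -> circle R -> R) (C : R) :
  (forall n x, 0 <= d n x) -> (forall n, cintegrable (fun x => (d n x)%:C)) ->
  (forall n, Rint (fun x => (d n x)%:C) <= C * 4^-1 ^+ n) ->
  exists S : circle R -> R, [/\ cintegrable (fun x => (S x)%:C), forall x, 0 <= S x &
    \forall x \ae m, forall N, \sum_(n < N) 2 ^+ n * d n x <= S x].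
Proof.
move=> d0 cd dC; pose g n x : \bar R := (2 ^+ n * d n x)%:E.
have g0 n x : (0 <= g n x)%E by rewrite lee_fin mulr_ge0.
have ig n : m.-integrable setT (EFin \o (fun x => 2 ^+ n * d n x)).
  exact: integrableZl (cintegrable_Re (cd n)).
have mg n : measurable_fun setT (g n) by have /integrableP[] := ig n.
have C0 : 0 <= C.
  have := dC 0%N; rewrite expr0 mulr1; apply: le_trans.
  by apply: Rint_ge0; [have [] := cd 0%N|apply: aeW => x; exact: d0].
pose G x : \bar R := (\sum_(n <oo) g n x)%E.
have G0 x : (0 <= G x)%E by apply: nneseries_ge0 => n _ _; exact: g0.
have mG : measurable_fun setT G.
  by apply: ge0_emeasurable_sum => // n x _ _; exact: g0.
have iG : m.-integrable setT G.
  apply/integrableP; split => //.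
  under eq_integral do rewrite gee0_abs//.
  rewrite integral_nneseries//; apply: (@le_lt_trans _ _ (2 * C)%:E); last exact: ltry.
  apply: nneseries_le => [n|n]; first by apply: integral_ge0 => x _; exact: g0.
  apply: (@le_trans _ _ (\sum_(0 <= i < n) (C * 2^-1 ^+ i)%:E)%E).
    apply: lee_sum => i _.
    have E : fine (\int[m]_x g i x) = 2 ^+ i * Rint (fun x => (d i x)%:C).
      by rewrite /Rint -RintegralZl//; exact: (cintegrable_Re (cd i)).
    rewrite -[leLHS](fineK (integrable_fin_num measurableT (ig i))) lee_fin.
    rewrite -[X in X <= _]/(fine (\int[m]_x g i x)) E.
    apply: le_trans (ler_wpM2l _ (dC i)) _ => //.
    by rewrite mulrCA -exprMn; have -> : 2 * 4^-1 = 2^-1 :> R by field.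
  rewrite sumEFin lee_fin -mulr_sumr mulrC ler_wpM2r//.
  rewrite big_mkord.
  suff -> : \sum_(i < n) 2^-1 ^+ i = 2 - 2 * 2^-1 ^+ n :> R.
    by rewrite gerBl mulr_ge0// exprn_ge0.
  elim: n => [|n IH]; first by rewrite big_ord0 expr0; lra.
  by rewrite big_ord_recr /= IH exprS; lra.
(* Where the series diverges [fine] returns 0, which concerns a null set only. *)
exists (fun x => fine (G x)); split.
- apply: cintegrableC; apply: (le_integrable measurableT _ _ iG).
    exact/measurable_EFinP/(measurableT_comp (fine_measurable _)).
  by move=> x _ /=; case: (G x) => //= *; rewrite normr0 leey.
- by move=> x; exact: fine_ge0.
- have := integrable_ae measurableT iG; apply: filterS => x /(_ I) Gfin K.
  rewrite -lee_fin (fineK Gfin) -sumEFin.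
  have := @nneseries_lim_ge _ (fun n => g n x) xpredT 0%N K (fun n _ _ => g0 n x).
  by rewrite big_mkord.
Qed.

(** Cauchy-Schwarz with weights 2^-n and 2^n; the first factor is the partial sum of the geometric
    series. *)
Lemma sqr_sum_le (a : nat -> R) N :
  (\sum_(n < N) a n) ^+ 2 <= (2 - 2 * 2^-1 ^+ N) * \sum_(n < N) 2 ^+ n * a n ^+ 2.
Proof.
elim: N => [|N IH]; first by rewrite !big_ord0 mulr0 expr0n.
rewrite !big_ord_recr /=.
set e := 2^-1 ^+ N in IH *; have e0 : 0 < e by rewrite exprn_gt0.
have -> : 2 ^+ N = e^-1 :> R by rewrite /e exprVn invrK.
have e1 : e <= 1 by apply: exprn_ile1; lra.
have S0 : 0 <= \sum_(n < N) 2 ^+ n * a n ^+ 2.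
  by apply: sumr_ge0 => i _; apply: mulr_ge0; [exact: exprn_ge0|exact: sqr_ge0].
rewrite [2^-1 ^+ N.+1]exprS -/e; move: S0; move: (\sum_(_ < _) a _) (\sum_(_ < _) _ * _) IH => b S bS S0.
pose y := a N / e; have -> : a N = y * e by rewrite /y divfK// gt_eqF.
have -> : e^-1 * (y * e) ^+ 2 = e * y ^+ 2 by field; rewrite gt_eqF.
rewrite -subr_ge0; have -> : (2 - 2 * (2^-1 * e)) * (S + e * y ^+ 2) - (b + y * e) ^+ 2 =
    ((2 - 2 * e) * S - b ^+ 2) + e * ((2 - 2 * e) * y ^+ 2 + S - 2 * b * y) by field.
apply: addr_ge0; first by rewrite subr_ge0.
apply: mulr_ge0; first exact: ltW.
(* Multiplied by 2 - 2 e, the remaining quadratic in [y] is a square plus a term that is nonnegative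
   by induction. When this factor vanishes the induction hypothesis forces b = 0. *)
have [A0|A0] := leP (2 - 2 * e) 0.
  have eE : 2 - 2 * e = 0 by lra.
  have b0 : b = 0.
    by apply/eqP; rewrite -sqrf_eq0 eq_le sqr_ge0 andbT (le_trans bS)// eE mul0r.
  by rewrite eE b0 mul0r add0r mulr0 mul0r subr0.
rewrite -(pmulr_rge0 _ A0).
have -> : (2 - 2 * e) * ((2 - 2 * e) * y ^+ 2 + S - 2 * b * y) =
  ((2 - 2 * e) * y - b) ^+ 2 + ((2 - 2 * e) * S - b ^+ 2) by ring.
by rewrite addr_ge0 ?sqr_ge0// subr_ge0.
Qed.

Lemma quadratic_ge0_eq0 (a b : R) : 0 <= a -> (forall t, 0 <= t ^+ 2 * a - 2 * t * b) -> b = 0.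
Proof.
(* The denominator a + 1 instead of a covers the case a = 0; at this t the expression equals - t^2
   (a + 2). *)
move=> a0 /(_ (b / (a + 1))); have a1 : a + 1 != 0 by rewrite gt_eqF// ltr_wpDl.
have -> : (b / (a + 1)) ^+ 2 * a - 2 * (b / (a + 1)) * b = - (b / (a + 1)) ^+ 2 * (a + 2).
  by field.
rewrite mulNr oppr_ge0 pmulr_lle0; last by lra.
rewrite real_exprn_even_le0 ?num_real//= mulf_eq0 invr_eq0 (negbTE a1) orbF.
by move/eqP.
Qed.

(** The core of the Riesz-Fischer theorem. Outside a null set the increments sum to at most sqrt (2
    S) with S integrable, which gives both convergence and the square-integrable majorant |u_0| +
    sqrt (2 S). *)
Lemma rapid_dominated_cvg2 u (C : R) : (forall n, square_integrable (u n)) ->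
  (forall n, sqnorm (fun x => u n.+1 x - u n x) <= C * 4^-1 ^+ n) ->
  exists f, dominated_cvg2 u f.
Proof.
move=> su uC; pose d n x := normc (u n.+1 x - u n x) ^+ 2.
have sd n := square_integrableB (su n.+1) (su n).
have [|||S [cS S0 [N [mN N0 NS]]]] := @ae_summable d C.
- by move=> n x; exact: sqr_ge0.
- by move=> n; have [] := sd n.
- exact: uC.
have good x : ~ N x -> forall K, \sum_(n < K) 2 ^+ n * d n x <= S x.
  by move=> Nx; apply: contrapT => h; apply: Nx; exact: NS.
have sumS x K : ~ N x -> \sum_(n < K) normc (u n.+1 x - u n x) <= Num.sqrt (2 * S x).
  move=> /good /(_ K) h.
  rewrite -(ler_pXn2r (n := 2))// ?nnegrE ?sqrtr_ge0 ?sumr_ge0//; last first.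
    by move=> i _; exact: normc_ge0.
  rewrite sqr_sqrtr ?mulr_ge0// (le_trans (@sqr_sum_le (fun n => normc (u n.+1 x - u n x)) K))//.
  apply: ler_pM => //; last 1 first.
  - by rewrite gerBl mulr_ge0// exprn_ge0.
  - by rewrite subr_ge0 ler_piMr//; apply: exprn_ile1; lra.
  - by apply: sumr_ge0 => i _; rewrite mulr_ge0// sqr_ge0.
(* Setting the sequence to zero on the exceptional set makes it converge everywhere, so that the
   limit is measurable. *)
pose w n x := (\1_(~` N) x : R[i]) * u n x.
have wE n x : ~ N x -> w n x = u n x by move=> Nx; rewrite /w indicE mem_set// mul1r.
have real_cvg (t : nat -> R) x : ~ N x -> (forall n, `|t n.+1 - t n| <= normc (u n.+1 x - u n x)) ->
    cvgn t.
  move=> Nx tu; suff h : cvgn (series (telescope t)).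
    have -> : t = (fun n => t 0%N + series (telescope t) n).
      by apply/funext => n; exact: eq_sum_telescope.
    by apply: is_cvgD => //; exact: is_cvg_cst.
  apply: normed_cvg; apply: nondecreasing_is_cvgn.
    by apply: nondecreasing_series => i _ _; exact: normr_ge0.
  exists (Num.sqrt (2 * S x)) => _ [n _ <-]; apply: le_trans (sumS x n Nx).
  rewrite -[leLHS]/(\sum_(0 <= k < n) `|telescope t k|) big_mkord.
  by apply: ler_sum => i _; exact: tu.
pose f x := (limn (fun n => Re (w n x))) +i* (limn (fun n => Im (w n x))).
have wf x : ccvg (w^~ x) (f x).
  have [Nx|Nx] := pselect (N x).
    have w0 n : w n x = 0 by rewrite /w indicE memNset ?mul0r// => /(_ Nx).
    have E1 : (fun n => Re (w n x)) = (fun=> 0) by apply/funext => n; rewrite w0.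
    have E2 : (fun n => Im (w n x)) = (fun=> 0) by apply/funext => n; rewrite w0.
    by split; rewrite /= ?E1 ?E2 lim_cst//; exact: cvg_cst.
  split => /=; apply: (real_cvg _ x Nx) => n; rewrite !wE//.
  - by have := norm_Re_le (u n.+1 x - u n x); rewrite !ReImE.
  - by have := norm_Im_le (u n.+1 x - u n x); rewrite !ReImE.
have mw n : cmeasurable (w n).
  apply: cmeasurableM; last by have [] := su n.
  by apply: cmeasurable_indic; exact: measurableC.
have mS : measurable_fun setT S by case: cS => -[].
exists f; split.
- by move=> n; have [] := su n.
- exact: cmeasurable_cvg mw wf.
- exists (fun x => (normc (u 0%N x))%:C + (Num.sqrt (2 * S x))%:C); split.
    apply: square_integrableD; first exact: square_integrable_normc.
    split.
      apply: cmeasurableC; apply: (measurableT_comp (@measurable_sqrt R)).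
      exact: measurable_funM.
    have -> : (fun x => (normc (Num.sqrt (2 * S x))%:C ^+ 2)%:C) = (fun x => 2%:C * (S x)%:C).
      apply/funext => x; rewrite normc_real ger0_norm ?sqrtr_ge0// sqr_sqrtr ?mulr_ge0//.
      by rewrite rmorphM.
    exact: cintegrableZ.
  move=> n; exists N; split => // x; apply: contra_notP => Nx.
  change (normc (u n x) <= normc ((normc (u 0%N x))%:C + (Num.sqrt (2 * S x))%:C)).
  rewrite -rmorphD normc_real ger0_norm ?addr_ge0 ?sqrtr_ge0 ?normc_ge0//.
  apply: le_trans (lerD (lexx _) (sumS x n Nx)).
  elim: n => [|n IH]; first by rewrite big_ord0 addr0.
  rewrite big_ord_recr /= addrA; apply: le_trans (lerD IH (lexx _)).
  by apply: le_trans (le_normcD _ _); rewrite [u n x + _]addrC subrK.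
- exists N; split => // x /=; apply: contra_notP => Nx.
  have [h1 h2] := wf x; split.
    by under eq_fun do rewrite -(wE _ _ Nx).
  by under eq_fun do rewrite -(wE _ _ Nx).
Qed.

(** The weighted sum bounds |u_n - f|^2 by S 2^-n at almost every point. *)
Lemma summable_ae_cvg u f (C : R) : (forall n, square_integrable (u n)) -> square_integrable f ->
  (forall n, sqnorm (fun x => u n x - f x) <= C * 4^-1 ^+ n) ->
  \forall x \ae m, ccvg (u^~ x) (f x).
Proof.
move=> su sf uC; pose d n x := normc (u n x - f x) ^+ 2.
have sd n := square_integrableB (su n) sf.
have [|||S [cS S0 h]] := @ae_summable d C.
- by move=> n x; exact: sqr_ge0.
- by move=> n; have [] := sd n.
- exact: uC.
apply: filterS h => x h; apply: normc_ccvg.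
have dS n : d n x <= S x * 2^-1 ^+ n.
  have := h n.+1; rewrite big_ord_recr /= => h'.
  have : 2 ^+ n * d n x <= S x.
    apply: le_trans h'; rewrite lerDr; apply: sumr_ge0 => i _.
    by rewrite mulr_ge0// sqr_ge0.
  by rewrite exprVn ler_pdivlMr ?exprn_gt0// mulrC.
have d0 : d n x @[n --> \oo] --> (0 : R).
  apply: (@squeeze_cvgr _ _ _ _ (cst 0) (fun n => S x * 2^-1 ^+ n)).
  - by apply: nearW => n; rewrite dS sqr_ge0.
  - exact: cvg_cst.
  - rewrite -[X in _ --> X](mulr0 (S x)); apply: cvgM; first exact: cvg_cst.
    by apply: cvg_expr; rewrite ger0_norm; lra.
move/(continuous_cvg _ (@sqrt_continuous R 0)): d0; rewrite sqrtr0.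
suff -> : Num.sqrt \o (fun n => d n x) = (fun n => normc (u n x - f x)) by [].
by apply/funext => n; rewrite /= sqrtr_sqr ger0_norm ?normc_ge0.
Qed.

(** q is the point nearest to h in the closure of V, obtained from a minimizing sequence whose
    excess over the infimum decays like 4^-n. As V need not be closed, q itself may lie outside V,
    and the sequence is part of the conclusion. *)
Lemma dominated_projection (V : set (circle R -> R[i])) h :
  V `<=` square_integrable -> V (fun=> 0) ->
  (forall (a : R) f g, V f -> V g -> V (fun x => a%:C * f x + g x)) ->
  square_integrable h ->
  exists u q, [/\ forall n, V (u n), dominated_cvg2 u q &
    forall f, V f -> Rint (fun x => (h x - q x) * (f x)^*) = 0].
Proof.
move=> Vs V0 VL sh.
pose E : set R := [set sqnorm (fun x => h x - f x) | f in V].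
have sB f : V f -> square_integrable (fun x => h x - f x).
  by move=> /Vs; exact: square_integrableB.
have E0 : lbound E 0 by move=> _ [v Vv <-]; exact: sqnorm_ge0 (sB v Vv).
have hE : has_inf E.
  by split; [exists (sqnorm (fun x => h x - 0)); exists (fun=> 0)|exists 0].
pose d := inf E.
have dle f : V f -> d <= sqnorm (fun x => h x - f x).
  by move=> Vf; apply: ge_inf; [exists 0|exists f].
have ex n : exists f, V f /\ sqnorm (fun x => h x - f x) < d + 4^-1 ^+ n.
  have e0 : 0 < 4^-1 ^+ n :> R by rewrite exprn_gt0.
  by have [_ [v Vv <-] hv] := inf_adherent e0 hE; exists v.
have [u uP] := choice ex; have Vu n : V (u n) by have [] := uP n.
(* By the parallelogram law and the midpoint, which also lies in V, the squared increment is at most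
   2 4^-n + 2 4^-(n+1), hence at most 4 4^-n. *)
have [||q uq] := @rapid_dominated_cvg2 u 4.
- by move=> n; exact: Vs.
- move=> n.
  have := parallelogram (sB _ (Vu n)) (sB _ (Vu n.+1)).
  have -> : (fun x => h x - u n x - (h x - u n.+1 x)) = (fun x => u n.+1 x - u n x).
    by apply/funext => x; ring.
  pose mid x := (2^-1)%:C * u n x + ((2^-1)%:C * u n.+1 x + 0).
  have Vm : V mid by apply: (VL) => //; exact: (VL).
  have -> : (fun x => h x - u n x + (h x - u n.+1 x)) = (fun x => 2%:C * (h x - mid x)).
    apply/funext => x; rewrite /mid.
    have e2 : (2^-1)%:C = 2^-1 :> R[i] by rewrite fmorphV rmorph_nat.
    have -> : 2%:C = 2 :> R[i] by rewrite rmorph_nat.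
    by rewrite e2; field.
  rewrite sqnormZ; last exact: sB.
  have := dle _ Vm; have [_] := uP n; have [_] := uP n.+1; rewrite exprS.
  have : 0 < 4^-1 ^+ n :> R by rewrite exprn_gt0.
  lra.
exists u, q; split => // v Vv.
have [_ sq] := dominated_cvg2_sqint uq.
have shq := square_integrableB sh sq.
have lim1 : sqnorm (fun x => h x - q x) <= d.
  have h1 := dominated_cvg2_sqnorm (dominated_cvg2Bl uq sh).
  have h2 : d + 4^-1 ^+ n @[n --> \oo] --> d.
    rewrite -[X in _ --> X]addr0; apply: cvgD; first exact: cvg_cst.
    by apply: cvg_expr; rewrite ger0_norm; lra.
  rewrite -(cvg_lim _ h1)// -(cvg_lim _ h2)//; apply: ler_lim.
  - by apply/cvgP: h1.
  - by apply/cvgP: h2.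
  - by apply: nearW => n; apply: ltW; have [] := uP n.
(* Each u_n + t v competes for the infimum, and the inequality survives the limit; optimality of q
   then reads as a quadratic inequality in t. *)
have lim2 (t : R) : d <= sqnorm (fun x => h x - t%:C * v x - q x).
  have sht : square_integrable (fun x => h x - t%:C * v x).
    by apply: square_integrableB => //; apply: square_integrableZ; exact: Vs.
  have h1 := dominated_cvg2_sqnorm (dominated_cvg2Bl uq sht).
  rewrite -(cvg_lim _ h1)//; apply: limr_ge; first by apply/cvgP: h1.
  apply: nearW => n; have := dle _ (VL t v (u n) Vv (Vu n)).
  by congr (_ <= sqnorm _); apply/funext => x; rewrite opprD addrA.
have sv := Vs _ Vv; apply: (@quadratic_ge0_eq0 (sqnorm v)); first exact: sqnorm_ge0.
move=> t; have := le_trans lim1 (lim2 t).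
have -> : (fun x => h x - t%:C * v x - q x) = (fun x => h x - q x + (- t)%:C * v x).
  by apply/funext => x; rewrite rmorphN; ring.
have sv' := square_integrableZ (- t)%:C sv.
rewrite [X in _ <= X](sqnormD shq sv').
rewrite sqnormZ//.
have -> : Rint (fun x => (h x - q x) * ((- t)%:C * v x)^*) =
          - t * Rint (fun x => (h x - q x) * (v x)^*).
  rewrite -RintZ; last exact: cintegrable_mulJ.
  by apply: eq_Rint => x; rewrite !ReImE /=; ring.
by rewrite sqrrN; lra.
Qed.

End riesz_fischer.

(** * Symmetric functions and wandering vectors *)

Section symmetric_functions.
Context {R : realType}.
Implicit Types (f g h : circle R -> R[i]) (u : nat -> circle R -> R[i]) (n : int).
Local Open Scope complex_scope.
Local Notation m := (@circle_measure R).

Lemma conjcM (z w : R[i]) : (z * w)^* = z^* * w^*.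
Proof. exact: rmorphM. Qed.

Lemma conjcB (z w : R[i]) : (z - w)^* = z^* - w^*.
Proof. exact: rmorphB. Qed.

Lemma Re_mulJC (z w : R[i]) : Re (z * w^*) = Re (w * z^*).
Proof. by rewrite !ReImE; ring. Qed.

Definition symmetric f := \forall x \ae m, f x = star f x.

(** For a symmetric integrable function this is the whole Fourier coefficient, whose imaginary part
    is zero. *)
Definition coef f n : R := Rint (fun x => f x * (x : R[i]) ^ (- n)).

Lemma symmetricD f g : symmetric f -> symmetric g -> symmetric (fun x => f x + g x).
Proof. by apply: filterS2 => x fx gx; rewrite /star rmorphD fx gx. Qed.

Lemma symmetricM f g : symmetric f -> symmetric g -> symmetric (fun x => f x * g x).
Proof. by apply: filterS2 => x fx gx; rewrite /star rmorphM fx gx. Qed.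

Lemma symmetric_cst (r : R) : symmetric (fun=> r%:C).
Proof. by apply: aeW => x; rewrite /star conjc_real. Qed.

Lemma symmetricB f g : symmetric f -> symmetric g -> symmetric (fun x => f x - g x).
Proof. by apply: filterS2 => x fx gx; rewrite /star rmorphB fx gx. Qed.

Lemma symmetric_real (w : circle R -> R) :
  (\forall x \ae m, w (circle_conj x) = w x) -> symmetric (fun x => (w x)%:C).
Proof. by apply: filterS => x wx; rewrite /star conjc_real wx. Qed.

Lemma symmetric_normc f : symmetric f -> \forall x \ae m, normc (f (circle_conj x)) = normc (f x).
Proof. by apply: filterS => x ->; rewrite /star normc_conj. Qed.

Lemma symmetricJ f : symmetric f -> symmetric (fun x => (f x)^*).
Proof. by apply: filterS => x fx; rewrite /star fx. Qed.

Lemma symmetric_expz n : symmetric (fun x => (x : R[i]) ^ n).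
Proof. by apply: aeW => x; rewrite /star circle_conj_expz conjc_expz opprK. Qed.

Lemma symmetric_cvg u f : (forall k, symmetric (u k)) -> (\forall x \ae m, ccvg (u^~ x) (f x)) ->
  symmetric f.
Proof.
move=> su uf; have su' := ae_foralln su; have uf' := ae_circle_conj uf.
apply: filterS3 su' uf uf' => x sx ux ux'.
apply: (ccvg_unique ux); have := ccvgJ ux'.
by rewrite (_ : (fun k => (u k (circle_conj x))^*) = (u^~ x))//; apply/funext => k; rewrite sx.
Qed.

(** Conjugation preserves the measure and changes the sign of the imaginary part of a symmetric
    function, so that part has integral zero and only Re d survives. *)
Lemma Rint_symmetricZ (d : R[i]) f : symmetric f -> cintegrable f ->
  Rint (fun x => d * f x) = Re d * Rint f.
Proof.
move=> sf cf; have Im0 : Rint (fun x => (Im (f x))%:C) = 0.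
  have cI : cintegrable (fun x => (Im (f x))%:C) by apply: cintegrableC; exact: cintegrable_Im.
  have : Rint (fun x => (Im (f x))%:C) = - Rint (fun x => (Im (f x))%:C).
    rewrite -{2}(Rint_comp_conj cI) -RintN; last exact: (cintegrable_comp_conj cI).
    apply: Rint_ae.
    - by have [] := cI.
    - by have [] := cintegrableN (cintegrable_comp_conj cI).
    - by apply: filterS sf => x ->; rewrite /star ReN /= ImJ.
  by lra.
rewrite (@eq_Rint _ _ (fun x => (Re d)%:C * f x - (Im d)%:C * (Im (f x))%:C)); last first.
  by move=> x; rewrite !ReImE /=; ring.
have cI : cintegrable (fun x => (Im (f x))%:C) by apply: cintegrableC; exact: cintegrable_Im.
by rewrite RintB ?RintZ ?Im0 ?mulr0 ?subr0//; exact: cintegrableZ.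
Qed.

Lemma symmetric_coef_eq0 f : symmetric f -> cintegrable f -> (forall n, coef f n = 0) ->
  \forall x \ae m, f x = 0.
Proof.
move=> sf cf f0; apply: null_coeffs_eq0; split => // c n.
rewrite Rint_symmetricZ; last 2 first.
- by apply: symmetricM => //; exact: symmetric_expz.
- exact: cintegrable_expzM.
by rewrite -[n]opprK -[Rint _]/(coef f (- n)) f0 mulr0.
Qed.

Lemma cintegral_symmetric f : symmetric f -> cintegrable f -> cintegral f = (Rint f)%:C.
Proof.
move=> sf cf; apply/eqP; rewrite eq_complex /= eqxx /=; apply/eqP.
transitivity (Rint (fun x => (- 'i%C) * f x)).
  by apply: eq_Rintegral => x _; rewrite !ReImE /=; ring.
by rewrite Rint_symmetricZ//= oppr0 mul0r.
Qed.

(** All coefficients of |f|^2 minus its mean vanish: those of positive index by the orthogonality,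
    those of negative index by conjugation since the function is real, and the zeroth by the choice
    of the constant. *)
Lemma wandering_const_modulus f : symmetric f -> square_integrable f ->
  (forall k : nat, (0 < k)%N -> Rint (fun x => f x * ((x : R[i]) ^+ k * f x)^*) = 0) ->
  \forall x \ae m, normc (f x) ^+ 2 = sqnorm f.
Proof.
move=> sf sqf f0; have [mf cf] := sqf.
pose F x := (normc (f x) ^+ 2)%:C - (sqnorm f)%:C.
have cF : cintegrable F by apply: cintegrableB => //; exact: cintegrable_cst.
have sF : symmetric F.
  apply: symmetricB; last exact: symmetric_cst.
  by apply: symmetric_real; apply: filterS (symmetric_normc sf) => x ->.
have coefF n :
    coef F n = Rint (fun x => (normc (f x) ^+ 2)%:C * (x : R[i]) ^ (- n)) - sqnorm f * (n == 0)%:R.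
  rewrite /coef; have -> : (n == 0)%:R = Rint (fun x : circle R => (x : R[i]) ^ (- n)).
    by rewrite Rint_expz oppr_eq0.
  rewrite -RintZ; last exact: cintegrable_expz.
  rewrite -RintB; last 2 first.
  - exact: cintegrable_expzM.
  - exact: cintegrableZ (cintegrable_expz _).
  by apply: eq_Rint => x; rewrite mulrBl.
have pos k : coef F (k.+1 : nat) = 0.
  rewrite coefF /= mulr0 subr0 -(f0 k.+1)//; apply: eq_Rint => x.
  have -> : (x : R[i]) ^ (- (k.+1 : int)) = ((x : R[i]) ^+ k.+1)^*.
    by rewrite -conjc_expz.
  by rewrite -mulJE [in RHS]rmorphM; congr Re; ring.
have := @symmetric_coef_eq0 F sF cF.
have cF0 n : coef F n = 0.
  case: n => [[|k]|k].
  - rewrite coefF /= mulr1; apply/eqP; rewrite subr_eq0; apply/eqP.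
    by apply: eq_Rint => x; rewrite expr0z mulr1.
  - exact: pos.
  - rewrite -(pos k); apply: eq_Rint => x.
    by rewrite -[RHS]ReJ; congr Re; rewrite conjcM conjc_expz /F conjcB !conjc_real NegzE.
move=> /(_ cF0); apply: filterS => x; rewrite /F -rmorphB => /complexI /eqP.
by rewrite subr_eq0 => /eqP.
Qed.

(** q is the projection of g on zV. For k > 0 the function z^k (g - q) is the limit of the z^k (g -
    z v_j), which lie in zV and are thus orthogonal to g - q; hence g - q is a wandering vector and
    has constant modulus. *)
Lemma wandering_decomposition (V : set (circle R -> R[i])) g :
  V `<=` square_integrable -> V `<=` symmetric -> V (fun=> 0) ->
  (forall (a : R) f h, V f -> V h -> V (fun x => a%:C * f x + h x)) ->
  (forall f, V f -> V (fun x : circle R => (x : R[i]) * f x)) -> V g ->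
  exists u q, [/\ forall k, V (u k),
    dominated_cvg2 (fun k x => (x : R[i]) * u k x) q,
    symmetric (fun x => g x - q x),
    forall f k, V f -> (0 < k)%N ->
      Rint (fun x => (g x - q x) * ((x : R[i]) ^+ k * f x)^*) = 0 &
    \forall x \ae m, normc (g x - q x) ^+ 2 = sqnorm (fun x => g x - q x)].
Proof.
move=> Vs Vsym V0 VL Vz Vg.
pose zV : set (circle R -> R[i]) :=
  [set h | exists2 f, V f & h = (fun x : circle R => (x : R[i]) * f x)].
have [|||u [q [zVu uq qort]]] := @dominated_projection _ zV g _ _ _ (Vs _ Vg).
- by move=> _ [f Vf ->]; exact: Vs (Vz _ Vf).
- by exists (fun=> 0) => //; apply/funext => x; rewrite mulr0.
- move=> a _ _ [f Vf ->] [h Vh ->]; exists (fun x => a%:C * f x + h x); first exact: VL.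
  by apply/funext => x; ring.
have [k|v vP] := @choice _ _ (fun k f => V f /\ u k = (fun x : circle R => (x : R[i]) * f x)).
  by have [f Vf ->] := zVu k; exists f.
have uE : u = (fun k (x : circle R) => (x : R[i]) * v k x).
  by apply/funext => k; have [_ ->] := vP k.
have Vv k : V (v k) by have [] := vP k.
rewrite uE in uq.
have [_ sq] := dominated_cvg2_sqint uq; have sg := Vs _ Vg.
have sgq := square_integrableB sg sq.
have VX k f : V f -> V (fun x : circle R => (x : R[i]) ^+ k * f x).
  move=> Vf; elim: k => [|k IH].
    by under eq_fun do rewrite expr0 mul1r.
  by under eq_fun do rewrite exprS -mulrA; exact: Vz.
have ort f k : V f -> (0 < k)%N -> Rint (fun x => (g x - q x) * ((x : R[i]) ^+ k * f x)^*) = 0.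
  case: k => // k Vf _; apply: qort; exists (fun x : circle R => (x : R[i]) ^+ k * f x); first exact: VX.
  by apply/funext => x; rewrite exprS mulrA.
have dB := dominated_cvg2Bl uq sg.
have Vw k : V (fun x => g x - (x : R[i]) * v k x).
  have := VL (-1) _ _ (Vz _ (Vv k)) Vg; congr V.
  by apply/funext => x; rewrite rmorphN1 mulN1r addrC.
have symgq : symmetric (fun x => g x - q x).
  by have [_ _ _ h] := dB; apply: (symmetric_cvg _ h) => k; exact: Vsym.
exists v, q; split => //.
apply: wandering_const_modulus => // k k0.
have mX : cmeasurable (fun x : circle R => (x : R[i]) ^+ k) by exact: (@cmeasurable_expz _ k).
have bX : \forall x \ae m, normc (((x : circle R) : R[i]) ^+ k) <= 1.
  by apply: aeW => x; rewrite normcX normc_circle expr1n.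
have h := dominated_cvg2_Rint (dominated_cvg2Mb dB mX bX) (square_integrableJ sgq).
have E f : Rint (fun x => (x : R[i]) ^+ k * f x * (g x - q x)^*) =
           Rint (fun x => (g x - q x) * ((x : R[i]) ^+ k * f x)^*).
  by apply: eq_Rint => x; exact: Re_mulJC.
rewrite -[LHS]E -(cvg_lim _ h)//.
rewrite (_ : (fun j => _) = (fun=> 0)) ?lim_cst//.
by apply/funext => j; rewrite (E (fun x : circle R => g x - (x : R[i]) * v j x));
    exact: (ort _ _ (Vw j) k0).
Qed.

End symmetric_functions.

(** * Trigonometric polynomials and Fejer means *)

Section trigonometric_polynomials.
Context {R : realType}.
Implicit Types (f g h : circle R -> R[i]) (u : nat -> circle R -> R[i]) (S : set int).
Local Open Scope complex_scope.
Local Notation m := (@circle_measure R).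

(** Real coefficients and frequencies in [S]: multiplication by such functions preserves a real
    vector space stable under the powers z^n with n in [S], by induction on this predicate. *)
Inductive trigpoly S : set (circle R -> R[i]) :=
| trigpoly0 : trigpoly S (fun=> 0)
| trigpolyS (a : R) n f : S n -> trigpoly S f ->
    trigpoly S (fun x => a%:C * (x : R[i]) ^ n + f x).

Definition nonneg_freq : set int := [set n | 0 <= n].

Lemma trigpolyL S (a : R) f g : trigpoly S f -> trigpoly S g ->
  trigpoly S (fun x => a%:C * f x + g x).
Proof.
move=> Sf Sg; elim: Sf => [|b n {}f Sn _ IH].
  by rewrite (_ : (fun x => _) = g)//; apply/funext => x; rewrite mulr0 add0r.
have := trigpolyS (a * b) Sn IH; congr trigpoly; apply/funext => x.
by rewrite rmorphM; ring.
Qed.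

Lemma trigpoly_expz S n : S n -> trigpoly S (fun x => (x : R[i]) ^ n).
Proof.
move=> Sn; have := trigpolyS 1 Sn (trigpoly0 S); congr trigpoly; apply/funext => x.
by rewrite mul1r addr0.
Qed.

Lemma trigpolyM S S' k f : (forall n, S n -> S' (k + n)) -> trigpoly S f ->
  trigpoly S' (fun x => (x : R[i]) ^ k * f x).
Proof.
move=> SS'; elim=> [|a n {}f Sn _ IH].
  by rewrite (_ : (fun x => _) = (fun=> 0)); [exact: trigpoly0|apply/funext => x; rewrite mulr0].
have := trigpolyS a (SS' _ Sn) IH; congr trigpoly; apply/funext => x.
by rewrite expzD; ring.
Qed.

Lemma trigpoly_sum S n (F : nat -> circle R -> R[i]) : (forall k, trigpoly S (F k)) ->
  trigpoly S (fun x => \sum_(k < n) F k x).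
Proof.
move=> SF; elim: n => [|n IH].
  by under eq_fun do rewrite big_ord0; exact: trigpoly0.
under eq_fun do rewrite big_ord_recr /=.
have := trigpolyL 1 (SF n) IH; congr trigpoly; apply/funext => x.
by rewrite mul1r addrC.
Qed.

Lemma trigpoly_bounded S f : trigpoly S f ->
  cmeasurable f /\ exists c, forall x, normc (f x) <= c.
Proof.
elim=> [|a n {}f _ _ [mf [c fc]]].
  by split; [exact: cmeasurable_cst|exists 0 => x; rewrite Normc.normc0].
split.
  apply: cmeasurableD => //; apply: cmeasurableM; first exact: cmeasurable_cst.
  exact: cmeasurable_expz.
exists (`|a| + c) => x; rewrite (le_trans (le_normcD _ _))// lerD//.
by rewrite Normc.normcM normc_expz normc_real mulr1.
Qed.

Lemma trigpoly_square_integrable S : trigpoly S `<=` square_integrable.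
Proof.
by move=> f /trigpoly_bounded[mf [c fc]]; apply: (@square_integrable_bounded _ _ c) => //; exact: aeW.
Qed.

Lemma trigpoly_symmetric S : trigpoly S `<=` symmetric.
Proof.
move=> f; elim=> [|a n {}f _ _ IH]; first exact: (@symmetric_cst _ 0).
apply: symmetricD => //; apply: symmetricM; first exact: symmetric_cst.
exact: symmetric_expz.
Qed.

Lemma coef_cst0 n : coef (fun _ : circle R => 0) n = 0.
Proof.
rewrite /coef (@eq_Rint _ _ (fun=> 0%:C)) ?Rint_cst// => x.
by rewrite mul0r.
Qed.

Lemma coefD f g n : cintegrable f -> cintegrable g ->
  coef (fun x => f x + g x) n = coef f n + coef g n.
Proof.
move=> cf cg; rewrite /coef -RintD; [|exact: cintegrable_expzM|exact: cintegrable_expzM].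
by apply: eq_Rint => x; rewrite mulrDl.
Qed.

Lemma coefB f g n : cintegrable f -> cintegrable g ->
  coef (fun x => f x - g x) n = coef f n - coef g n.
Proof.
move=> cf cg; rewrite /coef -RintB; [|exact: cintegrable_expzM|exact: cintegrable_expzM].
by apply: eq_Rint => x; rewrite mulrBl.
Qed.

Lemma coefZ (a : R) f n : cintegrable f -> coef (fun x => a%:C * f x) n = a * coef f n.
Proof.
move=> cf; rewrite /coef -RintZ; last exact: cintegrable_expzM.
by apply: eq_Rint => x; rewrite mulrA.
Qed.

Lemma coef_expz k n : coef (fun x : circle R => (x : R[i]) ^ k) n = (k == n)%:R.
Proof.
rewrite /coef (@eq_Rint _ _ (fun x => (x : R[i]) ^ (k - n))) ?Rint_expz ?subr_eq0//.
by move=> x; rewrite expzD.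
Qed.

Lemma coef_trigpoly S f n : trigpoly S f -> ~ S n -> coef f n = 0.
Proof.
elim=> [|a k {}f Sk Sf IH] Sn; first exact: coef_cst0.
have cf := square_integrable_cintegrable (trigpoly_square_integrable Sf).
have ck := cintegrable_expz (R := R) k.
rewrite coefD//; last exact: cintegrableZ.
rewrite coefZ// coef_expz IH// addr0; case: eqP => [kn|_]; last by rewrite mulr0.
by case: Sn; rewrite -kn.
Qed.

Lemma coef_dominated u f n : dominated_cvg2 u f -> coef (u k) n @[k --> \oo] --> coef f n.
Proof.
move=> uf; apply: dominated_cvg2_Rint => //.
apply: (@square_integrable_bounded _ _ 1); first exact: cmeasurable_expz.
by apply: aeW => x; rewrite normc_expz.
Qed.

Lemma coef_dominated_eq0 S u f n : (forall k, trigpoly S (u k)) -> dominated_cvg2 u f ->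
  ~ S n -> coef f n = 0.
Proof.
move=> Su uf Sn; rewrite -(cvg_lim _ (coef_dominated (n := n) uf))//.
rewrite (_ : (fun k => _) = (fun=> 0)) ?lim_cst//.
by apply/funext => k; apply: coef_trigpoly (Su k) Sn.
Qed.

(** Let q be the projection of f on the polynomials with frequencies in S. The coefficients of f - q
    vanish in S by orthogonality and outside S because those of f and of q do, so f = q almost
    everywhere. *)
Lemma trigpoly_dense S f : square_integrable f -> symmetric f ->
  (forall n, ~ S n -> coef f n = 0) ->
  exists u, (forall k, trigpoly S (u k)) /\ dominated_cvg2 u f.
Proof.
move=> sf symf f0.
have [|||u [q [Su uq qort]]] := @dominated_projection _ (trigpoly S) f _ _ _ sf.
- exact: trigpoly_square_integrable.
- exact: trigpoly0.
- by move=> a g h; exact: trigpolyL.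
exists u; split => //.
have [_ sq] := dominated_cvg2_sqint uq; have [mu mq [W uW] uq'] := uq.
have symq : symmetric q by apply: (symmetric_cvg _ uq') => k; exact: trigpoly_symmetric (Su k).
have cf := square_integrable_cintegrable sf; have cq := square_integrable_cintegrable sq.
have fq : \forall x \ae m, f x - q x = 0.
  apply: symmetric_coef_eq0; [exact: symmetricB|exact: cintegrableB|move=> n].
  have [Sn|Sn] := pselect (S n).
    rewrite -(qort _ (trigpoly_expz Sn)); apply: eq_Rint => x.
    by rewrite conjc_expz.
  by rewrite coefB// f0// (coef_dominated_eq0 Su uq Sn) subrr.
split => //; [by have [] := sf|by exists W|].
by apply: filterS2 fq uq' => x /eqP; rewrite subr_eq0 => /eqP ->.
Qed.

(** The extremal problem of Szego for the weight s^2: phi is the component of s orthogonal to the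
    products s z p, with p a polynomial. It has constant modulus, so G = phi / s has modulus sqrt c
    / s, and G is the limit of the polynomials 1 - z p_k, which equal 1 at the origin. *)
Lemma szego_factorization (s : circle R -> R) : (forall x, 1 <= s x) ->
  square_integrable (fun x => (s x)%:C) -> symmetric (fun x => (s x)%:C) ->
  exists u G (c : R), [/\ forall k, trigpoly nonneg_freq (u k), dominated_cvg2 u G,
    \forall x \ae m, (normc (G x) * s x) ^+ 2 = c,
    c <= sqnorm (fun x => (s x)%:C) & sqnorm (fun x => G x - 1) <= c - 1].
Proof.
move=> s1 ss syms; have [ms _] := ss.
have s0 x : 0 < s x by apply: lt_le_trans (s1 x).
pose V : set (circle R -> R[i]) :=
  [set f | exists2 p, trigpoly nonneg_freq p & f = (fun x => (s x)%:C * p x)].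
have Vsq : V `<=` square_integrable.
  move=> _ [p Sp ->]; have [mp [c pc]] := trigpoly_bounded Sp.
  by under eq_fun do rewrite mulrC; apply: (@square_integrableMb _ _ _ c) => //; exact: aeW.
have Vsym : V `<=` symmetric.
  by move=> _ [p Sp ->]; apply: symmetricM => //; exact: trigpoly_symmetric Sp.
have T1 : trigpoly nonneg_freq (fun=> 1 : R[i]).
  by have := @trigpoly_expz nonneg_freq 0 (lexx _); under eq_fun do rewrite expr0z.
have [||||v [q [Vv vq symq ort cst]]] := @wandering_decomposition _ V (fun x => (s x)%:C) Vsq Vsym.
- by exists (fun=> 0); [exact: trigpoly0|apply/funext => x; rewrite mulr0].
- move=> a _ _ [f Sf ->] [g Sg ->]; exists (fun x => a%:C * f x + g x); first exact: trigpolyL.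
  by apply/funext => x; ring.
- move=> _ [f Sf ->]; exists (fun x : circle R => (x : R[i]) ^ 1 * f x).
    apply: trigpolyM Sf => n; rewrite /nonneg_freq /= => n0.
    by rewrite addr_ge0.
  by apply/funext => x; rewrite expr1z; ring.
- by exists (fun=> 1) => //; apply/funext => x; rewrite mulr1.
have [k|p pP] := @choice _ _ (fun k p => trigpoly nonneg_freq p /\ v k = (fun x => (s x)%:C * p x)).
  by have [p Sp ->] := Vv k; exists p.
have Tp k : trigpoly nonneg_freq (p k) by have [] := pP k.
have vE k x : v k x = (s x)%:C * p k x by have [_ ->] := pP k.
have [_ sq] := dominated_cvg2_sqint vq.
pose phi x := (s x)%:C - q x.
have sphi : square_integrable phi by exact: square_integrableB.
have vphi := dominated_cvg2Bl vq ss.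
pose G x := ((s x)^-1)%:C * phi x.
pose u k (x : circle R) := 1 - (x : R[i]) * p k x.
have msV : cmeasurable (fun x => ((s x)^-1)%:C).
  apply: cmeasurableC; have -> : (fun x => (s x)^-1) = expR \o (fun x => - ln (s x)).
    by apply/funext => x; rewrite /= expRN lnK// posrE.
  apply: (measurableT_comp (@measurable_expR R)); apply: measurable_funN.
  by apply: (measurableT_comp (@measurable_ln R)); case: ms.
have sV x : (s x)%:C != 0 :> R[i] by rewrite -(rmorph0 (real_complex R)) (inj_eq (@complexI R)) gt_eqF.
have uG : dominated_cvg2 u G.
  have -> : u = (fun k x => ((s x)^-1)%:C * ((s x)%:C - (x : R[i]) * v k x)).
    by apply/funext => k; apply/funext => x; rewrite vE fmorphV /u; field; exact: sV.
  apply: (dominated_cvg2Mb (c := 1) vphi msV); apply: aeW => x.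
  rewrite normc_real ger0_norm; last by rewrite invr_ge0 ltW.
  by rewrite invf_le1.
have xE k : (fun x : circle R => (x : R[i]) * p k x) = (fun x : circle R => (x : R[i]) ^ 1 * p k x).
  by apply/funext => x; rewrite expr1z.
have Tx k : trigpoly [set n : int | 1 <= n] (fun x => (x : R[i]) * p k x).
  by rewrite xE; apply: trigpolyM (Tp k) => n; rewrite /nonneg_freq /= lerDl.
have Tu k : trigpoly nonneg_freq (u k).
  have Tx' : trigpoly nonneg_freq (fun x => (x : R[i]) * p k x).
    rewrite xE; apply: trigpolyM (Tp k) => n; rewrite /nonneg_freq /= => n0.
    by rewrite addr_ge0.
  have := trigpolyL (-1) Tx' T1; congr trigpoly; apply/funext => x.
  by rewrite rmorphN1 mulN1r addrC.
have [_ sG] := dominated_cvg2_sqint uG.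
have GE x : normc (G x) * s x = normc (phi x).
  rewrite Normc.normcM normc_real ger0_norm ?invr_ge0 ?ltW// mulrAC mulVf ?mul1r//.
  by rewrite gt_eqF.
exists u, G, (sqnorm phi); split => //.
- by apply: filterS cst => x h; rewrite GE.
(* Pythagoras: phi is orthogonal to q, the limit of the z v_k. *)
- have -> : (fun x => (s x)%:C) = (fun x => phi x + q x).
    by apply/funext => x; rewrite /phi subrK.
  rewrite sqnormD//; have -> : Rint (fun x => phi x * (q x)^*) = 0.
    have h := dominated_cvg2_Rint vq (square_integrableJ sphi).
    rewrite (@eq_Rint _ _ (fun x => q x * (phi x)^*)); last by move=> x; exact: Re_mulJC.
    rewrite -(cvg_lim _ h)// (_ : (fun k => _) = (fun=> 0)) ?lim_cst//.
    apply/funext => k; rewrite -(ort _ 1%N (Vv k))//; apply: eq_Rint => x.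
    by rewrite expr1; exact: Re_mulJC.
  by rewrite mulr0 addr0 lerDl sqnorm_ge0.
(* The squared norm of G - 1 is that of G, minus twice the zeroth coefficient, plus 1. That
   coefficient is 1 because z p_k has no constant term, and |G| <= |phi| because s >= 1. *)
- rewrite (sqnormD sG (square_integrable_cst (- 1))).
  have -> : Rint (fun x => G x * (- 1)^*) = - coef G 0.
    rewrite -RintN; last exact: cintegrable_expzM (square_integrable_cintegrable sG).
    by apply: eq_Rint => x; rewrite oppr0 expr0z !ReImE /=; ring.
  have -> : coef G 0 = 1.
    rewrite -(cvg_lim _ (coef_dominated (n := 0) uG))//.
    rewrite (_ : (fun k => _) = (fun=> 1)) ?lim_cst//.
    apply/funext => k; rewrite coefB; last 2 first.
    - exact: cintegrable_cst.
    - exact: square_integrable_cintegrable (trigpoly_square_integrable (Tx k)).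
    rewrite (coef_trigpoly (n := 0) (Tx k))// subr0.
    transitivity (coef (fun x : circle R => (x : R[i]) ^ 0) 0).
      by apply: eq_Rint => x; rewrite expr0z.
    by rewrite coef_expz eqxx.
  have -> : sqnorm (fun=> - 1 : R[i]) = 1.
    rewrite /sqnorm (@eq_Rint _ _ (fun=> 1%:C)) ?Rint_cst// => x.
    by rewrite normcN Normc.normc1 expr1n.
  suff : sqnorm G <= sqnorm phi by lra.
  rewrite -[leRHS]Rint_cst; apply: le_Rint.
  + by have [] := sG.
  + exact: cintegrable_cst.
  + apply: filterS cst => x /= <-; rewrite -GE exprMn ler_peMr ?sqr_ge0//.
    by rewrite exprn_ege1.
Qed.

End trigonometric_polynomials.

(** * Fejer means and bounded polynomial approximation *)

Section fejer_means.
Context {R : realType}.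
Implicit Types (f g h : circle R -> R[i]) (u : nat -> circle R -> R[i]).
Local Open Scope complex_scope.
Local Notation m := (@circle_measure R).

(** The difference n = j - k occurs N - |n| times, so the double sum produces the Fejer weights 1 -
    |n|/N without naming them. *)
Definition fejer N g (x : circle R) : R[i] :=
  \sum_(j < N) \sum_(k < N)
    (N%:R^-1 * coef g (j%:Z - k%:Z))%:C * (x : R[i]) ^ (j%:Z - k%:Z).

(** The Fejer kernel at x / y, as a squared geometric sum so that its positivity is visible. *)
Definition fejer_kernel N (x y : circle R) : R :=
  N%:R^-1 * normc (\sum_(j < N) ((x : R[i]) * (y : R[i])^*) ^+ j) ^+ 2.

Lemma fejer_kernel_ge0 N x y : 0 <= fejer_kernel N x y.
Proof. by rewrite mulr_ge0 ?invr_ge0 ?ler0n ?sqr_ge0. Qed.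

Lemma conjc_sum n (F : nat -> R[i]) : (\sum_(k < n) F k)^* = \sum_(k < n) (F k)^*.
Proof. exact: rmorph_sum. Qed.

Lemma fejer_kernelE N (x y : circle R) : (fejer_kernel N x y)%:C =
  \sum_(j < N) \sum_(k < N) (N%:R^-1)%:C *
    ((x : R[i]) ^ (j%:Z - k%:Z) * (y : R[i]) ^ (- (j%:Z - k%:Z))).
Proof.
have realcM (a b : R) : (a * b)%:C = a%:C * b%:C by exact: rmorphM.
rewrite /fejer_kernel realcM -mulJE (conjc_sum N (fun j => ((x : R[i]) * (y : R[i])^*) ^+ j)).
rewrite big_distrlr /= mulr_sumr; apply: eq_bigr => j _.
rewrite mulr_sumr; apply: eq_bigr => k _; congr (_ * _).
rewrite rmorphXn /= conjcM !exprMn !expzD opprB !expzD -!exprnP.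
have E (z : circle R) (i : nat) : (z : R[i]) ^ (- i%:Z) = ((z : R[i])^*) ^+ i.
  by rewrite -exprz_inv circle_invE.
have -> : ((y : R[i])^*)^* = y by exact: conjcK.
by rewrite !E; ring.
Qed.

Lemma Rint_sum n (F : nat -> circle R -> R[i]) : (forall k, cintegrable (F k)) ->
  Rint (fun x => \sum_(k < n) F k x) = \sum_(k < n) Rint (F k).
Proof.
move=> cF; elim: n => [|n IH].
  rewrite big_ord0 (@eq_Rint _ _ (fun=> 0%:C)) ?Rint_cst// => x.
  by rewrite big_ord0.
rewrite big_ord_recr /= -IH -RintD//; last exact: cintegrable_sum.
by apply: eq_Rint => x; rewrite big_ord_recr.
Qed.

Lemma Re_sum n (F : nat -> R[i]) : Re (\sum_(k < n) F k) = \sum_(k < n) Re (F k).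
Proof. by elim: n => [|n IH]; rewrite ?big_ord0// !big_ord_recr /= ReD IH. Qed.

(** The Fejer mean is the integral of h against the kernel; the factor d captures both parts of this
    complex identity. Symmetry of h is what makes the real numbers [coef] suffice. *)
Lemma Rint_fejer_kernel N (d : R[i]) h (x : circle R) : symmetric h -> cintegrable h ->
  Rint (fun y => d * (h y * (fejer_kernel N x y)%:C)) = Re (d * fejer N h x).
Proof.
move=> symh ch.
pose c (j k : nat) := d * ((N%:R^-1)%:C * (x : R[i]) ^ (j%:Z - k%:Z)).
pose F (j k : nat) y := c j k * (h y * (y : R[i]) ^ (- (j%:Z - k%:Z))).
have cF j k : cintegrable (F j k) by apply: cintegrableZ; exact: cintegrable_expzM.
transitivity (Rint (fun y => \sum_(j < N) \sum_(k < N) F j k y)).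
  apply: eq_Rint => y; rewrite fejer_kernelE !mulr_sumr; congr Re.
  apply: eq_bigr => j _; rewrite !mulr_sumr; apply: eq_bigr => k _.
  by rewrite /F /c; ring.
rewrite (Rint_sum N (F := fun j y => \sum_(k < N) F j k y)); last first.
  by move=> j; exact: cintegrable_sum.
rewrite /fejer mulr_sumr.
rewrite (Re_sum N (fun j => d * \sum_(k < N)
  (N%:R^-1 * coef h (j%:Z - k%:Z))%:C * (x : R[i]) ^ (j%:Z - k%:Z))).
apply: eq_bigr => j _; rewrite (Rint_sum N (F := F j))// mulr_sumr.
rewrite (Re_sum N (fun k => d * ((N%:R^-1 * coef h (j%:Z - k%:Z))%:C * (x : R[i]) ^ (j%:Z - k%:Z)))).
apply: eq_bigr => k _; rewrite /F Rint_symmetricZ; last 2 first.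
- by apply: symmetricM => //; exact: symmetric_expz.
- exact: cintegrable_expzM.
rewrite -/(coef h _) /c.
have -> : d * ((N%:R^-1 * coef h (j%:Z - k%:Z))%:C * (x : R[i]) ^ (j%:Z - k%:Z)) =
  (coef h (j%:Z - k%:Z))%:C * (d * ((N%:R^-1)%:C * (x : R[i]) ^ (j%:Z - k%:Z))).
  by rewrite rmorphM; ring.
by rewrite [in RHS]ReM /= mul0r subr0 mulrC.
Qed.

Lemma sum_kronecker N (a : R) : (0 < N)%N ->
  \sum_(j < N) \sum_(k < N) N%:R^-1 * a * ((j%:Z - k%:Z == 0)%:R) = a.
Proof.
move=> N0; have N0' : N%:R != 0 :> R by rewrite pnatr_eq0 -lt0n.
rewrite (eq_bigr (fun=> N%:R^-1 * a)).
  by rewrite sumr_const card_ord -[LHS]mulr_natl mulrA mulfV// mul1r.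
move=> j _; rewrite (bigD1 j)//= subrr eqxx mulr1 big1 ?addr0// => k kj.
rewrite subr_eq0 eqz_nat; case: eqP => [jk|_]; last by rewrite mulr0.
by move: kj; rewrite -(inj_eq val_inj) /= jk eqxx.
Qed.

Lemma fejer_cst1 N (x : circle R) : (0 < N)%N -> fejer N (fun=> 1) x = 1.
Proof.
move=> N0; rewrite /fejer -[RHS](rmorph1 (real_complex R)) -{2}(sum_kronecker (1 : R) N0).
rewrite rmorph_sum; apply: eq_bigr => j _; rewrite rmorph_sum; apply: eq_bigr => k _.
have -> : coef (fun _ : circle R => 1) (j%:Z - k%:Z) = (j%:Z - k%:Z == 0)%:R.
  rewrite eq_sym -coef_expz; apply: eq_Rint => y.
  by rewrite expr0z.
by case: eqP => [->|_]; rewrite ?mulr1 ?mulr0 ?mul0r ?expr0z ?mulr1.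
Qed.

Lemma cmeasurable_fejer N g : cmeasurable (fejer N g) /\ exists c, forall x, normc (fejer N g x) <= c.
Proof.
apply: (@trigpoly_bounded _ setT).
apply: (@trigpoly_sum _ setT N (fun j x => \sum_(k < N)
    (N%:R^-1 * coef g (j%:Z - k%:Z))%:C * (x : R[i]) ^ (j%:Z - k%:Z))) => j.
apply: (@trigpoly_sum _ setT N (fun k x =>
    (N%:R^-1 * coef g (j%:Z - k%:Z))%:C * (x : R[i]) ^ (j%:Z - k%:Z))) => k.
have := @trigpolyS _ setT (N%:R^-1 * coef g (j%:Z - k%:Z)) (j%:Z - k%:Z) _ I (trigpoly0 _).
by congr trigpoly; apply/funext => x; rewrite addr0.
Qed.

Lemma fejer_trigpoly N g : (forall n, ~ nonneg_freq n -> coef g n = 0) ->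
  trigpoly nonneg_freq (fejer N g).
Proof.
move=> g0.
apply: (@trigpoly_sum _ _ N (fun j x => \sum_(k < N)
    (N%:R^-1 * coef g (j%:Z - k%:Z))%:C * (x : R[i]) ^ (j%:Z - k%:Z))) => j.
apply: (@trigpoly_sum _ _ N (fun k x =>
    (N%:R^-1 * coef g (j%:Z - k%:Z))%:C * (x : R[i]) ^ (j%:Z - k%:Z))) => k.
have [Sn|Sn] := pselect (nonneg_freq (j%:Z - k%:Z)).
  have := @trigpolyS _ _ (N%:R^-1 * coef g (j%:Z - k%:Z)) _ _ Sn (trigpoly0 _).
  by congr trigpoly; apply/funext => x; rewrite addr0.
rewrite (_ : (fun x => _) = (fun=> 0)); first exact: trigpoly0.
by apply/funext => x; rewrite g0// mulr0 mul0r.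
Qed.

Lemma Rint_fejer N h : (0 < N)%N -> Rint (fejer N h) = coef h 0.
Proof.
move=> N0; rewrite -[RHS](sum_kronecker _ N0).
pose F (j k : nat) (x : circle R) := (N%:R^-1 * coef h (j%:Z - k%:Z))%:C * (x : R[i]) ^ (j%:Z - k%:Z).
have cF j k : cintegrable (F j k) by apply: cintegrableZ; exact: cintegrable_expz.
rewrite (Rint_sum N (F := fun j y => \sum_(k < N) F j k y)); last first.
  by move=> j; exact: cintegrable_sum.
apply: eq_bigr => j _; rewrite (Rint_sum N (F := F j))//; apply: eq_bigr => k _.
rewrite RintZ; last exact: cintegrable_expz.
by rewrite Rint_expz; case: eqP => [->|_]; rewrite ?mulr0.
Qed.

(** The kernel is a probability density in y, so this is Jensen's inequality for the square: expand
    the nonnegative integral of |g - c|^2 against the kernel, with c the mean of g. The second bound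
    averages |g|^2 <= C^2. *)
Lemma sqr_normc_fejer_le N g x (C : R) : (0 < N)%N -> symmetric g -> cmeasurable g ->
  (\forall x \ae m, normc (g x) <= C) ->
  normc (fejer N g x) ^+ 2 <= Re (fejer N (fun x => (normc (g x) ^+ 2)%:C) x) /\
  Re (fejer N (fun x => (normc (g x) ^+ 2)%:C) x) <= C ^+ 2.
Proof.
move=> N0 symg mg gC; pose g2 y := (normc (g y) ^+ 2)%:C : R[i].
have sg := square_integrable_bounded mg gC; have [_ cg2] := sg.
have cg := square_integrable_cintegrable sg.
have symg2 : symmetric g2.
  by apply: symmetric_real; apply: filterS (symmetric_normc symg) => y ->.
have c1 : cintegrable (fun _ : circle R => 1 : R[i]) by exact: cintegrable_cst.
have sym1 : symmetric (fun _ : circle R => 1 : R[i]) by exact: (@symmetric_cst _ 1).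
have mK : cmeasurable (fun y => (fejer_kernel N x y)%:C).
  under eq_fun do rewrite fejer_kernelE.
  have : cintegrable (fun y : circle R => \sum_(j < N) \sum_(k < N) (N%:R^-1)%:C *
    ((x : R[i]) ^ (j%:Z - k%:Z) * (y : R[i]) ^ (- (j%:Z - k%:Z)))).
    apply: (@cintegrable_sum _ N (fun j y => \sum_(k < N) (N%:R^-1)%:C *
      ((x : R[i]) ^ (j%:Z - k%:Z) * (y : R[i]) ^ (- (j%:Z - k%:Z))))) => j.
    apply: (@cintegrable_sum _ N (fun k y => (N%:R^-1)%:C *
      ((x : R[i]) ^ (j%:Z - k%:Z) * (y : R[i]) ^ (- (j%:Z - k%:Z))))) => k.
    by apply: cintegrableZ; apply: cintegrableZ; exact: cintegrable_expz.
  by case.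
have Kb y : normc (fejer_kernel N x y)%:C <= N%:R.
  rewrite normc_real ger0_norm ?fejer_kernel_ge0//.
  have h : normc (\sum_(j < N) ((x : R[i]) * (y : R[i])^*) ^+ j) <= N%:R.
    have : forall n, normc (\sum_(j < n) ((x : R[i]) * (y : R[i])^*) ^+ j) <= n%:R.
      elim=> [|n IH]; first by rewrite big_ord0 Normc.normc0.
      rewrite big_ord_recr /= (le_trans (le_normcD _ _))// -natr1 lerD//.
      by rewrite normcX Normc.normcM normc_conj !normc_circle mulr1 expr1n.
    exact.
  rewrite /fejer_kernel ler_pdivrMl ?ltr0n// -expr2 ler_pXn2r// nnegrE ?normc_ge0 ?ler0n//.
have cK f : cintegrable f -> cintegrable (fun y => f y * (fejer_kernel N x y)%:C).
  move=> cf; under eq_fun do rewrite mulrC.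
  by apply: (@cintegrableMb _ _ _ N%:R) => //; exact: aeW.
split.
- set c := fejer N g x.
  have : 0 <= Rint (fun y => (normc (g y - c) ^+ 2)%:C * (fejer_kernel N x y)%:C).
    apply: Rint_ge0.
      apply: cmeasurableM => //; apply: cmeasurable_sqr_normc.
      by apply: cmeasurableB => //; exact: cmeasurable_cst.
    by apply: aeW => y; rewrite -rmorphM /= mulr_ge0 ?sqr_ge0 ?fejer_kernel_ge0.
  have -> : Rint (fun y => (normc (g y - c) ^+ 2)%:C * (fejer_kernel N x y)%:C) =
      Rint (fun y => 1 * (g2 y * (fejer_kernel N x y)%:C)) -
      Rint (fun y => (2%:C * c^*) * (g y * (fejer_kernel N x y)%:C)) +
      Rint (fun y => (normc c ^+ 2)%:C * (1 * (fejer_kernel N x y)%:C)).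
    rewrite -RintB; [|exact: cintegrableZ (cK _ cg2)|exact: cintegrableZ (cK _ cg)].
    rewrite -RintD; last 2 first.
    - by apply: cintegrableB; [exact: cintegrableZ (cK _ cg2)|exact: cintegrableZ (cK _ cg)].
    - exact: cintegrableZ (cK _ c1).
    by apply: eq_Rint => y; rewrite /g2 !sqr_normcE !ReImE /=; ring.
  rewrite !Rint_fejer_kernel// fejer_cst1// mul1r -/c -mulrA.
  have -> : Re (2%:C * (c^* * c)) = 2 * normc c ^+ 2.
    by rewrite !ReImE /= sqr_normcE; ring.
  rewrite mulr1 -/g2 => h; have : 0 <= Re (fejer N g2 x) - 2 * normc c ^+ 2 + normc c ^+ 2 by exact: h.
  by lra.
- rewrite -[X in Re X]mul1r -Rint_fejer_kernel//.
  have -> : C ^+ 2 = Rint (fun y => (C ^+ 2)%:C * (1 * (fejer_kernel N x y)%:C)).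
    by rewrite Rint_fejer_kernel// fejer_cst1// mulr1.
  apply: le_Rint; [exact: cintegrableZ (cK _ cg2)|exact: cintegrableZ (cK _ c1)|].
  apply: filterS gC => y gC; rewrite !mul1r -!rmorphM /= ler_wpM2r ?fejer_kernel_ge0//.
  by rewrite ler_pXn2r// nnegrE ?normc_ge0// (le_trans _ gC) ?normc_ge0.
Qed.

(** Integrate the pointwise inequality: averaging does not change the zeroth coefficient, which for
    |g|^2 is the squared norm of g. *)
Lemma sqnorm_fejer_le N g (C : R) : (0 < N)%N -> symmetric g -> cmeasurable g ->
  (\forall x \ae m, normc (g x) <= C) -> sqnorm (fejer N g) <= sqnorm g.
Proof.
move=> N0 symg mg gC; have [mF [c Fc]] := cmeasurable_fejer N g.
pose g2 y := (normc (g y) ^+ 2)%:C : R[i].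
have [mF2 [c2 Fc2]] := cmeasurable_fejer N g2.
have -> : sqnorm g = Rint (fejer N g2).
  rewrite Rint_fejer//; apply: eq_Rint => x.
  by rewrite oppr0 expr0z mulr1.
apply: le_Rint.
- by have [] := @square_integrable_bounded _ _ c mF (aeW _ Fc).
- exact: cintegrable_bounded mF2 (aeW _ Fc2).
- by apply: aeW => x /=; have [] := sqr_normc_fejer_le x N0 symg mg gC.
Qed.

Lemma fejerD N f g x : cintegrable f -> cintegrable g ->
  fejer N (fun x => f x + g x) x = fejer N f x + fejer N g x.
Proof.
move=> cf cg; rewrite -big_split; apply: eq_bigr => j _; rewrite -big_split.
by apply: eq_bigr => k _; rewrite coefD// mulrDr rmorphD mulrDl.
Qed.

Lemma fejerZ N (a : R) f x : cintegrable f ->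
  fejer N (fun x => a%:C * f x) x = a%:C * fejer N f x.
Proof.
move=> cf; rewrite mulr_sumr; apply: eq_bigr => j _; rewrite mulr_sumr.
by apply: eq_bigr => k _; rewrite coefZ// mulrCA rmorphM mulrA.
Qed.

Lemma fejerB N f g x : cintegrable f -> cintegrable g ->
  fejer N (fun x => f x - g x) x = fejer N f x - fejer N g x.
Proof.
move=> cf cg; rewrite -sumrB; apply: eq_bigr => j _; rewrite -sumrB.
by apply: eq_bigr => k _; rewrite coefB// mulrBr rmorphB mulrBl.
Qed.

(** The mean multiplies z^i by cnt / N, where cnt counts the pairs with j - k = i and lies between N
    - i and N. *)
Lemma fejer_expz N (i : nat) (x : circle R) : (0 < N)%N ->
  normc (fejer N (fun x => (x : R[i]) ^ i) x - (x : R[i]) ^ i) <= i%:R / N%:R.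
Proof.
move=> N0; have N0' : 0 < N%:R :> R by rewrite ltr0n.
pose cnt : R := \sum_(j < N) \sum_(k < N) (i%:Z == j%:Z - k%:Z)%:R.
have -> : fejer N (fun x => (x : R[i]) ^ i) x = (N%:R^-1 * cnt)%:C * (x : R[i]) ^ i.
  rewrite /cnt rmorphM rmorph_sum /= -mulrA mulr_suml mulr_sumr; apply: eq_bigr => j _.
  rewrite rmorph_sum mulr_suml mulr_sumr; apply: eq_bigr => k _.
  rewrite coef_expz rmorphM -mulrA; congr (_ * _).
  by case: eqP => [->|_]; rewrite ?mul0r.
(* The subtraction of naturals is truncated, so the count is 0 once i >= N, as it should be. *)
have cntE : cnt = \sum_(k < N) (k < N - i)%N%:R.
  rewrite /cnt exchange_big /=; apply: eq_bigr => k _.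
  have eqE (j : 'I_N) : (i%:Z == j%:Z - k%:Z) = (j == k + i :> nat)%N.
    by rewrite eq_sym subr_eq -PoszD eqz_nat addnC.
  under eq_bigr do rewrite eqE.
  rewrite ltn_subRL (addnC i); case: (ltnP (k + i) N) => kiN.
    rewrite (bigD1 (Ordinal kiN))//= eqxx big1 ?addr0// => j jk.
    rewrite (_ : (j == k + i :> nat)%N = false)//; apply/negbTE.
    by apply: contraNneq jk => jk; apply/eqP/val_inj.
  by rewrite big1// => j _; rewrite ltn_eqF// (leq_trans (ltn_ord j)).
have cnt_min c M : \sum_(k < M) (k < c)%N%:R = (minn c M)%:R :> R.
  elim: M => [|M IH]; first by rewrite big_ord0 minn0.
  rewrite big_ord_recr /= IH -natrD; congr (_%:R).
  by rewrite /minn ltnS; case: (ltngtP c M) => [_|_|->]; rewrite ?addn0 ?addn1.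
have cntN : N%:R - i%:R <= cnt <= N%:R.
  rewrite cntE cnt_min; apply/andP; split; last by rewrite ler_nat geq_minr.
  by rewrite lerBlDr -natrD ler_nat (minn_idPl (leq_subr i N)) addnC -leq_subLR.
rewrite -[X in _ - X]mul1r -(rmorph1 (real_complex R)) -mulrBl -rmorphB.
rewrite Normc.normcM normc_expz mulr1 normc_real ler_norml.
have E : N%:R^-1 * cnt - 1 = (cnt - N%:R) / N%:R by field; rewrite gt_eqF.
rewrite E -mulNr !ler_pM2r ?invr_gt0//; move: cntN => /andP[c1 c2].
have i0 : 0 <= i%:R :> R by rewrite ler0n.
by apply/andP; split; lra.
Qed.

Lemma fejer_trigpoly_cvg p : trigpoly nonneg_freq p ->
  exists K : R, forall N x, (0 < N)%N -> normc (fejer N p x - p x) <= K / N%:R.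
Proof.
elim=> [|a n {}p n0 Sp [K IH]].
  exists 0 => N x N0; rewrite mul0r subr0 /fejer big1 ?Normc.normc0// => j _.
  by rewrite big1// => k _; rewrite coef_cst0 mulr0 mul0r.
case: n n0 => // i _.
exists (`|a| * i%:R + K) => N x N0.
have cp := square_integrable_cintegrable (trigpoly_square_integrable Sp).
have ci := cintegrable_expz (R := R) i.
rewrite fejerD//; last exact: cintegrableZ.
rewrite fejerZ// opprD addrACA -mulrBr (le_trans (le_normcD _ _))// mulrDl lerD ?IH//.
by rewrite Normc.normcM normc_real -mulrA ler_wpM2l// fejer_expz.
Qed.

Lemma sqnormD_le f g : square_integrable f -> square_integrable g ->
  sqnorm (fun x => f x + g x) <= 2 * sqnorm f + 2 * sqnorm g.
Proof.
move=> sf sg; rewrite -parallelogram// lerDl.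
by apply: sqnorm_ge0; exact: square_integrableB.
Qed.

Lemma sqnorm_le_sqr f (c : R) : cmeasurable f -> (forall x, normc (f x) <= c) ->
  sqnorm f <= c ^+ 2.
Proof.
move=> mf fc; rewrite -[leRHS]Rint_cst; apply: le_Rint.
- by have [] := @square_integrable_bounded _ _ c mf (aeW _ fc).
- exact: cintegrable_cst.
- apply: aeW => x /=; rewrite ler_pXn2r// nnegrE ?normc_ge0//.
  by rewrite (le_trans _ (fc x)) ?normc_ge0.
Qed.

(** The polynomials u_k may be unbounded as k varies, whereas the Fejer means of G inherit its
    bound. They are close to G in L^2 by comparison with some u_j, since the means contract the norm
    and converge uniformly on polynomials; the rate 4^-k gives convergence almost everywhere. *)
Lemma bounded_trigpoly_approx u G (C : R) : 0 <= C -> (forall k, trigpoly nonneg_freq (u k)) ->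
  dominated_cvg2 u G -> (\forall x \ae m, normc (G x) <= C) ->
  exists v, [/\ forall k, trigpoly nonneg_freq (v k), forall k x, normc (v k x) <= C &
    \forall x \ae m, ccvg (v^~ x) (G x)].
Proof.
move=> C0 Tu uG GC; have [su sG] := dominated_cvg2_sqint uG; have [mu mG _ uG'] := uG.
have symG : symmetric G by apply: (symmetric_cvg _ uG') => k; exact: trigpoly_symmetric (Tu k).
have G0 n : ~ nonneg_freq n -> coef G n = 0 by exact: coef_dominated_eq0 Tu uG.
have ex k : exists N, (0 < N)%N /\ sqnorm (fun x => fejer N G x - G x) <= 1 * 4^-1 ^+ k.
  pose e : R := 4^-1 ^+ k; have e0 : 0 < e by rewrite exprn_gt0.
  have h0 : sqnorm (fun x => G x - u j x) @[j --> \oo] --> (0 : R).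
    have -> : (0 : R) = sqnorm (fun x => G x - G x).
      rewrite /sqnorm (@eq_Rint _ _ (fun=> 0%:C)) ?Rint_cst// => x.
      by rewrite subrr Normc.normc0 expr0n.
    exact: dominated_cvg2_sqnorm (dominated_cvg2Bl uG sG).
  (* The error splits into three terms of squared norm at most e / 12, which two uses of the
     inequality |a + b|^2 <= 2 |a|^2 + 2 |b|^2 weight by 2, 4 and 4: the total is at most 10 e /
     12. *)
  have [j _ /(_ j (leqnn j))] : \forall j \near \oo, sqnorm (fun x => G x - u j x) < e / 12.
    by apply: (cvgr_lt 0) => //; rewrite divr_gt0.
  rewrite /= => hj.
  have [K hK] := fejer_trigpoly_cvg (Tu j).
  have sGu := square_integrableB sG (su j).
  have [muj [c uc]] := trigpoly_bounded (Tu j).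
  have symGu : symmetric (fun x => G x - u j x).
    by apply: symmetricB => //; exact: trigpoly_symmetric (Tu j).
  (* N exceeds 12 K^2 / e and is at least 1, whence K^2 / N^2 <= K^2 / N <= e / 12. *)
  pose N := (Num.truncn (K ^+ 2 * 12 / e)).+1.
  have N0 : (0 < N)%N by [].
  have N0' : 0 < N%:R :> R by rewrite ltr0n.
  have KN : (K / N%:R) ^+ 2 <= e / 12.
    have h1 : K ^+ 2 * 12 / e < N%:R := truncnS_gt _.
    have N1 : 1 <= N%:R :> R by rewrite ler1n.
    rewrite expr_div_n ler_pdivrMr ?exprn_gt0//.
    apply: (@le_trans _ _ (e / 12 * N%:R)); last first.
      by rewrite ler_pM2l ?divr_gt0// expr2 ler_peMl// ltW.
    by move: h1; rewrite ltr_pdivrMr// => h1; lra.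
  exists N; split => //; rewrite mul1r.
  have GucC : \forall x \ae m, normc (G x - u j x) <= C + c.
    apply: filterS GC => x Gx; rewrite (le_trans (le_normcD _ _))// normcN.
    by rewrite lerD.
  have [mF1 [c1 Fc1]] := cmeasurable_fejer N (fun x => G x - u j x).
  have [mF2 [c2 Fc2]] := cmeasurable_fejer N (u j).
  have sF1 := square_integrable_bounded mF1 (aeW _ Fc1).
  have mF2' := cmeasurableB mF2 muj.
  have sF2 : square_integrable (fun x => fejer N (u j) x - u j x).
    by apply: (@square_integrable_bounded _ _ (K / N%:R)) => //; apply: aeW => x; exact: hK.
  have suG := square_integrableB (su j) sG.
  have -> : (fun x => fejer N G x - G x) = (fun x => fejer N (fun x => G x - u j x) x +
      ((fejer N (u j) x - u j x) + (u j x - G x))).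
    apply/funext => x; rewrite fejerB; last 2 first.
    - exact: square_integrable_cintegrable.
    - exact: square_integrable_cintegrable.
    by ring.
  apply: (le_trans (sqnormD_le sF1 (square_integrableD sF2 suG))).
  have h1 := sqnorm_fejer_le N0 symGu (cmeasurableB mG muj) GucC.
  have h2 := sqnormD_le sF2 suG.
  have h3 : sqnorm (fun x => fejer N (u j) x - u j x) <= (K / N%:R) ^+ 2.
    by apply: sqnorm_le_sqr => // x; exact: hK.
  have h4 : sqnorm (fun x => u j x - G x) = sqnorm (fun x => G x - u j x).
    by apply: eq_Rint => x; rewrite -opprB normcN.
  rewrite h4 in h2; rewrite -/e; lra.
have [N NP] := choice ex.
have Tv k : trigpoly nonneg_freq (fejer (N k) G) by exact: fejer_trigpoly.
exists (fun k => fejer (N k) G); split => //.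
- move=> k x; rewrite -(ler_pXn2r (n := 2))// ?nnegrE ?normc_ge0//.
  have [h1 h2] := sqr_normc_fejer_le x (NP k).1 symG mG GC.
  exact: le_trans h1 h2.
- apply: (summable_ae_cvg (C := 1)) => // [k|k]; last by have [] := NP k.
  exact: trigpoly_square_integrable (Tv k).
Qed.

End fejer_means.

(** * Bounded approximation in shift-invariant spaces *)

Section shift_invariant_spaces.
Context {R : realType}.
Implicit Types (f g h : circle R -> R[i]) (u : nat -> circle R -> R[i]).
Implicit Types (D M : set (circle R -> R[i])).
Local Open Scope complex_scope.
Local Notation m := (@circle_measure R).

Definition ae_bounded f := exists c, \forall x \ae m, normc (f x) <= c.

(* The only closedness used is under almost everywhere limits dominated by a
   function of [D]; this treats all exponents at once. *)
Record shift_space D M : Prop := {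
  shift_space_cst : forall c : R, D (fun=> c%:C);
  shift_space_sub : M `<=` D;
  shift_space_int : M `<=` cintegrable;
  shift_space_sym : M `<=` symmetric;
  shift_space0 : M (fun=> 0);
  shift_spaceL : forall (a : R) f g, M f -> M g -> M (fun x => a%:C * f x + g x);
  shift_spacez : forall f, M f -> M (fun x => (x : R[i]) * f x);
  shift_space_dom : forall u f g, (forall k, M (u k)) -> cmeasurable f -> D g ->
    (forall k, \forall x \ae m, normc (u k x) <= normc (g x)) ->
    (\forall x \ae m, ccvg (u^~ x) (f x)) -> M f }.

Lemma shift_spaceZ D M (a : R) f : shift_space D M -> M f -> M (fun x => a%:C * f x).
Proof.
move=> sM Mf; have := shift_spaceL sM a Mf (shift_space0 sM).
by congr M; apply/funext => x; rewrite addr0.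
Qed.

Lemma shift_space_ae D M f g : shift_space D M -> M f -> cmeasurable g ->
  (\forall x \ae m, f x = g x) -> M g.
Proof.
move=> sM Mf mg fg; apply: (shift_space_dom sM (u := fun=> f) (g := f)) => //.
- exact: shift_space_sub sM _ Mf.
- by move=> _; exact: aeW.
- by apply: filterS fg => x ->; exact: ccvg_cst.
Qed.

Lemma shift_spaceX D M (n : nat) f : shift_space D M -> M f -> M (fun x => (x : R[i]) ^ n * f x).
Proof.
move=> sM Mf; elim: n => [|n IH].
  by rewrite (_ : (fun x => _) = f)//; apply/funext => x; rewrite expr0z mul1r.
have := shift_spacez sM IH; congr M; apply/funext => x.
by rewrite -!exprnP exprS mulrA.
Qed.

Lemma shift_space_trigpoly D M S p f : shift_space D M ->
  (forall n f, S n -> M f -> M (fun x => (x : R[i]) ^ n * f x)) ->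
  trigpoly S p -> M f -> M (fun x => p x * f x).
Proof.
move=> sM SM Sp Mf; elim: Sp => [|a n {}p Sn _ IH].
  by rewrite (_ : (fun x => _) = (fun=> 0)); [exact: shift_space0 sM|apply/funext => x; rewrite mul0r].
have := shift_spaceL sM a (SM _ _ Sn Mf) IH; congr M; apply/funext => x.
by rewrite mulrDl mulrA.
Qed.

Lemma nonneg_freq_shift D M n f : shift_space D M -> nonneg_freq n -> M f ->
  M (fun x => (x : R[i]) ^ n * f x).
Proof. by case: n => // n sM _; exact: shift_spaceX sM. Qed.

(* Outer functions obtained from [1 + d w], d -> 0, play the role of the usual
   truncation multipliers. *)
Lemma cutoff_multipliers (w : circle R -> R) : (forall x, 0 <= w x) ->
  square_integrable (fun x => (w x)%:C) -> symmetric (fun x => (w x)%:C) ->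
  exists k : nat -> circle R -> R[i],
    [/\ forall j, cmeasurable (k j), forall j, \forall x \ae m, normc (k j x) <= 2,
      forall j, exists c, \forall x \ae m, normc (k j x) * w x <= c,
      \forall x \ae m, ccvg (k^~ x) 1 &
      forall D M j f, shift_space D M -> M f -> M (fun x => k j x * f x)].
Proof.
move=> w0 sw symw.
(* For 0 < d <= 1 the squared norm of 1 + d w is at most 1 + d A. The choice d_j = 4^-j / A then
   gives |G_j - 1|^2 an integral of at most 4^-j, fast enough for convergence almost everywhere; the
   summand 1 keeps A positive. *)
pose A := 1 + 2 * Rint (fun x => (w x)%:C) + sqnorm (fun x => (w x)%:C).
have cw := square_integrable_cintegrable sw; have [mw _] := sw.
have A1 : 1 <= A.
  rewrite /A -addrA lerDl addr_ge0 ?sqnorm_ge0// mulr_ge0//.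
  by apply: Rint_ge0 => //; apply: aeW => x /=.
pose d (j : nat) : R := 4^-1 ^+ j / A.
have d0 j : 0 < d j by rewrite divr_gt0 ?exprn_gt0// (lt_le_trans _ A1).
have d1 j : d j <= 1.
  rewrite ler_pdivrMr ?(lt_le_trans _ A1)// mul1r (le_trans _ A1)//.
  by apply: exprn_ile1; lra.
pose s j x := 1 + d j * w x.
have sE j : (fun x => (s j x)%:C) = (fun x => 1 + (d j)%:C * (w x)%:C).
  by apply/funext => x; rewrite rmorphD rmorphM.
have ss j : square_integrable (fun x => (s j x)%:C).
  rewrite sE; apply: square_integrableD; first exact: square_integrable_cst.
  exact: square_integrableZ.
have s1 j x : 1 <= s j x by rewrite /s lerDl mulr_ge0// ltW.
have symS j : symmetric (fun x => (s j x)%:C).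
  rewrite sE; apply: symmetricD; first exact: (@symmetric_cst _ 1).
  by apply: symmetricM => //; exact: symmetric_cst.
have norms j : sqnorm (fun x => (s j x)%:C) <= 1 + 4^-1 ^+ j.
  rewrite sE sqnormD; [|exact: square_integrable_cst|exact: square_integrableZ].
  rewrite sqnormZ//.
  have -> : sqnorm (fun _ : circle R => 1 : R[i]) = 1.
    rewrite /sqnorm (@eq_Rint _ _ (fun=> 1%:C)) ?Rint_cst// => x.
    by rewrite Normc.normc1 expr1n.
  have -> : Rint (fun x => 1 * ((d j)%:C * (w x)%:C)^*) = d j * Rint (fun x => (w x)%:C).
    by rewrite -RintZ//; apply: eq_Rint => x; rewrite !ReImE /=; ring.
  have h1 : d j * A = 4^-1 ^+ j by rewrite /d divfK// gt_eqF// (lt_le_trans _ A1).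
  rewrite -addrA lerD2l -h1 /A.
  have h2 := sqnorm_ge0 sw; have h3 := d0 j; have h4 := d1 j.
  have h5 : d j ^+ 2 * sqnorm (fun x => (w x)%:C) <= d j * sqnorm (fun x => (w x)%:C).
    by rewrite ler_wpM2r// expr2 ler_piMl// ltW.
  by lra.
have ex j : exists G : circle R -> R[i], [/\ square_integrable G,
    \forall x \ae m, normc (G x) * s j x <= 2,
    sqnorm (fun x => G x - 1) <= 1 * 4^-1 ^+ j &
    exists v, [/\ forall i, trigpoly nonneg_freq (v i), forall i x, normc (v i x) <= 2 &
      \forall x \ae m, ccvg (v^~ x) (G x)]].
  have [u [G [c [Tu uG Gc cs Gs]]]] := szego_factorization (s1 j) (ss j) (symS j).
  have c2 : c <= 2.
    by have := norms j; have : 4^-1 ^+ j <= 1 :> R; [apply: exprn_ile1; lra|lra].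
  have Gs2 : \forall x \ae m, normc (G x) * s j x <= 2.
    apply: filterS Gc => x Gx; have s0 : 0 <= s j x by rewrite (le_trans _ (s1 j x)).
    by rewrite -(ler_pXn2r (n := 2))// ?nnegrE ?mulr_ge0 ?normc_ge0// Gx; lra.
  exists G; split => //.
  - by have [_] := dominated_cvg2_sqint uG.
  - by have := norms j; lra.
  - apply: bounded_trigpoly_approx uG _ => //; apply: filterS Gs2 => x; apply: le_trans.
    by rewrite ler_peMr// normc_ge0.
have [k kP] := choice ex; exists k.
have k2 j : \forall x \ae m, normc (k j x) <= 2.
  have [_ h _ _] := kP j; apply: filterS h => x; apply: le_trans.
  by rewrite ler_peMr// normc_ge0.
split => //.
- by move=> j; have [[mk _] _ _ _] := kP j.
(* From |k_j| (1 + d_j w) <= 2, after dropping the summand 1. *)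
- move=> j; exists (2 / d j); have [_ h _ _] := kP j; apply: filterS h => x h.
  rewrite ler_pdivlMr// (le_trans _ h)// /s mulrDr -mulrA mulr1 [w x * _]mulrC lerDr.
  exact: normc_ge0.
- apply: (summable_ae_cvg (C := 1)) => [j||j]; last by have [] := kP j.
  + by have [] := kP j.
  + exact: square_integrable_cst.
- move=> D M j f sM Mf; have [[mk _] _ _ [v [Tv vb vk]]] := kP j.
  have [mf _] := shift_space_int sM Mf.
  (* The polynomials v_i tending to k_j are uniformly bounded by 2, so v_i f is dominated by 2 |f|:
     this is why the Fejer means were needed. *)
  apply: (shift_space_dom sM (u := fun i x => v i x * f x) (g := fun x => 2%:C * f x)).
  + move=> i; apply: (shift_space_trigpoly sM _ (Tv i) Mf) => n g.
    exact: nonneg_freq_shift sM.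
  + exact: cmeasurableM.
  + by apply: (shift_space_sub sM); exact: shift_spaceZ sM _.
  + move=> i; apply: aeW => x; rewrite !Normc.normcM normc_real ler_wpM2r ?normc_ge0//.
    by rewrite ger0_norm.
  + by apply: filterS vk => x h; apply: ccvgM => //; exact: ccvg_cst.
Qed.

Lemma bounded_approximation D M f : shift_space D M -> M f ->
  exists u, [/\ forall k, M (u k), forall k, ae_bounded (u k),
    forall k, \forall x \ae m, normc (u k x) <= normc (4%:C * f x) &
    \forall x \ae m, ccvg (u^~ x) (f x)].
Proof.
move=> sM Mf; have [mf cf] := shift_space_int sM Mf; have symf := shift_space_sym sM Mf.
pose w x := Num.sqrt (normc (f x)).
have [|||k [mk k2 kw k1 kM]] := @cutoff_multipliers w.
- by move=> x; exact: sqrtr_ge0.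
- split.
    apply: cmeasurableC; apply: (measurableT_comp (@measurable_sqrt R)).
    exact: measurable_normc.
  have -> : (fun x => (normc (w x)%:C ^+ 2)%:C) = (fun x => (normc (f x))%:C).
    by apply/funext => x; rewrite normc_real ger0_norm ?sqrtr_ge0// sqr_sqrtr ?normc_ge0.
  exact: cintegrable_normc.
- by apply: symmetric_real; apply: filterS (symmetric_normc symf) => x h; rewrite /w h.
exists (fun j x => k j x * (k j x * f x)); split.
- by move=> j; exact: (kM _ _ _ _ sM (kM _ _ _ _ sM Mf)).
- move=> j; have [c kc] := kw j; exists (c ^+ 2); apply: filterS kc => x kc.
  rewrite !Normc.normcM mulrA -expr2 -[normc (f x)]sqr_sqrtr ?normc_ge0// -exprMn.
  have h : 0 <= normc (k j x) * w x by rewrite mulr_ge0 ?normc_ge0 ?sqrtr_ge0.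
  by rewrite ler_pXn2r// nnegrE (le_trans h).
- move=> j; apply: filterS (k2 j) => x kx.
  rewrite !Normc.normcM normc_real ger0_norm// mulrA ler_wpM2r ?normc_ge0//.
  by have := normc_ge0 (k j x); nra.
- apply: filterS k1 => x k1; rewrite -[X in ccvg _ X]mul1r -[X in ccvg _ (_ * X)]mul1r.
  by apply: ccvgM => //; apply: ccvgM => //; exact: ccvg_cst.
Qed.

(** The majorant W is square integrable but need not be in D, so two limits are taken. For fixed j,
    the products k_j u_i are bounded by a constant because k_j cuts off W, and their limit k_j f is
    in M; as j grows, k_j f is bounded by 2 c and tends to f. *)
Lemma shift_space_cvg2 D M u f : shift_space D M -> (forall k, M (u k)) ->
  dominated_cvg2 u f -> ae_bounded f -> M f.
Proof.
move=> sM Mu [mu mf [W [sW uW]] uf] [c fc].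
(* W need not be symmetric; adding its reflection makes [w] invariant under conjugation, as the
   cutoff requires. *)
pose w x := normc (W x) + normc (W (circle_conj x)).
have [|||k [mk k2 kw k1 kM]] := @cutoff_multipliers w.
- by move=> x; rewrite addr_ge0 ?normc_ge0.
- under eq_fun do rewrite rmorphD.
  apply: square_integrableD; apply: square_integrable_normc => //.
  exact: square_integrable_comp_conj.
- by apply: symmetric_real; apply: aeW => x; rewrite /w circle_conjK addrC.
have Mkf j : M (fun x => k j x * f x).
  have [d kd] := kw j.
  apply: (shift_space_dom sM (u := fun i x => k j x * u i x) (g := fun=> d%:C)).
  - by move=> i; exact: kM sM _.
  - exact: cmeasurableM.
  - exact: shift_space_cst sM _.
  - move=> i; apply: filterS2 kd (uW i) => x kx ux.
    rewrite Normc.normcM normc_real (le_trans _ (le_trans kx (ler_norm _)))//.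
    by rewrite ler_wpM2l ?normc_ge0// (le_trans ux)// lerDl normc_ge0.
  - by apply: filterS uf => x h; apply: ccvgMl.
apply: (shift_space_dom sM (u := fun i x => k i x * f x) (g := fun=> (2 * c)%:C)) => //.
- exact: shift_space_cst sM _.
- move=> i; apply: filterS2 (k2 i) fc => x kx fx.
  rewrite Normc.normcM normc_real (le_trans _ (ler_norm _))//.
  by rewrite ler_pM ?normc_ge0.
- by apply: filterS k1 => x k1; rewrite -[X in ccvg _ X]mul1r; apply: ccvgM => //; exact: ccvg_cst.
Qed.

(** Boundedness of f keeps the products u_k f dominated in L^2, and boundedness of both h and f
    makes the limit h f bounded, so that [shift_space_cvg2] applies. *)
Lemma shift_spaceM_cvg2 D M S u h f : shift_space D M ->
  (forall n f, S n -> M f -> M (fun x => (x : R[i]) ^ n * f x)) ->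
  (forall k, trigpoly S (u k)) -> dominated_cvg2 u h -> ae_bounded h ->
  M f -> ae_bounded f -> M (fun x => h x * f x).
Proof.
move=> sM SM Su uh [a ha] Mf [b fb]; have [mf _] := shift_space_int sM Mf.
apply: (shift_space_cvg2 sM (u := fun k x => u k x * f x)).
- by move=> k; exact: (shift_space_trigpoly sM SM (Su k)).
- rewrite (_ : (fun x => h x * f x) = (fun x => f x * h x)); last by apply/funext => x; rewrite mulrC.
  rewrite (_ : (fun k x => _) = (fun k x => f x * u k x)); first exact: dominated_cvg2Mb uh mf fb.
  by apply/funext => k; apply/funext => x; rewrite mulrC.
- exists (a * b); apply: filterS2 ha fb => x hx fx.
  by rewrite Normc.normcM ler_pM ?normc_ge0.
Qed.

End shift_invariant_spaces.

(** * Dominated convergence in Lebesgue spaces *)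

Section lebesgue_spaces.
Context {R : realType}.
Implicit Types (f g h : circle R -> R[i]) (u : nat -> circle R -> R[i]) (p : \bar R).
Local Open Scope complex_scope.
Local Notation m := (@circle_measure R).

Lemma circle_measure_gt0 : (0 < m setT)%E.
Proof. by rewrite probability_setT lte01. Qed.

Definition powc (r : R) f : circle R -> R[i] := fun x => (normc (f x) `^ r)%:C.

Lemma cmeasurable_powc r f : cmeasurable f -> cmeasurable (powc r f).
Proof.
move=> mf; apply: cmeasurableC.
exact: (measurableT_comp (measurable_powR r) (measurable_normc mf)).
Qed.

Lemma normc_powc r f x : normc (powc r f x) = normc (f x) `^ r.
Proof. by rewrite normc_real ger0_norm// powR_ge0. Qed.

Lemma powR_cLnorm (r : R) f : 1 <= r ->
  (cLnorm r%:E f `^ r)%E = (\int[m]_x (normc (f x) `^ r)%:E)%E.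
Proof.
move=> r1; have r0 : r != 0 by rewrite gt_eqF// (lt_le_trans ltr01 r1).
rewrite /cLnorm (powR_Lnorm m _ r0).
by apply: eq_integral => x _; rewrite abse_EFin poweR_EFin ger0_norm ?normc_ge0.
Qed.

Lemma Lp_powc (r : R) f : 1 <= r ->
  Lp r%:E f <-> cmeasurable f /\ cintegrable (powc r f).
Proof.
move=> r1; have int_powc : cmeasurable f -> cintegrable (powc r f) <->
    (\int[m]_x (normc (f x) `^ r)%:E < +oo)%E.
  move=> mf; have mp := cmeasurable_powc r mf; split=> [[_ /integrableP[_]]|h].
    by congr (_ < _)%E; apply: eq_integral => x _; rewrite normc_powc gee0_abs// lee_fin powR_ge0.
  split=> //; apply/integrableP; split; first exact/measurable_EFinP/measurable_normc.
  by move: h; congr (_ < _)%E; apply: eq_integral => x _; rewrite normc_powc gee0_abs// lee_fin powR_ge0.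
split=> [[mf fr]|[mf /(int_powc mf)]].
  by split=> //; apply/(int_powc mf); rewrite -powR_cLnorm// poweR_lty.
rewrite -powR_cLnorm// => fr; split=> //; rewrite ltey; apply: contraTneq fr => ->.
by rewrite poweRyr ?ltxx// gt_eqF// (lt_le_trans ltr01 r1).
Qed.

Lemma Lp_oo f : Lp +oo%E f <-> cmeasurable f /\ ae_bounded f.
Proof.
rewrite /Lp/= /cLnorm unlock circle_measure_gt0; split=> -[mf].
  move=> fy; split=> //; have h := ess_sup_inf.ess_sup_ge m (abse \o (fun x => (normc (f x))%:E)).
  (* Excludes the value -oo, so that the essential supremum is a real number. *)
  have : (0 <= ess_sup_inf.ess_sup m (abse \o (fun x => (normc (f x))%:E)))%E.
    by apply: ess_sup_inf.ess_sup_gee; [exact: circle_measure_gt0|apply: aeW => x; exact: abse_ge0].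
  move: fy h; case: (ess_sup_inf.ess_sup _ _) => // c _ h _; exists c; apply: filterS h => x /=.
  by rewrite lee_fin ger0_norm ?normc_ge0.
move=> [c fc]; split=> //; apply: (@le_lt_trans _ _ c%:E); last exact: ltry.
by apply/ess_sup_inf.ess_supP; apply: filterS fc => x; rewrite /= lee_fin ger0_norm ?normc_ge0.
Qed.

Lemma exponentP p : (1 <= p)%E -> p = +oo%E \/ exists2 r, p = r%:E & 1 <= r.
Proof. by case: p => [r| |]// r1; [right; exists r|left]. Qed.

Lemma le_Lp p f g : (1 <= p)%E -> cmeasurable f -> Lp p g ->
  (\forall x \ae m, normc (f x) <= normc (g x)) -> Lp p f.
Proof.
move=> /exponentP[->|[r -> r1]] mf.
  move=> /Lp_oo[_ [c gc]] fg; apply/Lp_oo; split=> //; exists c.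
  by apply: filterS2 fg gc => x; exact: le_trans.
move=> /(Lp_powc _ r1)[mg cg] fg; apply/(Lp_powc _ r1); split=> //.
apply: le_cintegrable cg _; first exact: cmeasurable_powc.
apply: filterS fg => x fg; rewrite !normc_powc ge0_ler_powR ?nnegrE ?normc_ge0//.
exact: le_trans r1.
Qed.

Lemma LpZ p (a : R[i]) f : (1 <= p)%E -> Lp p f -> Lp p (fun x => a * f x).
Proof.
move=> /exponentP[->|[r -> r1]].
  move=> /Lp_oo[mf [c fc]]; apply/Lp_oo; split.
    by apply: cmeasurableM => //; exact: cmeasurable_cst.
  exists (normc a * c); apply: filterS fc => x fc.
  by rewrite Normc.normcM ler_wpM2l ?normc_ge0.
move=> /(Lp_powc _ r1)[mf cf]; apply/(Lp_powc _ r1); split.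
  by apply: cmeasurableM => //; exact: cmeasurable_cst.
rewrite (_ : powc r _ = fun x => (normc a `^ r)%:C * powc r f x); first exact: cintegrableZ.
by apply/funext => x; rewrite /powc -rmorphM Normc.normcM powRM ?normc_ge0.
Qed.

Lemma Lp_bounded p f (c : R) : (1 <= p)%E -> cmeasurable f ->
  (\forall x \ae m, normc (f x) <= c) -> Lp p f.
Proof.
move=> p1 mf fc; apply: (@le_Lp p f (fun=> c%:C)) => //; last first.
  by apply: filterS fc => x fc; rewrite normc_real (le_trans fc)// ler_norm.
have [->|[r -> r1]] := exponentP p1.
  apply/Lp_oo; split; first exact: cmeasurable_cst.
  by exists `|c|; apply: aeW => x; rewrite normc_real.
apply/(Lp_powc _ r1); split; first exact: cmeasurable_cst.
exact: cintegrable_cst.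
Qed.

Lemma powR_ge_id (t r : R) : 0 <= t -> 1 <= r -> t <= 1 + t `^ r.
Proof.
move=> t0 r1; have [t1|/ltW t1] := leP t 1; first by rewrite (le_trans t1)// lerDl powR_ge0.
by rewrite (le_trans (le1r_powR t1 r1))// lerDr.
Qed.

Lemma Lp_cintegrable p f : (1 <= p)%E -> Lp p f -> cintegrable f.
Proof.
move=> /exponentP[->|[r -> r1]].
  by move=> /Lp_oo[mf [c fc]]; exact: cintegrable_bounded fc.
move=> /(Lp_powc _ r1)[mf cf].
apply: (@le_cintegrable _ f (fun x => 1%:C + powc r f x)) => //.
  by apply: cintegrableD => //; exact: cintegrable_cst.
apply: aeW => x; rewrite /powc -rmorphD normc_real ger0_norm ?addr_ge0 ?powR_ge0//.
exact: powR_ge_id (normc_ge0 _) r1.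
Qed.

Lemma powR_le_id (t r : R) : 0 <= t <= 1 -> 1 <= r -> t `^ r <= t.
Proof.
move=> /andP[t0 t1] r1; have [->|tn0] := eqVneq t 0.
  by rewrite powR0// gt_eqF// (lt_le_trans _ r1).
by apply: ge1r_powR => //; rewrite t1 lt_def tn0 t0.
Qed.

Lemma cvg_powR_0 (a : nat -> R) (r : R) : 1 <= r -> (forall n, 0 <= a n) ->
  a n @[n --> \oo] --> 0 -> a n `^ r @[n --> \oo] --> 0.
Proof.
move=> r1 a0 cva; apply: (@squeeze_cvgr _ _ _ _ (fun=> 0) a); last 2 first.
- exact: cvg_cst.
- exact: cva.
near=> n; rewrite powR_ge0 /= powR_le_id// a0 /=.
by near: n; apply: (cvgr_le 0) => //; exact: ltr01.
Unshelve. all: by end_near. Qed.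

Lemma ae_cvg_le u f g : (forall k, \forall x \ae m, normc (u k x) <= normc (g x)) ->
  (\forall x \ae m, ccvg (u^~ x) (f x)) -> \forall x \ae m, normc (f x) <= normc (g x).
Proof.
move=> ug uf; have {}ug : \forall x \ae m, forall k, normc (u k x) <= normc (g x).
  exact: ae_foralln.
by apply: filterS2 ug uf => x ug uf; exact: ccvg_le uf ug.
Qed.

Lemma normcB_le2 (z w v : R[i]) : normc z <= normc v -> normc w <= normc v ->
  normc (z - w) <= normc (2%:C * v).
Proof.
move=> zv wv; rewrite Normc.normcM normc_real ger0_norm// mulr_natl mulr2n.
rewrite (le_trans (normcD_le _ _))// lerD// (_ : normc (- w) = normc w)//.
exact: normcN.
Qed.

(** Dominated convergence for the functions |f - u_k|^r, with majorant |2 g|^r. *)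
Lemma Lp_dominated_cvg (r e : R) u f g : 1 <= r -> 0 < e ->
  (forall k, cmeasurable (u k)) -> cmeasurable f -> Lp r%:E g ->
  (forall k, \forall x \ae m, normc (u k x) <= normc (g x)) ->
  (\forall x \ae m, ccvg (u^~ x) (f x)) ->
  exists k, (cLnorm r%:E (f \- u k)%R < e%:E)%E.
Proof.
move=> r1 e0 mu mf Lg ug uf; have r0 : 0 < r := lt_le_trans ltr01 r1.
have [_ cg] := (Lp_powc _ r1).1 (LpZ 2%:C (r1 : (1 <= r%:E)%E) Lg).
have fg := ae_cvg_le ug uf.
have md k : cmeasurable (f \- u k) by exact: cmeasurableB.
have bd k : \forall x \ae m, normc (powc r (f \- u k) x) <= normc (powc r (fun x => 2%:C * g x) x).
  apply: filterS2 (ug k) fg => x ux fx.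
  rewrite !normc_powc ge0_ler_powR ?nnegrE ?normc_ge0 ?(ltW r0)//=.
  exact: normcB_le2.
have [|||||_ lim0] := @dominated_cintegrable _ (fun k => powc r (f \- u k)) (fun=> 0)
  (powc r (fun x => 2%:C * g x)).
- by move=> k; exact: cmeasurable_powc.
- exact: cmeasurable_cst.
- exact: cg.
- exact: bd.
- apply: filterS uf => x uf; apply: normc_ccvg.
  under eq_fun do rewrite subr0 normc_powc.
  apply: cvg_powR_0 => // [n|]; first exact: normc_ge0.
  have := ccvg_normc (ccvgB (ccvg_cst (f x)) uf).
  by rewrite subrr Normc.normc0.
have R0 : Rint (fun _ : circle R => 0) = 0 :> R by exact: (Rint_cst 0).
rewrite R0 in lim0.
have er : 0 < e `^ r by rewrite powR_gt0.
have /filter_ex[k hk] : \forall k \near \oo, Rint (powc r (f \- u k)) < e `^ r.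
  exact: (cvgr_lt 0).
exists k; have [_ ck] : cmeasurable (f \- u k) /\ cintegrable (powc r (f \- u k)).
  split=> //; apply: le_cintegrable cg (bd k); exact: cmeasurable_powc.
have h := powR_cLnorm (f \- u k) r1.
have E : (\int[m]_x (normc ((f \- u k) x) `^ r)%:E)%E = (Rint (powc r (f \- u k)))%:E.
  rewrite /Rint /Rintegral fineK//.
  exact: (integrable_fin_num measurableT (cintegrable_Re ck)).
rewrite E in h; rewrite ltNge; apply/negP => le_e.
have : (e%:E `^ r <= cLnorm r%:E (f \- u k)%R `^ r)%E.
  by apply: gt0_ler_poweR; rewrite ?(ltW r0)// ?in_itv/= ?lee_fin ?(ltW e0)// ?leey ?andbT// Lnorm_ge0.
by rewrite h poweR_EFin lee_fin leNgt hk.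
Qed.

Lemma weakstar_dominated_cvg n (g : 'I_n -> circle R -> R[i]) (e : R) u f h :
  (forall i, cintegrable (g i)) -> 0 < e ->
  (forall k, cmeasurable (u k)) -> cmeasurable f -> ae_bounded h ->
  (forall k, \forall x \ae m, normc (u k x) <= normc (h x)) ->
  (\forall x \ae m, ccvg (u^~ x) (f x)) ->
  exists k, forall i, normc (cintegral (fun x => (f x - u k x) * g i x)) < e.
Proof.
move=> cg e0 mu mf [c hc] uh uf; have fh := ae_cvg_le uh uf.
have lim0 (a : R[i]) i : Rint (fun x => a * ((f x - u k x) * g i x)) @[k --> \oo] --> 0.
  have [mg _] := cg i.
  have [|||||_] := @dominated_cintegrable _ (fun k x => a * ((f x - u k x) * g i x)) (fun=> 0)
    (fun x => (2%:C * `|c|%:C * a) * g i x).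
  - move=> k; apply: cmeasurableM; first exact: cmeasurable_cst.
    by apply: cmeasurableM => //; exact: cmeasurableB.
  - exact: cmeasurable_cst.
  - exact: cintegrableZ.
  - move=> k; apply: filterS3 (uh k) fh hc => x ux fx hx.
    rewrite mulrCA -(mulrA _ a) Normc.normcM [leRHS]Normc.normcM ler_wpM2r ?normc_ge0//.
    rewrite (le_trans (normcB_le2 fx ux))// !Normc.normcM ler_wpM2l ?normc_ge0//.
    by rewrite normc_real normr_id (le_trans hx)// ler_norm.
  - apply: filterS uf => x uf; rewrite -[X in ccvg _ X](mulr0 a); apply: ccvgMl.
    rewrite -[X in ccvg _ X](mul0r (g i x)); apply: ccvgM; last exact: ccvg_cst.
    by rewrite -[X in ccvg _ X](subrr (f x)); apply: ccvgB => //; exact: ccvg_cst.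
  by rewrite [Rint (fun=> _)](Rint_cst 0).
have e2 : 0 < e / 2 by rewrite divr_gt0.
have small (a : R[i]) i : \forall k \near \oo,
    `|Rint (fun x => a * ((f x - u k x) * g i x))| < e / 2.
  have /cvgr0_norm_lt := lim0 a i; exact.
(* The factor -i turns the imaginary part into a real part; a weak-* neighbourhood involves finitely
   many test functions, so a single k serves them all. *)
have /filter_ex[k hk] : \forall k \near \oo, forall i,
    `|Rint (fun x => 1 * ((f x - u k x) * g i x))| < e / 2 /\
    `|Rint (fun x => (0 +i* (-1)) * ((f x - u k x) * g i x))| < e / 2.
  by apply: filter_forall => i; apply: filterI; exact: small.
exists k => i; have [h1 h2] := hk i.
rewrite (le_lt_trans (normc_le_sum _))// [e]splitr ltrD//=.
  by move: h1; congr (`|_| < _); apply: eq_Rint => x; rewrite mul1r.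
move: h2; congr (`|_| < _); congr Rintegral; apply/funext => x.
by rewrite ReM /=; ring.
Qed.

(** The topology of L^p enters the argument here only; afterwards closedness of M is used in this
    form alone. *)
Lemma Lp_closed_dominated p M u f h : (1 <= p)%E -> Lp_closed p M -> M `<=` Lp p ->
  (forall k, M (u k)) -> cmeasurable f -> Lp p h ->
  (forall k, \forall x \ae m, normc (u k x) <= normc (h x)) ->
  (\forall x \ae m, ccvg (u^~ x) (f x)) -> M f.
Proof.
move=> p1 cM ML Mu mf Lh uh uf; have Lf : Lp p f by exact: le_Lp Lh (ae_cvg_le uh uf).
have mu k : cmeasurable (u k) by have [] := ML _ (Mu k).
move: cM; rewrite /Lp_closed; case: eqP => [py|/eqP py] cM.
  rewrite py in Lf Lh; apply: cM => // n g e Lg e0; have [_ bh] := (Lp_oo _).1 Lh.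
  have [k uk] := weakstar_dominated_cvg (fun i => Lp_cintegrable (lexx _) (Lg i)) e0 mu mf bh uh uf.
  by exists (u k).
have [p_oo|[r pr r1]] := exponentP p1; first by rewrite p_oo eqxx in py.
rewrite pr in Lf Lh cM; apply: cM => // e e0.
by have [k uk] := Lp_dominated_cvg r1 e0 mu mf Lh uh uf; exists (u k).
Qed.

Lemma real_subspace_shift_space p M : (1 <= p)%E -> real_subspace p M -> Lp_closed p M ->
  mulset (@zfun R) M `<=` M -> shift_space (Lp p) M.
Proof.
move=> p1 sM cM zM; have ML : M `<=` Lp p by move=> f /(real_subspace_sub sM)[].
split => //.
- move=> c; apply: (@Lp_bounded _ _ `|c|); [exact: p1|exact: cmeasurable_cst|].
  by apply: aeW => x; rewrite normc_real.
- by move=> f /ML; exact: Lp_cintegrable.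
- by move=> f /(real_subspace_sub sM)[_]; apply: filterS => x /(_ I).
- exact: real_subspace0 sM.
- move=> a f g Mf Mg; exact: real_subspaceD sM _ _ (real_subspaceZ sM a Mf) Mg.
- move=> f Mf; apply: zM; split; last by exists f => //; apply: aeW.
  by apply: cmeasurableM; [exact: cmeasurable_circle_val|have [] := ML _ Mf].
- by move=> u f g Mu mf Lg ug uf; exact: Lp_closed_dominated Lg ug uf.
Qed.

End lebesgue_spaces.

(** * Simply and doubly invariant spaces *)

Section invariant_subspaces.
Context {R : realType}.
Implicit Types (f g h phi : circle R -> R[i]) (u : nat -> circle R -> R[i]) (p : \bar R).
Implicit Types (D M : set (circle R -> R[i])) (x : circle R).
Local Open Scope complex_scope.
Local Notation m := (@circle_measure R).

Definition zbar f : circle R -> R[i] := fun x => (x : R[i])^* * f x.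

Lemma zbarK f x : (x : R[i]) * zbar f x = f x.
Proof. by rewrite mulrA circle_mulJ mul1r. Qed.

Lemma normc_zbar f x : normc (zbar f x) = normc (f x).
Proof. by rewrite Normc.normcM normc_conj normc_circle mul1r. Qed.

Lemma cmeasurable_zbar f : cmeasurable f -> cmeasurable (zbar f).
Proof. by apply: cmeasurableM; apply: cmeasurableJ; exact: cmeasurable_circle_val. Qed.

Lemma zbar_expz x : (x : R[i])^* = (x : R[i]) ^ (-1).
Proof. by rewrite -circle_invE exprN1. Qed.

(** The case p = 1 of the real Hardy space, through the real coefficients [coef]. It is itself a
    shift space with integrable majorants, so bounded approximation applies to it as well as to
    M. *)
Definition hardy1 : set (circle R -> R[i]) :=
  [set f | [/\ cintegrable f, symmetric f & forall n : int, n < 0 -> coef f n = 0]].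

Lemma hardy1_shift_space : shift_space cintegrable hardy1.
Proof.
split.
- by move=> c; exact: cintegrable_cst.
- by move=> f [].
- by move=> f [].
- by move=> f [].
- split; [exact: cintegrable_cst|exact: (symmetric_cst 0)|].
  by move=> n _; exact: coef_cst0.
- move=> a f g [cf sf f0] [cg sg g0]; split.
  + by apply: cintegrableD => //; exact: cintegrableZ.
  + by apply: symmetricD => //; apply: symmetricM => //; exact: symmetric_cst.
  + by move=> n n0; rewrite coefD ?coefZ ?f0 ?g0 ?mulr0 ?addr0//; exact: cintegrableZ.
- move=> f [cf sf f0]; split.
  + apply: (cintegrableMb (c := 1)) => //; first exact: cmeasurable_circle_val.
    by apply: aeW => x; rewrite normc_circle.
  + by apply: symmetricM => //; have := @symmetric_expz R 1; under eq_fun do rewrite expr1z.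
  + move=> n n0; rewrite -(f0 (n - 1)); last by rewrite ltrBlDr (lt_trans n0).
    by apply: eq_Rint => x; rewrite opprB expzD expr1z -mulrA [in RHS]mulrCA.
- move=> u f g hu mf cg ug uf; split.
  + have [|||||//] := dominated_cintegrable (u := u) (f := f) (g := g) => //.
    by move=> k; have [[]] := hu k.
  + by apply: symmetric_cvg uf => k; have [] := hu k.
  + move=> n n0; have [|||||_] := dominated_cintegrable
      (u := fun k x => u k x * (x : R[i]) ^ (- n)) (f := fun x => f x * (x : R[i]) ^ (- n))
      (g := fun x => g x * (x : R[i]) ^ (- n)).
    * move=> k; have [[mu _] _ _] := hu k; apply: cmeasurableM => //; exact: cmeasurable_expz.
    * by apply: cmeasurableM => //; exact: cmeasurable_expz.
    * exact: cintegrable_expzM.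
    * by move=> k; apply: filterS (ug k) => x; rewrite !Normc.normcM normc_expz !mulr1.
    * by apply: filterS uf => x h; apply: ccvgM => //; exact: ccvg_cst.
    * have hu0 k : Rint (fun x => u k x * (x : R[i]) ^ (- n)) = 0.
        by have [_ _ hk] := hu k; exact: hk.
      under eq_fun do rewrite hu0.
      by move=> h; rewrite /coef -(cvg_lim _ h)// lim_cst.
Qed.

Lemma shift_space_zbar D M : shift_space D M ->
  (forall f, M f -> ae_bounded f -> M (zbar f)) -> forall f, M f -> M (zbar f).
Proof.
move=> sM zM f Mf; have [u [Mu bu uf ulim]] := bounded_approximation sM Mf.
have [mf _] := shift_space_int sM Mf.
apply: (shift_space_dom sM (u := fun k => zbar (u k)) (g := fun x => 4%:C * f x)).
- by move=> k; exact: zM.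
- exact: cmeasurable_zbar.
- by apply: (shift_space_sub sM); exact: shift_spaceZ sM _.
- by move=> k; apply: filterS (uf k) => x; rewrite normc_zbar.
- by apply: filterS ulim => x; exact: ccvgMl.
Qed.

Lemma mulset_zfun M : mulset (@zfun R) M `<=` M ->
  (forall f, M f -> cmeasurable f /\ M (zbar f)) -> mulset (@zfun R) M = M.
Proof.
move=> zM Mz; apply/seteqP; split=> // f Mf; have [mf Mzf] := Mz _ Mf.
by split=> //; exists (zbar f) => //; apply: aeW => x _; rewrite /= zbarK.
Qed.

Lemma mulset_zfun_zbar D M f : shift_space D M -> mulset (@zfun R) M = M -> M f -> M (zbar f).
Proof.
move=> sM zM Mf; have [mf [g Mg fg]] : mulset (@zfun R) M f by rewrite zM.
apply: (shift_space_ae sM Mg); first exact: cmeasurable_zbar.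
apply: filterS fg => x /(_ I) fx.
by rewrite /zbar fx /= /zfun mulrA [_^* * _]mulrC circle_mulJ mul1r.
Qed.

Lemma bounded_square_integrable D M : shift_space D M ->
  [set f | M f /\ ae_bounded f] `<=` square_integrable.
Proof.
move=> sM f [/(shift_space_int sM)[mf _] [c fc]].
exact: square_integrable_bounded mf fc.
Qed.

Lemma bounded_shift_space D M : shift_space D M ->
  let V := [set f | M f /\ ae_bounded f] in
  [/\ V `<=` square_integrable, V `<=` symmetric, V (fun=> 0),
      (forall (a : R) f g, V f -> V g -> V (fun x => a%:C * f x + g x)) &
      forall f, V f -> V (fun x => (x : R[i]) * f x)].
Proof.
move=> sM V; split.
- exact: bounded_square_integrable sM.
- by move=> f [/(shift_space_sym sM)].
- split; first exact: shift_space0 sM.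
  by exists 0; apply: aeW => x; rewrite Normc.normc0.
- move=> a f g [Mf [b fb]] [Mg [c gc]]; split; first exact: shift_spaceL sM _ _ _ Mf Mg.
  exists (`|a| * b + c); apply: filterS2 fb gc => x fb gc.
  by rewrite (le_trans (normcD_le _ _))// lerD// Normc.normcM normc_real ler_wpM2l.
- move=> f [Mf [b fb]]; split; first exact: shift_spacez sM _ Mf.
  by exists b; apply: filterS fb => x; rewrite Normc.normcM normc_circle mul1r.
Qed.

Lemma beurling_inner D M f0 : shift_space D M -> M f0 -> ae_bounded f0 -> ~ M (zbar f0) ->
  exists phi, [/\ \forall x \ae m, normc (phi x) = 1, M phi &
    forall f k, M f -> ae_bounded f -> (0 < k)%N ->
      Rint (fun x => phi x * ((x : R[i]) ^+ k * f x)^*) = 0].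
Proof.
move=> sM Mf0 bf0 nM; have [V1 V2 V3 V4 V5] := bounded_shift_space sM.
have [u [q [Vu uq sq orth mod]]] := wandering_decomposition V1 V2 V3 V4 V5 (conj Mf0 bf0).
have [mf0 _] := shift_space_int sM Mf0; have [_ mq _ _] := uq.
have sf0 := bounded_square_integrable sM (conj Mf0 bf0).
have [_ siq] := dominated_cvg2_sqint uq.
set c := sqnorm _ in mod; have c0 : 0 <= c by apply: sqnorm_ge0; exact: square_integrableB.
have bphi : ae_bounded (fun x => f0 x - q x).
  exists (Num.sqrt c); apply: filterS mod => x h.
  by rewrite -h sqrtr_sqr ger0_norm ?normc_ge0.
have bq : ae_bounded q.
  have [[a fa] [b qb]] := (bf0, bphi); exists (a + b); apply: filterS2 fa qb => x fa qb.
  have -> : q x = f0 x + - (f0 x - q x) by rewrite opprB addrC subrK.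
  by rewrite (le_trans (normcD_le _ _))// lerD// (_ : normc (- _) = normc (f0 x - q x))//; exact: normcN.
(* Both f0 and f0 - q are bounded, the latter by constancy of its modulus, so the L^2 limit q is
   bounded and returns to M. *)
have Mq : M q.
  apply: (shift_space_cvg2 sM (u := fun k x => (x : R[i]) * u k x)) => // k.
  by have [Mu _] := Vu k; exact: shift_spacez sM _ Mu.
(* If c = 0 then f0 = q is the limit of the z u_k, hence [zbar f0] is the limit of the u_k and lies
   in M, against the hypothesis. *)
have cn0 : c != 0.
  apply/eqP => c00; apply: nM; have f0q : \forall x \ae m, f0 x = q x.
    apply: filterS mod => x; rewrite c00 => /eqP.
    by rewrite expf_eq0 /= normc_eq0 subr_eq0 => /eqP.
  apply: (shift_space_cvg2 sM (u := u)); first by move=> k; have [] := Vu k.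
    have [mu _ [W [sW uW]] cu] := uq; split=> [k||//|].
    - by have [] := square_integrable_cintegrable (V1 _ (Vu k)).
    - exact: cmeasurable_zbar.
    - by exists W; split=> // k; apply: filterS (uW k) => x; rewrite Normc.normcM normc_circle mul1r.
    - apply: filterS2 cu f0q => x cu f0q; have := ccvgMl ((x : R[i])^*) cu; rewrite /zbar f0q.
      by under eq_fun do rewrite mulrA [_^* * _]mulrC circle_mulJ mul1r.
  by have [a fa] := bf0; exists a; apply: filterS fa => x; rewrite normc_zbar.
have sc : 0 < Num.sqrt c by rewrite sqrtr_gt0 lt_def cn0.
exists (fun x => (Num.sqrt c)^-1%:C * (f0 x - q x)); split.
- apply: filterS mod => x h; rewrite Normc.normcM normc_real ger0_norm ?invr_ge0 ?sqrtr_ge0//.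
  by rewrite -h sqrtr_sqr ger0_norm ?normc_ge0// mulVf//
    gt_eqF// -(ger0_norm (normc_ge0 _)) -sqrtr_sqr h.
- apply: (shift_spaceZ _ sM).
  have := shift_spaceL sM (-1) Mq Mf0; congr M; apply/funext => x.
  by rewrite rmorphN1 mulN1r addrC.
- move=> f k Mf bf k0; have := orth f k (conj Mf bf) k0.
  have cf : cintegrable (fun x => (f0 x - q x) * ((x : R[i]) ^+ k * f x)^*).
    apply: cintegrable_mulJ; first exact: square_integrableB.
    exact: (@square_integrable_expzM _ k) (V1 _ (conj Mf bf)).
  by move=> h; rewrite -[RHS](mulr0 (Num.sqrt c)^-1) -h -RintZ//; apply: eq_Rint => x; rewrite mulrA.
Qed.

(** For bounded f, orthogonality of phi to z^k f says that the coefficient of index -k of conj phi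
    times f is zero. Bounded approximation extends this to all of M, since [hardy1] is closed under
    dominated limits. *)
Lemma beurling D M : shift_space D M -> (exists2 f, M f & ~ M (zbar f)) ->
  exists phi, [/\ \forall x \ae m, normc (phi x) = 1, M phi &
    forall f, M f -> hardy1 (fun x => (phi x)^* * f x)].
Proof.
move=> sM [f1 Mf1 nM1].
have [f0 [Mf0 bf0 nM]] : exists f0, [/\ M f0, ae_bounded f0 & ~ M (zbar f0)].
  apply: contrapT => h; apply: nM1; apply: (shift_space_zbar sM _ Mf1) => f Mf bf.
  by apply: contrapT => nf; apply: h; exists f.
have [phi [phi1 Mphi orth]] := beurling_inner sM Mf0 bf0 nM; exists phi; split=> // f Mf.
have [mphi _] := shift_space_int sM Mphi; have symphi := shift_space_sym sM Mphi.
have norm_phi g : \forall x \ae m, normc ((phi x)^* * g x) = normc (g x).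
  by apply: filterS phi1 => x h; rewrite Normc.normcM normc_conj h mul1r.
have cphi g : M g -> cintegrable (fun x => (phi x)^* * g x).
  move=> Mg; have [mg cg] := shift_space_int sM Mg; apply: (@le_cintegrable _ _ g) => //.
    by apply: cmeasurableM => //; exact: cmeasurableJ.
  by apply: filterS (norm_phi g) => x ->.
have [u [Mu bu uf ulim]] := bounded_approximation sM Mf.
apply: (shift_space_dom hardy1_shift_space (u := fun k x => (phi x)^* * u k x)
  (g := fun x => 4%:C * f x)).
- move=> k; split; first exact: cphi.
    by apply: symmetricM; [exact: symmetricJ|exact: shift_space_sym sM _ (Mu k)].
  case=> n // _; rewrite -(orth (u k) n.+1)//; apply: eq_Rint => x.
  by rewrite [RHS]Re_mulJC NegzE opprK -exprnP mulrC [(phi x)^* * _]mulrC mulrA.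
- by have [] := cphi _ Mf.
- by apply: cintegrableZ; exact: shift_space_int sM _ Mf.
- by move=> k; apply: filterS2 (uf k) (norm_phi (u k)) => x h ->.
- by apply: filterS ulim => x; exact: ccvgMl.
Qed.

(** h is approached by bounded functions u_k of [hardy1], each a dominated L^2 limit of polynomials
    with nonnegative frequencies, so phi u_k is in M. The u_k are dominated by 4 |h|, whence the
    last hypothesis. *)
Lemma hardy1_mul_mem D M h phi : shift_space D M -> M phi ->
  (\forall x \ae m, normc (phi x) = 1) -> hardy1 h -> D (fun x => 4%:C * h x) ->
  M (fun x => phi x * h x).
Proof.
move=> sM Mphi phi1 hh D4; have [mphi _] := shift_space_int sM Mphi.
have [u [hu bu uh ulim]] := bounded_approximation hardy1_shift_space hh.
have [[mh _] _ _] := hh.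
apply: (shift_space_dom sM (u := fun k x => phi x * u k x)) D4 _ _.
- move=> k; have [[mu _] su u0] := hu k; have [c uc] := bu k.
  have [|v [Tv vu]] := trigpoly_dense (S := nonneg_freq) (square_integrable_bounded mu uc) su.
    by move=> n /negP; rewrite -ltNge => n0; exact: u0.
  rewrite (_ : (fun x => _) = (fun x => u k x * phi x)); last by apply/funext => x; rewrite mulrC.
  apply: (shift_spaceM_cvg2 sM _ Tv vu) => //; first by move=> n f; exact: nonneg_freq_shift sM.
  by exists 1; apply: filterS phi1 => x ->.
- exact: cmeasurableM.
- by move=> k; apply: filterS2 (uh k) phi1 => x ux px; rewrite Normc.normcM px mul1r.
- by apply: filterS ulim => x; exact: ccvgMl.
Qed.

Lemma shift_spaceV D M (n : int) f : shift_space D M -> (forall f, M f -> M (zbar f)) ->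
  M f -> M (fun x => (x : R[i]) ^ n * f x).
Proof.
move=> sM zM Mf; case: n => n; first exact: shift_spaceX sM Mf.
elim: n => [|n IH].
  by have := zM _ Mf; congr M; apply/funext => x; rewrite /zbar zbar_expz.
have := zM _ IH; congr M; apply/funext => x.
by rewrite /zbar zbar_expz mulrA -expzD.
Qed.

Lemma wiener_projection D M : shift_space D M -> (forall f, M f -> M (zbar f)) ->
  exists E : set (circle R), [/\ measurable E, {ae m, forall x, E x <-> set_star E x},
    M (\1_E : circle R -> R[i]) & forall f, M f -> \forall x \ae m, \1_E x * f x = f x].
Proof.
move=> sM zM; have [V1 V2 V3 V4 V5] := bounded_shift_space sM.
have s1 : square_integrable (fun _ : circle R => 1 : R[i]) by exact: square_integrable_cst.
have [u [q [Vu uq orth]]] := dominated_projection V1 V3 V4 s1.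
have [_ sqq] := dominated_cvg2_sqint uq; have [mq _] := sqq; have [_ _ _ ulim] := uq.
have symq : symmetric q by apply: symmetric_cvg ulim => k; apply: V2.
have kill f : M f -> ae_bounded f -> \forall x \ae m, (1 - q x) * (f x)^* = 0.
  move=> Mf bf; have sf := V1 _ (conj Mf bf).
  apply: symmetric_coef_eq0 => [||n].
  - apply: symmetricM; last by apply: symmetricJ; exact: shift_space_sym sM _ Mf.
    by apply: symmetricB => //; exact: (symmetric_cst 1).
  - by apply: cintegrable_mulJ => //; exact: square_integrableB.
  (* Here invariance under negative powers matters: z^n f stays in V for every integer n, so all
     coefficients vanish at once. *)
  - rewrite -(orth (fun x => (x : R[i]) ^ n * f x)).
      by apply: eq_Rint => x; rewrite conjcM conjc_expz mulrAC mulrA.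
    split; first exact: shift_spaceV sM zM Mf.
    have [c fc] := bf; exists c; apply: filterS fc => x.
    by rewrite Normc.normcM normc_expz mul1r.
(* Although q is not yet known to be in V, the relation for the u_k passes to the limit and gives (1
   - q) conj q = 0. *)
have q01 : \forall x \ae m, q x = 0 \/ q x = 1.
  have ku : \forall x \ae m, forall k, (1 - q x) * (u k x)^* = 0.
    by apply: ae_foralln => k; have [Mu bu] := Vu k; exact: kill.
  apply: filterS2 ku ulim => x ku ulim.
  have /eqP : (1 - q x) * (q x)^* = 0.
    apply: (ccvg_unique (u := fun k => (1 - q x) * (u k x)^*)).
      by apply: ccvgMl; exact: ccvgJ.
    by under eq_fun do rewrite ku; exact: ccvg_cst.
  rewrite mulf_eq0 subr_eq0 => /orP[/eqP<-|]; first by right.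
  by rewrite -normc_eq0 normc_conj normc_eq0 => /eqP; left.
(* Any threshold strictly between the values 0 and 1 of q would do. *)
pose E := [set x | 2^-1 < Re (q x)].
have qE : \forall x \ae m, q x = \1_E x.
  apply: filterS q01 => x; rewrite indicE => -[] qx; rewrite qx.
    by rewrite memNset//= /E /= qx /= => h; have : 0 < 2^-1 :> R by []; rewrite ltNge (ltW h).
  by rewrite mem_set//= /E /= qx /= invf_lt1// ltr1n.
have mE : measurable E.
  have -> : E = (fun x => Re (q x)) @^-1` `]2^-1, +oo[.
    by apply/seteqP; split => x /=; rewrite in_itv/= andbT.
  by rewrite -[X in measurable X]setTI; exact: mq.1.
exists E; split=> //.
- apply: filterS symq => x qx; have {}qx : E x <-> E (circle_conj x) by rewrite /E /= qx /star ReJ.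
  split=> [/qx Ex|[y Ey yx]]; first by exists (circle_conj x) => //; exact: circle_conjK.
  by apply/qx; rewrite -yx circle_conjK.
- have Mq : M q.
    apply: (shift_space_cvg2 sM _ uq); first by move=> k; have [] := Vu k.
    by exists 1; apply: filterS q01 => x [] ->; rewrite ?Normc.normc0 ?Normc.normc1.
  by apply: (shift_space_ae sM Mq) qE; exact: cmeasurable_indic.
- move=> f Mf; have [v [Mv bv _ vlim]] := bounded_approximation sM Mf.
  have kv : \forall x \ae m, forall k, (1 - q x) * (v k x)^* = 0.
    by apply: ae_foralln => k; exact: kill.
  apply: filterS3 qE kv vlim => x <- kv vlim.
  have /eqP : (1 - q x) * (f x)^* = 0.
    apply: (ccvg_unique (u := fun k => (1 - q x) * (v k x)^*)).
      by apply: ccvgMl; exact: ccvgJ.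
    by under eq_fun do rewrite kv; exact: ccvg_cst.
  rewrite mulf_eq0 subr_eq0 => /orP[/eqP<-|]; first by rewrite mul1r.
  by rewrite -normc_eq0 normc_conj normc_eq0 => /eqP ->; rewrite mulr0.
Qed.

(** With all powers of z available, genuine truncation is possible: h cut off where |h| > k is
    bounded and symmetric, hence a dominated L^2 limit of trigonometric polynomials, and these act
    on the indicator of E within M. *)
Lemma indic_mul_mem p M (E : set (circle R)) h : (1 <= p)%E -> shift_space (Lp p) M ->
  (forall f, M f -> M (zbar f)) -> measurable E -> M (\1_E : circle R -> R[i]) ->
  Lp p h -> symmetric h -> M (fun x => \1_E x * h x).
Proof.
move=> p1 sM zM mE ME Lh symh; have [mh _] := Lp_cintegrable p1 Lh.
have bE : ae_bounded (\1_E : circle R -> R[i]).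
  exists 1; apply: aeW => x; rewrite indicE; case: (_ \in _); first by rewrite Normc.normc1.
  by rewrite Normc.normc0.
pose w (k : nat) x : R := \1_[set x | normc (h x) <= k%:R] x.
have mw k : cmeasurable (fun x => (w k x)%:C).
  apply: cmeasurableC; apply: measurable_indic.
  have -> : [set x | normc (h x) <= k%:R] = (fun x => normc (h x)) @^-1` `]-oo, k%:R].
    by apply/seteqP; split => x /=; rewrite in_itv.
  by rewrite -[X in measurable X]setTI; exact: (measurable_normc mh).
have symw k : symmetric (fun x => (w k x)%:C).
  apply: symmetric_real; apply: filterS (symmetric_normc symh) => x hx.
  by rewrite /w !indicE; congr ((nat_of_bool _)%:R); apply/idP/idP; rewrite !inE /= hx.
have w1 k x : normc (w k x)%:C <= 1.
  by rewrite normc_real /w indicE; case: (_ \in _); rewrite ?normr0 ?normr1.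
have wh k x : normc ((w k x)%:C * h x) <= normc (h x).
  by rewrite Normc.normcM ler_piMl ?normc_ge0.
apply: (shift_space_dom sM (u := fun k x => \1_E x * ((w k x)%:C * h x))) Lh _ _.
- move=> k; have mwh : cmeasurable (fun x => (w k x)%:C * h x) by exact: cmeasurableM.
  have bwh : \forall x \ae m, normc ((w k x)%:C * h x) <= k%:R.
    apply: aeW => x; rewrite /w indicE; case: (boolP (_ \in _)) => [/set_mem|_].
      by rewrite /= rmorph1 mul1r.
    by rewrite rmorph0 mul0r Normc.normc0.
  have [|v [Tv vwh]] := trigpoly_dense (S := setT) (square_integrable_bounded mwh bwh)
    (symmetricM (symw k) symh); first by move=> n /(_ I).
  rewrite (_ : (fun x => _) = (fun x => (w k x)%:C * h x * \1_E x)); last first.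
    by apply/funext => x; rewrite mulrC.
  apply: (shift_spaceM_cvg2 sM _ Tv vwh) => //.
    by move=> n f _ Mf; exact: shift_spaceV sM zM Mf.
  by exists k%:R.
- by apply: cmeasurableM => //; exact: cmeasurable_indic.
- move=> k; apply: aeW => x; rewrite Normc.normcM (le_trans _ (wh k x))// ler_piMl ?normc_ge0//.
  by rewrite indicE; case: (_ \in _); rewrite ?Normc.normc1 ?Normc.normc0.
- apply: aeW => x; apply: ccvgMl; rewrite -[X in ccvg _ X]mul1r; apply: ccvgM; last exact: ccvg_cst.
  apply: normc_ccvg; apply: cvg_near_cst; near=> k.
  have : normc (h x) <= k%:R by near: k; exact: nbhs_infty_ger.
  by move=> hk; rewrite /w indicE mem_set// rmorph1 subrr Normc.normc0.
Unshelve. all: by end_near. Qed.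

Lemma fourier_coef f n : symmetric f -> cintegrable f -> fourier f n = (coef f n)%:C.
Proof.
move=> sf cf; apply: cintegral_symmetric; last exact: cintegrable_expzM.
by apply: symmetricM => //; exact: symmetric_expz.
Qed.

Lemma LprP p f : Lpr p f <-> Lp p f /\ symmetric f.
Proof.
by split=> -[Lf sf]; split=> //; apply: filterS sf => x; [move=> /(_ I)|].
Qed.

Lemma HprP p f : (1 <= p)%E -> Hpr p f <-> Lp p f /\ hardy1 f.
Proof.
move=> p1; split=> [[[Lf f0] /LprP[_ sf]]|[Lf [cf sf f0]]].
  have cf := Lp_cintegrable p1 Lf; split=> //; split=> // n n0.
  by have := f0 n n0; rewrite fourier_coef// => -[].
split; last exact/LprP.
by split=> // n n0; rewrite fourier_coef// f0.
Qed.

(** Since 1 is in the Hardy space, phi belongs to M. If zM = M then phi = z phi h with h in the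
    Hardy space, so z h = 1 and the coefficient of h at -1 would be 1 instead of 0. *)
Lemma mulset_hardy_simply p phi : (1 <= p)%E -> unimodular phi ->
  simply_invariant (mulset phi (Hpr p)).
Proof.
move=> p1 [mphi phi1] dbl; set M := mulset phi (Hpr p) in dbl.
have h1 : Hpr p (fun _ : circle R => 1 : R[i]).
  apply/(HprP _ p1); split.
    apply: (@Lp_bounded _ _ _ 1); [exact: p1|exact: cmeasurable_cst|].
    by apply: aeW => x; rewrite Normc.normc1.
  split; [exact: cintegrable_cst|exact: (symmetric_cst 1)|].
  by move=> n n0; have := @coef_expz R 0 n; rewrite eq_sym lt_eqF// => <-; apply: eq_Rint.
have Mphi : M phi by split=> //; exists (fun=> 1) => //; apply: aeW => x _ /=; rewrite mulr1.
rewrite -dbl in Mphi; have [_ [g [mg [h Hh gh]] phig]] := Mphi.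
have [Lh [ch sh /(_ (-1) isT) hN1]] := (HprP _ p1).1 Hh.
suff E : Rint (fun x => h x * (x : R[i]) ^ (- (-1))) = Rint (fun _ : circle R => 1%:C).
  by have := oner_neq0 R; rewrite -(Rint_cst 1) -E; move: hN1; rewrite /coef => ->; rewrite eqxx.
apply: Rint_ae; [|exact: cmeasurable_cst|].
  by apply: cmeasurableM; [have [] := ch|exact: cmeasurable_expz].
apply: filterS3 phi1 gh phig => x px /(_ I) gx /(_ I) phix; congr Re.
have pn0 : phi x != 0 by rewrite -normc_eq0 px oner_neq0.
apply: (mulfI pn0); rewrite mulr1 [RHS]phix /= gx /= /zfun opprK expr1z.
by rewrite [RHS]mulrC mulrA.
Qed.

End invariant_subspaces.

(** * Characterization of the simply and the doubly invariant subspaces *)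

Theorem theorem3p4 (R : realType) (p : \bar R) (M : set (circle R -> R[i]))
    (p1 : (1 <= p)%E) (Msub : real_subspace p M) (Mclosed : Lp_closed p M)
    (Minv : mulset zfun M `<=` M) :
  (simply_invariant M <->
    exists phi : circle R -> R[i],
      [/\ unimodular phi, phi = star phi %[ae circle_measure] &
          M = mulset phi (Hpr p)]) /\
  (doubly_invariant M <->
    exists E : set (circle R),
      [/\ measurable E,
          {ae circle_measure, forall x, E x <-> set_star E x} &
          M = mulset (\1_E : circle R -> R[i]) (Lpr p)]).
Proof.
have sM := real_subspace_shift_space p1 Msub Mclosed Minv.
have Mmeas f : M f -> cmeasurable f by move=> /(shift_space_int sM)[].
split; split.
- move=> simpleM.
  (* Were M stable under multiplication by the conjugate of z, every f in M would be z times an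
     element of M, and M would be doubly invariant. *)
  have ex : exists2 f, M f & ~ M (zbar f).
    apply: contrapT => nex; apply: simpleM; apply: mulset_zfun => // f Mf; split; first exact: Mmeas.
    by apply: contrapT => nMf; apply: nex; exists f.
  have [phi [phi1 Mphi hphi]] := beurling sM ex; exists phi; split.
  + by split=> //; exact: Mmeas.
  + by apply: filterS (shift_space_sym sM Mphi) => x.
  + apply/seteqP; split=> [f Mf|f [mf [h Hh fh]]].
      have mphif : cmeasurable (fun x => (phi x)^*%C * f x).
        by apply: cmeasurableM; [apply: cmeasurableJ|]; exact: Mmeas.
      split; first exact: Mmeas.
      (* The quotient of f by phi, as phi has modulus 1; it stays in L^p because it has the modulus
         of f. *)
      exists (fun x => (phi x)^*%C * f x).
        apply/(HprP _ p1); split; last exact: hphi.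
        apply: (le_Lp p1 mphif (shift_space_sub sM Mf)).
        by apply: filterS phi1 => x h; rewrite Normc.normcM normc_conj h mul1r.
      by apply: filterS phi1 => x h _; rewrite /= mulrA mulJE h expr1n mul1r.
    have [Lh hh] := (HprP _ p1).1 Hh.
    have Mh := hardy1_mul_mem sM Mphi phi1 hh (LpZ 4%:C%C p1 Lh).
    by apply: (shift_space_ae sM Mh) => //; apply: filterS fh => x /(_ I).
- by move=> [phi [uphi _ ->]]; exact: mulset_hardy_simply.
- move=> dblM; have zM f : M f -> M (zbar f) by exact: mulset_zfun_zbar sM dblM.
  have [E [mE symE ME EM]] := wiener_projection sM zM; exists E; split=> //.
  apply/seteqP; split=> [f Mf|f [mf [h /LprP[Lh symh] fh]]].
    split; first exact: Mmeas.
    exists f.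
      by apply/LprP; split; [exact: shift_space_sub sM _ Mf|exact: shift_space_sym sM _ Mf].
    by apply: filterS (EM _ Mf) => x.
  have Mh := indic_mul_mem p1 sM zM mE ME Lh symh.
  by apply: (shift_space_ae sM Mh) => //; apply: filterS fh => x /(_ I).
- move=> [E [mE _ defM]]; apply: mulset_zfun => // f Mf; split; first exact: Mmeas.
  have mzf : cmeasurable (zbar f) by apply: cmeasurable_zbar; exact: Mmeas.
  move: Mf; rewrite defM => -[mf [h /LprP[Lh symh] fh]]; split=> //.
  (* Multiplication by the conjugate of z preserves L^p and symmetry, and commutes with the
     indicator. *)
  exists (zbar h).
    apply/LprP; split.
      apply: (le_Lp p1 _ Lh); first by apply: cmeasurable_zbar; have [] := Lp_cintegrable p1 Lh.
      by apply: aeW => x; rewrite normc_zbar.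
    apply: symmetricM => //; apply: symmetricJ.
    by have := @symmetric_expz R 1; under eq_fun do rewrite expr1z.
  by apply: filterS fh => x /(_ I) fx _; rewrite /zbar fx /= mulrCA.
Qed.
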